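(* There exist an AF $C^*$-algebra $\mathcal A$, an uncountable totally ordered set $J$, and a family $(\mathcal I_j)_{j\in J}$ of ideals of $\mathcal A$ such that $\mathcal I_j\subseteq\mathcal I_{j'}$ whenever $j\le j'$, each $\mathcal I_j$ is a separable stable AF-algebra, $\mathcal A$ is the inductive limit of this increasing chain (i.e. $\mathcal A=\overline{\bigcup_{j\in J}\mathcal I_j}$), and $\mathcal A$ is not stable.
   Context: Ideals are closed two-sided ideals. A $C^*$-algebra is approximately finite-dimensional (AF) if it contains a directed (by inclusion) family of finite-dimensional $C^*$-subalgebras whose union is dense in it (separability is not assumed). A $C^*$-algebra $\mathcal A$ is stable if it is $*$-isomorphic to $\mathcal A\otimes\mathcal K(\ell_2)$, where $\mathcal K(\ell_2)$ is the algebra of compact operators on the separable infinite-dimensional Hilbert space $\ell_2$. *)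

(* Defs.v *)
From HB Require Import structures.
From mathcomp Require Export all_boot all_order all_algebra.
From mathcomp Require Export complex.
From mathcomp Require Export all_classical all_reals all_analysis.
Import Order.TTheory GRing.Theory Num.Theory.
Import numFieldNormedType.Exports.

Set Implicit Arguments.
Unset Strict Implicit.
Unset Printing Implicit Defensive.

Local Open Scope classical_set_scope.
Local Open Scope ring_scope.
Local Open Scope complex_scope.

(* C*-algebras need not have a unit, so the product is not the product of a
   MathComp ring.  The scalars are the complex numbers R[i] over R : realType;
   norms take their values in R[i], where 0 <= z implies that z is real. *)
HB.mixin Record isCStarAlgebra (R : realType) A
    of CompleteNormedModule R[i] A := {
  cmul : A -> A -> A ;
  star : A -> A ;
  cmulA : forall x y z, cmul x (cmul y z) = cmul (cmul x y) z ;
  cmul_linearl : forall c x y z,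
    cmul (c *: x + y) z = c *: cmul x z + cmul y z ;
  cmul_linearr : forall c x y z,
    cmul x (c *: y + z) = c *: cmul x y + cmul x z ;
  cmul_norm : forall x y, `|cmul x y| <= `|x| * `|y| ;
  starK : forall x, star (star x) = x ;
  star_conjlinear : forall (c : R[i]) x y,
    star (c *: x + y) = Num.conj c *: star x + star y ;
  starM : forall x y, star (cmul x y) = cmul (star y) (star x) ;
  cstar_identity : forall x, `|cmul (star x) x| = `|x| ^+ 2
}.

#[short(type="cstarAlgType")]
HB.structure Definition CStarAlgebra (R : realType) :=
  {A of isCStarAlgebra R A & CompleteNormedModule R[i] A}.

HB.mixin Record isHilbert (R : realType) H of CompleteNormedModule R[i] H := {
  inner : H -> H -> R[i] ;
  inner_linearl : forall (c : R[i]) x y z,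
    inner (c *: x + y) z = c * inner x z + inner y z ;
  inner_conj : forall x y, inner y x = Num.conj (inner x y) ;
  inner_norm : forall x, inner x x = `|x| ^+ 2
}.

#[short(type="hilbertType")]
HB.structure Definition Hilbert (R : realType) :=
  {H of isHilbert R H & CompleteNormedModule R[i] H}.

Section CStarAlgebras.
Variable R : realType.
Implicit Types A B K T : cstarAlgType R.

Definition star_hom A B (f : {linear A -> B}) : Prop :=
  (forall x y, f (cmul x y) = cmul (f x) (f y)) /\
  (forall x, f (star x) = star (f x)).

Definition star_isomorphic A B : Prop :=
  exists f : {linear A -> B}, star_hom f /\ bijective f.

Definition linear_subspace A (S : set A) : Prop :=
  S 0 /\ (forall (c : R[i]) x y, S x -> S y -> S (c *: x + y)).

Definition cstar_subalgebra A (S : set A) : Prop :=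
  [/\ linear_subspace S, (forall x y, S x -> S y -> S (cmul x y)),
      (forall x, S x -> S (star x)) & closed S].

Definition closed_ideal A (S : set A) : Prop :=
  [/\ linear_subspace S, (forall a x, S x -> S (cmul a x)),
      (forall a x, S x -> S (cmul x a)) & closed S].

Definition finite_dim A (S : set A) : Prop :=
  exists (n : nat) (v : 'I_n -> A), forall x, S x ->
    exists c : 'I_n -> R[i], x = \sum_(i < n) c i *: v i.

Definition AF A : Prop :=
  exists F : set (set A),
    [/\ F !=set0,
        (forall S, F S -> cstar_subalgebra S /\ finite_dim S),
        (forall S1 S2, F S1 -> F S2 ->
           exists S3, [/\ F S3, S1 `<=` S3 & S2 `<=` S3]) &
        closure (\bigcup_(S in F) S) = setT].

Definition separable A : Prop :=
  exists D : set A, countable D /\ closure D = setT.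

(* A Hilbert space with an orthonormal basis indexed by the natural numbers
   is, through the coordinates in this basis, the Hilbert space l_2. *)
Definition is_l2 (H : hilbertType R) : Prop :=
  exists e : nat -> H,
    (forall i j, inner (e i) (e j) = (i == j)%:R) /\
    closure [set x | exists (n : nat) (c : nat -> R[i]),
                       x = \sum_(i < n) c i *: e i] = setT.

Definition compact_operator (H : hilbertType R) (f : {linear H -> H}) : Prop :=
  compact (closure (f @` [set x | `|x| <= 1])).

(* rho identifies K with the compact operators on H: pointwise linear
   structure, composition, adjoint, and operator norm (the least bound). *)
Definition compact_operator_algebra (H : hilbertType R) K
    (rho : K -> {linear H -> H}) : Prop :=
  [/\ (forall f : {linear H -> H},
         compact_operator f <-> exists a, rho a =1 f),
      (forall (c : R[i]) a b x, rho (c *: a + b) x = c *: rho a x + rho b x),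
      (forall a b x, rho (cmul a b) x = rho a (rho b x)),
      (forall a x y, inner (rho (star a) x) y = inner x (rho a y)) &
      (forall a, (forall x, `|rho a x| <= `|a| * `|x|) /\
         forall M : R[i], 0 <= M -> (forall x, `|rho a x| <= M * `|x|) ->
           `|a| <= M)].

Definition is_compacts_l2 K : Prop :=
  exists (H : hilbertType R) (rho : K -> {linear H -> H}),
    is_l2 H /\ compact_operator_algebra rho.

(* The sum of the elementary tensors a (x) b, (a, b) in s, vanishes in the
   algebraic tensor product: by its universal property, this says that every
   bilinear map sends the formal sum to 0. *)
Definition tensor_sum_eq0 A B (s : seq (A * B)) : Prop :=
  forall (W : lmodType R[i]) (beta : {bilinear A -> B -> W}),
    \sum_(p <- s) beta p.1 p.2 = 0.

(* T is the completion of the algebraic tensor product of A and B, with its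
   usual *-algebra structure, in a C*-norm; tau a b is a (x) b.  When B is
   the algebra of compact operators, which is nuclear, there is only one
   C*-norm, so T is then unique up to *-isomorphism. *)
Definition is_tensor_product A B T : Prop :=
  exists tau : {bilinear A -> B -> T},
    [/\ (forall a a' b b',
           cmul (tau a b) (tau a' b') = tau (cmul a a') (cmul b b')),
        (forall a b, star (tau a b) = tau (star a) (star b)),
        (forall s : seq (A * B),
           \sum_(p <- s) tau p.1 p.2 = 0 -> tensor_sum_eq0 s) &
        closure [set t | exists s : seq (A * B),
                           t = \sum_(p <- s) tau p.1 p.2] = setT].

Definition stable A : Prop :=
  exists K T, [/\ is_compacts_l2 K, is_tensor_product A K T &
                  star_isomorphic A T].

(* S, with the operations and norm of A, is a C*-algebra with property P: it
   is the range of an injective (hence isometric) *-homomorphism from such an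
   algebra.  Meant for P invariant under *-isomorphism. *)
Definition as_cstar_algebra A (S : set A) (P : cstarAlgType R -> Prop) : Prop :=
  exists B (f : {linear B -> A}),
    [/\ star_hom f, injective f, range f = S & P B].

End CStarAlgebras.

(* Main.v *)
(** A datum [t] is a function [f t : nat -> nat] with unitaries [u t n] of l_2,
    each commuting with the projections onto the first basis vectors from some
    rank on.  In the algebra of bounded families of operators indexed by
    N x N, the families that vanish off the graph of [f t] and are equal to
    [u t n * c * (u t n)^*] at [(n, f t n)], for a compact [c], form a copy of
    the compact operators.  For a set X of data whose graphs are pairwise almost
    disjoint, let A(X) be generated by these copies and the families of finite
    support with compact values.  It is AF, and an ideal of A(Y) when X is
    contained in Y.  If X is countable, A(X) is separable; it is also stable,
    since l_2 (x) l_2 = l_2 and, after conjugation at each point of N x N by the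
    unitary of the first datum whose graph passes through it, every element of
    the dense subalgebra is eventually constant along each graph.

    As in Luzin's construction of an almost disjoint family, the data are
    arranged in an uncountable chain with countable initial segments such that
    every [t] has an injective [h] on its predecessors with the property: for
    [s < t] and [j <= h s] there is [n >= h s] with [f t n = f s n] and
    [u t n = u s n * g j].  Here [g] is a sequence of unitaries such that the
    [g j e_0] norm all finitely supported vectors up to a factor.

    Were the union A stable, then every idempotent [x] of A would be close to
    some [s] with a companion [s'], of a type [m : nat], such that
    [s'^* s' = s^* s], whereas [s_1^* s_2' = 0] for pairs of the same type.
    Apply this to [x_t = u t n * e_00 * (u t n)^*] on the graph of [f t]: up to
    a small error, [(u t n)^* s_t' (u t n) e_0] is eventually a constant vector
    [w_t].  Uncountably many [t] have the same type and a common [j] with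
    [|<w_t, g j e_0>| >= 1/4].  Some [t] among them has infinitely many of them
    below it, so one has [f t n = f r n], [u t n = u r n * g j] for such an [r]
    and a large [n], where [s_t^* s_r' = 0] contradicts the choice of [j]. *)
From HB Require Import structures.
From mathcomp Require Import ring lra zify.
Require Import Defs.
Import Order.TTheory GRing.Theory Num.Theory.
Import numFieldNormedType.Exports.
Set Implicit Arguments.
Unset Strict Implicit.
Unset Printing Implicit Defensive.
Local Open Scope classical_set_scope.
Local Open Scope ring_scope.
Local Open Scope complex_scope.

(** * Norms and limits *)

(** Stability supplies a purely algebraic isomorphism and an unspecified C*-norm. Estimates across
    them use vector states: if [|k| < 1], then [1 - k^* k] is a square, so left multiplication by
    [k] does not increase any GNS seminorm. Such bounds need a fixed right factor; an idempotent
    provides it, since [x = x x]. A companion [s'] comes from a partial isometry of the compacts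
    that moves the first [m] basis vectors to the next [m]. As [m] is its only parameter, there are
    countably many types, too few for an uncountable family. A countable family escapes this: in an
    enumeration each datum has finitely many predecessors, and outside a finite square it is apart
    from them. That graphs meet is not yet a contradiction: untwisted, [s_t^* s_r' = 0] only says
    that [w_r] is nearly orthogonal to [e_0], which it may well be. The twist by [g j] replaces
    [e_0] by a vector that [w_r] cannot avoid. The index set is N x N because a new function then
    has infinitely many values to choose from at each [n], while only finitely many old ones must be
    avoided there. The unitaries commute with the large cuts so that conjugation preserves finite
    matrices; the AF structure rests on this. *)

(* Norms take their values in [R[i]]; [nm] is the real number behind. *)
Definition nm (R : realType) (V : normedZmodType R[i]) (x : V) : R :=
  complex.Re `|x|.

Section Norm.
Variable R : realType.

Lemma nmE (V : normedZmodType R[i]) (x : V) : `|x| = (nm x)%:C.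
Proof. by rewrite /nm RRe_real// ger0_real. Qed.

Lemma nm_ge0 (V : normedZmodType R[i]) (x : V) : 0 <= nm x.
Proof. by rewrite -lecR -nmE normr_ge0. Qed.

Lemma nmD (V : normedZmodType R[i]) (x y : V) : nm (x + y) <= nm x + nm y.
Proof. by rewrite -lecR rmorphD /= -!nmE ler_normD. Qed.

Lemma nmN (V : normedZmodType R[i]) (x : V) : nm (- x) = nm x.
Proof. by rewrite /nm normrN. Qed.

Lemma nmB (V : normedZmodType R[i]) (x y : V) : nm (x - y) = nm (y - x).
Proof. by rewrite -nmN opprB. Qed.

Lemma nm0 (V : normedZmodType R[i]) : nm (0 : V) = 0.
Proof. by rewrite /nm normr0. Qed.

Lemma nm_eq0 (V : normedZmodType R[i]) (x : V) : nm x = 0 -> x = 0.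
Proof. by move=> h; apply: normr0_eq0; rewrite nmE h. Qed.

Lemma nm_le0 (V : normedZmodType R[i]) (x : V) : nm x <= 0 -> x = 0.
Proof.
by move=> h; apply: nm_eq0; apply/eqP; rewrite eq_le h nm_ge0.
Qed.

Lemma nmZ (V : normedModType R[i]) (c : R[i]) (x : V) : nm (c *: x) = nm c * nm x.
Proof. by apply: complexI; rewrite rmorphM /= -!nmE normrZ. Qed.

Lemma nmM (x y : R[i]) : nm (x * y) = nm x * nm y.
Proof. by apply: complexI; rewrite rmorphM /= -!nmE normrM. Qed.

Lemma nm1 : nm (1 : R[i]) = 1.
Proof. by rewrite /nm normr1. Qed.

Lemma nmR (x : R) : nm x%:C = `|x|.
Proof. by rewrite /nm normc_def /= expr0n addr0 sqrtr_sqr. Qed.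

Lemma nm_conj (x : R[i]) : nm (Num.conj x) = nm x.
Proof. by rewrite /nm norm_conjC. Qed.

Lemma nm_sqr (x : R[i]) : (nm x ^+ 2)%:C = x * Num.conj x.
Proof. by rewrite rmorphXn /= -nmE normCK. Qed.

Lemma nm_triangle (V : normedZmodType R[i]) (z x y : V) :
  nm (x - y) <= nm (x - z) + nm (z - y).
Proof. by apply: le_trans (nmD _ _); rewrite addrA subrK. Qed.

Lemma nm_triangle_le (V : normedZmodType R[i]) (z x y : V) p q r :
  nm (x - z) <= p -> nm (z - y) <= q -> p + q <= r -> nm (x - y) <= r.
Proof. by move=> hp hq; apply/le_trans/(le_trans (nm_triangle z x y) (lerD hp hq)). Qed.

Lemma nm_triangle2 (V : normedZmodType R[i]) (z x y : V) d :
  nm (x - z) <= d / 2 -> nm (z - y) <= d / 2 -> nm (x - y) <= d.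
Proof. by move=> hp hq; apply: nm_triangle_le hp hq _; lra. Qed.

Lemma nmD_le (V : normedZmodType R[i]) (x y : V) p q r :
  nm x <= p -> nm y <= q -> p + q <= r -> nm (x + y) <= r.
Proof. by move=> hp hq; apply/le_trans/(le_trans (nmD x y) (lerD hp hq)). Qed.

Lemma nm_small (V : normedZmodType R[i]) (x : V) :
  (forall e, 0 < e -> nm x <= e) -> x = 0.
Proof. by move=> h; apply: nm_le0; apply/ler_addgt0Pl => e /h; rewrite addr0. Qed.

Lemma nm_sum (V : normedZmodType R[i]) (I : Type) (s : seq I) P (F : I -> V) :
  nm (\sum_(i <- s | P i) F i) <= \sum_(i <- s | P i) nm (F i).
Proof.
elim/big_ind2 : _ => //; first by rewrite nm0.
by move=> a b c d h1 h2; apply: le_trans (nmD _ _) (lerD h1 h2).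
Qed.

Lemma conjRC (x : R) : Num.conj x%:C = x%:C :> R[i].
Proof. by apply/conj_Creal/complex_realP; exists x. Qed.

Lemma Re_nm (x : R[i]) : complex.Re x <= nm x.
Proof.
apply: le_trans (ler_norm _) _.
by have := normc_ge_Re x; rewrite nmE lecR.
Qed.

End Norm.

Section Topology.
Variable R : realType.
Variable V : normedModType R[i].
Implicit Types (S D : set V) (x : V).

Lemma closure_nm D x :
  closure D x <-> forall e, 0 < e -> exists2 y, D y & nm (x - y) < e.
Proof.
split=> [cl e e0|h].
  have : nbhs x (ball x e%:C) by apply: nbhsx_ballx; rewrite ltcR.
  by move=> /cl[y [Dy]]; rewrite -ball_normE /= nmE ltcR; exists y.
move=> B /nbhs_ballP[e /= e0 eB].
have e1 : e = (complex.Re e)%:C by rewrite RRe_real// gtr0_real.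
have [|y Dy xy] := h (complex.Re e); first by rewrite -ltcR -e1.
exists y; split=> //; apply: eB; rewrite -ball_normE /= nmE e1 ltcR //.
Qed.

Lemma closed_nm S :
  (forall x, (forall e, 0 < e -> exists2 y, S y & nm (x - y) < e) -> S x) ->
  closed S.
Proof. by move=> h x /closure_nm; apply: h. Qed.

Lemma closedE S x : closed S ->
  (forall e, 0 < e -> exists2 y, S y & nm (x - y) < e) -> S x.
Proof. by move=> cS h; apply: cS; apply/closure_nm. Qed.

End Topology.

Definition seq_cauchy (R : realType) (V : normedZmodType R[i]) (u : nat -> V) :=
  forall e : R, 0 < e ->
    exists n0, forall n m, (n0 <= n)%N -> (n0 <= m)%N -> nm (u n - u m) <= e.

Definition seq_lim (R : realType) (V : normedZmodType R[i]) (u : nat -> V) l :=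
  forall e : R, 0 < e -> exists n0, forall n, (n0 <= n)%N -> nm (u n - l) <= e.

Section Completeness.
Variable R : realType.

Lemma inv_small (e : R) : 0 < e ->
  exists n0, forall n, (n0 <= n)%N -> n.+1%:R^-1 <= e.
Proof.
move=> e0; exists (Num.truncn e^-1) => n hn.
rewrite -[e]invrK lef_pV2 ?posrE ?invr_gt0//.
apply/ltW; apply: lt_le_trans (truncnS_gt _) _; by rewrite ler_nat ltnS.
Qed.

Lemma seq_lim_exists (V : completeNormedModType R[i]) (u : nat -> V) :
  seq_cauchy u -> exists l, seq_lim u l.
Proof.
move=> cu.
have : cauchy (u @ \oo).
  apply/cauchy_ballP => e e0.
  have e1 : e = (complex.Re e)%:C by rewrite RRe_real// gtr0_real.
  have re0 : 0 < complex.Re e by rewrite -ltcR -e1.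
  have [n0 h] := cu (complex.Re e / 2) ltac:(lra).
  exists ([set x | exists2 n, (n0 <= n)%N & u n = x],
          [set x | exists2 n, (n0 <= n)%N & u n = x]) => /=.
    by split; exists n0 => // n /= hn; exists n.
  move=> [x y] /= [[n hn <-] [m hm <-]].
  rewrite -ball_normE /= nmE e1 ltcR; apply: le_lt_trans (h _ _ hn hm) _; lra.
move=> /cauchy_cvg /cvg_ex[l hl]; exists l => e e0.
move/cvgrPdist_le : hl => /(_ e%:C); rewrite ltcR => /(_ e0)[n0 _ h].
by exists n0 => n hn; rewrite nmB -lecR -nmE; apply: h.
Qed.

(** Sequences suffice: a Cauchy filter contains a ball of each radius [1/(n+1)], the centres form a
    Cauchy sequence, and its limit is the limit of the filter. *)
Lemma complete_of_seq (V : normedModType R[i]) :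
  (forall u : nat -> V, seq_cauchy u -> exists l, seq_lim u l) ->
  forall F : set_system V, ProperFilter F -> cauchy F -> cvg F.
Proof.
move=> hV F FF /cauchyP cF.
have /choice[a ha] : forall n : nat, exists x, F (ball x (n.+1%:R^-1 : R)%:C).
  by move=> n; apply: cF; rewrite ltcR invr_gt0.
have [l hl] : exists l, seq_lim a l.
  apply: hV => e e0; have [n0 h] := inv_small (e := e / 2) ltac:(lra).
  exists n0 => n m hn hm.
  have [z [zn zm]] := filter_ex (filterI (ha n) (ha m)).
  move: zn zm; rewrite -!ball_normE /= !nmE !ltcR (nmB (a m)) => zn zm.
  have {}zn : nm (a n - z) < _ := lt_le_trans zn (h _ hn).
  have {}zm : nm (z - a m) < _ := lt_le_trans zm (h _ hm).
  have := nm_triangle z (a n) (a m); lra.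
apply/cvg_ex; exists l; apply/cvgrPdist_le => e e0.
have e1 : e = (complex.Re e)%:C by rewrite RRe_real// gtr0_real.
have re0 : 0 < complex.Re e by rewrite -ltcR -e1.
have [n0 h0] := inv_small (e := complex.Re e / 2) ltac:(lra).
have [n1 h1] := hl (complex.Re e / 2) ltac:(lra).
apply: filterS (ha (maxn n0 n1)) => y.
rewrite -!ball_normE /= !nmE e1 ltcR lecR => hy.
have {}hy : nm (_ - y) < _ := lt_le_trans hy (h0 _ (leq_maxl n0 n1)).
have := nm_triangle (a (maxn n0 n1)) l y.
rewrite (nmB l (a _)).
have := h1 _ (leq_maxr n0 n1); lra.
Qed.

End Completeness.

(** * The Hilbert space l_2 *)

Section SeqLim.
Variable R : realType.

Lemma real_seq_lim_exists (u : nat -> R) :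
  (forall e, 0 < e -> exists n0, forall n m,
     (n0 <= n)%N -> (n0 <= m)%N -> `|u n - u m| <= e) ->
  exists l, forall e, 0 < e -> exists n0, forall n, (n0 <= n)%N -> `|u n - l| <= e.
Proof.
move=> cu.
have : cauchy (u @ \oo).
  apply/cauchy_ballP => e e0.
  have [n0 h] := cu (e / 2) ltac:(by rewrite divr_gt0).
  exists ([set x | exists2 n, (n0 <= n)%N & u n = x],
          [set x | exists2 n, (n0 <= n)%N & u n = x]) => /=.
    by split; exists n0 => // n /= hn; exists n.
  move=> [x y] /= [[n hn <-] [m hm <-]].
  rewrite -ball_normE /=; apply: le_lt_trans (h _ _ hn hm) _.
  by rewrite ltr_pdivrMr// ltr_pMr// ltr1n.
move=> /cauchy_cvg /cvg_ex[l hl]; exists l => e e0.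
move/cvgrPdist_le : hl => /(_ e e0)[n0 _ h].
by exists n0 => n hn; rewrite distrC; apply: h.
Qed.

Lemma nm_Re_Im (z : R[i]) : nm z <= `|complex.Re z| + `|complex.Im z|.
Proof.
case: z => a b /=; have -> : a +i* b = a%:C + 'i%C * b%:C by rewrite [LHS]complexE.
apply: le_trans (nmD _ _) _; rewrite nmM !nmR.
suff -> : nm ('i%C : R[i]) = 1 by rewrite mul1r.
by rewrite /nm normc_def /= expr0n expr1n add0r sqrtr1.
Qed.

Lemma normr_Re_le (z : R[i]) : `|complex.Re z| <= nm z.
Proof. by have := normc_ge_Re z; rewrite nmE lecR. Qed.

Lemma normr_Im_le (z : R[i]) : `|complex.Im z| <= nm z.
Proof.
rewrite -normrN -ReiNIm; apply: le_trans (normr_Re_le _) _; rewrite nmM.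
suff -> : nm ('i%C : R[i]) = 1 by rewrite mulr1.
by rewrite /nm normc_def /= expr0n expr1n add0r sqrtr1.
Qed.

Lemma complex_seq_lim (u : nat -> R[i]) : seq_cauchy u -> exists l, seq_lim u l.
Proof.
move=> cu.
have [a ha] : exists l, forall e, 0 < e ->
    exists n0, forall n, (n0 <= n)%N -> `|complex.Re (u n) - l| <= e.
  apply: real_seq_lim_exists => e /cu[n0 h]; exists n0 => n m hn hm.
  by rewrite -raddfB; apply: le_trans (normr_Re_le _) (h _ _ hn hm).
have [b hb] : exists l, forall e, 0 < e ->
    exists n0, forall n, (n0 <= n)%N -> `|complex.Im (u n) - l| <= e.
  apply: real_seq_lim_exists => e /cu[n0 h]; exists n0 => n m hn hm.
  by rewrite -raddfB; apply: le_trans (normr_Im_le _) (h _ _ hn hm).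
exists (a +i* b) => e e0.
have [n0 h0] := ha (e / 2) ltac:(lra); have [n1 h1] := hb (e / 2) ltac:(lra).
exists (maxn n0 n1) => n; rewrite geq_max => /andP[/h0 l0 /h1 l1].
apply: le_trans (nm_Re_Im _) _.
by move: l0 l1; rewrite !raddfB /=; lra.
Qed.

Lemma seq_lim_unique (V : normedZmodType R[i]) (u : nat -> V) l l' :
  seq_lim u l -> seq_lim u l' -> l = l'.
Proof.
move=> h h'; apply/eqP; rewrite -subr_eq0; apply/eqP/nm_small => e e0.
have [n0 h0] := h (e / 2) ltac:(lra); have [n1 h1] := h' (e / 2) ltac:(lra).
have := nm_triangle (u (maxn n0 n1)) l l'; rewrite (nmB l (u _)).
have := h0 _ (leq_maxl n0 n1); have := h1 _ (leq_maxr n0 n1); lra.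
Qed.

Lemma seq_limD (V : normedZmodType R[i]) (u v : nat -> V) l l' :
  seq_lim u l -> seq_lim v l' -> seq_lim (fun n => u n + v n) (l + l').
Proof.
move=> h h' e e0.
have [n0 h0] := h (e / 2) ltac:(lra); have [n1 h1] := h' (e / 2) ltac:(lra).
exists (maxn n0 n1) => n; rewrite geq_max => /andP[/h0 l0 /h1 l1].
rewrite opprD addrACA; apply: le_trans (nmD _ _) _; lra.
Qed.

Lemma seq_limM (u : nat -> R[i]) l c : seq_lim u l -> seq_lim (fun n => c * u n) (c * l).
Proof.
move=> h e e0; have c0 := nm_ge0 c.
have [n0 h0] := h (e / (nm c + 1)) ltac:(by rewrite divr_gt0//; lra).
exists n0 => n /h0 hn; rewrite -mulrBr nmM.
have : nm c * nm (u n - l) <= nm c * (e / (nm c + 1)) by rewrite ler_wpM2l.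
suff : nm c * (e / (nm c + 1)) <= e by lra.
rewrite mulrA ler_pdivrMr; nra.
Qed.

Lemma seq_lim_conj (u : nat -> R[i]) l :
  seq_lim u l -> seq_lim (fun n => Num.conj (u n)) (Num.conj l).
Proof. by move=> h e /h[n0 h0]; exists n0 => n /h0; rewrite -rmorphB /= nm_conj. Qed.

Lemma seq_lim_le (V : normedZmodType R[i]) (u : nat -> V) l M n0 :
  seq_lim u l -> (forall n, (n0 <= n)%N -> nm (u n) <= M) -> nm l <= M.
Proof.
move=> h b; apply/ler_addgt0Pr => e /h[n1 h1].
have := h1 _ (leq_maxr n0 n1); have := b _ (leq_maxl n0 n1).
have := nmD (l - u (maxn n0 n1)) (u (maxn n0 n1)); rewrite subrK nmB; lra.
Qed.

(** A partial sum close to the supremum of all of them leaves only a small tail. *)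
Lemma partial_sum_tail (a : nat -> R) M : (forall i, 0 <= a i) ->
  (forall n, \sum_(i < n) a i <= M) ->
  forall e, 0 < e -> exists n0, forall n, \sum_(n0 <= i < n) a i <= e.
Proof.
move=> a0 aM e e0.
pose S := [set \sum_(i < n) a i | n in [set: nat]].
have hS : has_sup S by split; [exists (\sum_(i < 0) a i); exists 0%N|exists M => _ [n _ <-]].
have [_ [n0 _ <-] h] := sup_adherent e0 hS.
exists n0 => n; have [nn0|n0n] := leqP n n0.
  by rewrite big_geq// ltW.
have : \sum_(i < n) a i <= sup S by apply: sup_upper_bound => //; exists n.
rewrite -!(big_mkord xpredT a) (big_cat_nat _ (n:=n0)) //= ?big_mkord; last exact: ltnW.
by move: h; rewrite -(big_mkord xpredT a); lra.
Qed.

End SeqLim.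

(** * Positive definite sesquilinear forms *)

Section CauchySchwarz.
Variables (R : realType) (V : lmodType R[i]) (ip : V -> V -> R[i]).
Hypothesis ipl : forall (c : R[i]) x y z, ip (c *: x + y) z = c * ip x z + ip y z.
Hypothesis ipC : forall x y, ip y x = Num.conj (ip x y).
Hypothesis ip_ge0 : forall x, 0 <= ip x x.
Hypothesis ip_eq0 : forall x, ip x x = 0 -> x = 0.

Lemma form0l z : ip 0 z = 0.
Proof. by have := ipl (-1) 0 0 z; rewrite scaler0 addr0 mulN1r addNr. Qed.

Lemma form0r z : ip z 0 = 0.
Proof. by rewrite ipC form0l conjC0. Qed.

Lemma formDl x y z : ip (x + y) z = ip x z + ip y z.
Proof. by have := ipl 1 x y z; rewrite scale1r mul1r. Qed.

Lemma formZl c x z : ip (c *: x) z = c * ip x z.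
Proof. by have := ipl c x 0 z; rewrite addr0 form0l addr0. Qed.

Lemma formDr x y z : ip z (x + y) = ip z x + ip z y.
Proof. by rewrite ipC formDl rmorphD /= -!ipC. Qed.

Lemma formZr c x z : ip z (c *: x) = Num.conj c * ip z x.
Proof. by rewrite ipC formZl rmorphM /= -!ipC. Qed.

Let q x : R := complex.Re (ip x x).

Lemma form_q x : ip x x = (q x)%:C.
Proof. by rewrite /q RRe_real// ger0_real. Qed.

Lemma form_q_ge0 x : 0 <= q x.
Proof. by rewrite -ler0c -form_q. Qed.

(** Stated for a bare form, because it yields the triangle inequality of [l2] before [l2] has a
    norm, and then serves all Hilbert spaces. *)
Lemma form_cauchy_schwarz x y : nm (ip x y) ^+ 2 <= q x * q y.
Proof.
have [y0|y0] := eqVneq (q y) 0.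
  have -> : y = 0 by apply: ip_eq0; rewrite form_q y0.
  by rewrite form0r nm0 expr0n /= /q form0r mulr0.
have qy : 0 < q y by rewrite lt_neqAle eq_sym y0 form_q_ge0.
have yC : (q y)%:C != 0 :> R[i].
  by apply/negP => /eqP[]; apply/eqP.
(* [c *: y] is the orthogonal projection of [x] on [y]; the inequality says that the remainder has a
   nonnegative square. *)
pose c := ip x y / (q y)%:C.
have : 0 <= q (x + (- c) *: y) by apply: form_q_ge0.
suff -> : q (x + (- c) *: y) = q x - nm (ip x y) ^+ 2 / q y.
  by rewrite subr_ge0 ler_pdivrMr.
apply: complexI; rewrite -form_q rmorphB /= -form_q.
rewrite !(formDl, formDr, formZl, formZr) rmorphM /= fmorphV /= nm_sqr.
rewrite (form_q y) rmorphN /= (ipC x y) /c rmorphM /= fmorphV /= conjRC.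
by field.
Qed.

End CauchySchwarz.

Section L2.
Variable R : realType.

Definition l2_pred : {pred (nat -> R[i])} :=
  fun x => `[< exists M, forall n, \sum_(i < n) nm (x i) ^+ 2 <= M >].

Lemma nm_sqrD (V : normedZmodType R[i]) (x y : V) : nm (x + y) ^+ 2 <= 2 * nm x ^+ 2 + 2 * nm y ^+ 2.
Proof.
have h := nmD x y; have h0 := nm_ge0 (x + y).
have : nm (x + y) ^+ 2 <= (nm x + nm y) ^+ 2 by rewrite ler_pXn2r// nnegrE ?addr_ge0 ?nm_ge0.
by have := sqr_ge0 (nm x - nm y); nra.
Qed.

Lemma l2_submod_closed : submod_closed l2_pred.
Proof.
split.
  by apply/asboolP; exists 0 => n; rewrite big1// => i _; rewrite nm0 expr0n.
move=> c x y /asboolP[M hM] /asboolP[M' hM']; apply/asboolP.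
exists (2 * (nm c ^+ 2 * M) + 2 * M') => n.
apply: (@le_trans _ _ (2 * (nm c ^+ 2 * \sum_(i < n) nm (x i) ^+ 2) + 2 * \sum_(i < n) nm (y i) ^+ 2)); last first.
  by rewrite lerD ?ler_wpM2l ?exprn_ge0 ?nm_ge0.
rewrite !mulr_sumr -big_split /=; apply: ler_sum => i _.
by apply: le_trans (nm_sqrD (c * x i) (y i)) _; rewrite nmM exprMn.
Qed.

HB.instance Definition _ := GRing.isSubmodClosed.Build _ _ l2_pred l2_submod_closed.

Record l2 := L2 { l2val :> nat -> R[i]; _ : l2val \in l2_pred }.
HB.instance Definition _ := [isSub for l2val].
HB.instance Definition _ := [Choice of l2 by <:].
HB.instance Definition _ := [SubChoice_isSubLmodule of l2 by <:].

Implicit Types x y z : l2.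

Lemma l2P x : exists M, forall n, \sum_(i < n) nm (x i) ^+ 2 <= M.
Proof. by case: x => x /= /asboolP. Qed.

Lemma l2_ext x y : (forall i, x i = y i) -> x = y.
Proof. by move=> h; apply: val_inj; apply/funext. Qed.

Lemma l2_0 i : (0 : l2) i = 0. Proof. by []. Qed.

Definition l2ip_sum x y n : R[i] := \sum_(i < n) x i * Num.conj (y i).

Lemma l2ip_cauchy x y : seq_cauchy (l2ip_sum x y).
Proof.
have [M hM] := l2P x; have [M' hM'] := l2P y.
(* Tails of this series dominate those of the inner product, by [a b <= a^2 + b^2]. *)
have tl e : 0 < e ->
    exists n0, forall n, \sum_(n0 <= i < n) (nm (x i) ^+ 2 + nm (y i) ^+ 2) <= e.
  apply: (@partial_sum_tail _ _ (M + M')); first by move=> i; rewrite addr_ge0 ?sqr_ge0.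
  by move=> n; rewrite big_split lerD.
move=> e e0; have [n0 h0] := tl e e0; exists n0.
have main n m : (n0 <= n)%N -> (n <= m)%N -> nm (l2ip_sum x y n - l2ip_sum x y m) <= e.
  move=> hn nm'; rewrite nmB /l2ip_sum -!(big_mkord xpredT (fun i => x i * Num.conj (y i))).
  rewrite (big_cat_nat _ (n:=n)) //= addrC addrK.
  apply: le_trans (nm_sum _ _ _) _; apply: le_trans (h0 m).
  rewrite [leRHS](big_cat_nat _ (n:=n)) //=; apply: le_trans (_ : _ <= \sum_(n <= i < m) (nm (x i) ^+ 2 + nm (y i) ^+ 2)) _.
    apply: ler_sum => i _; rewrite nmM nm_conj.
    by have := sqr_ge0 (nm (x i) - nm (y i)); nra.
  by rewrite lerDr; apply: sumr_ge0 => i _; rewrite addr_ge0 ?sqr_ge0.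
move=> n m hn hm; have [nm'|/ltnW mn] := leqP n m; first exact: main.
by rewrite nmB; apply: main.
Qed.

Definition l2ip x y : R[i] := projT1 (cid (complex_seq_lim (l2ip_cauchy x y))).

Lemma l2ip_lim x y : seq_lim (l2ip_sum x y) (l2ip x y).
Proof. exact: (projT2 (cid (complex_seq_lim (l2ip_cauchy x y)))). Qed.

Lemma l2ip_linearl c x y z : l2ip (c *: x + y) z = c * l2ip x z + l2ip y z.
Proof.
apply: (seq_lim_unique (l2ip_lim _ _)).
have := seq_limD (seq_limM c (l2ip_lim x z)) (l2ip_lim y z).
congr (seq_lim _ _); apply/funext => n; rewrite /l2ip_sum mulr_sumr -big_split /=.
by apply: eq_bigr => i _; rewrite mulrDl mulrA.
Qed.

Lemma l2ip_conj x y : l2ip y x = Num.conj (l2ip x y).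
Proof.
apply: (seq_lim_unique (l2ip_lim _ _)).
have := seq_lim_conj (l2ip_lim x y).
congr (seq_lim _ _); apply/funext => n; rewrite /l2ip_sum rmorph_sum /=.
by apply: eq_bigr => i _; rewrite rmorphM /= conjCK mulrC.
Qed.

Lemma l2ip_sumxx x n : l2ip_sum x x n = (\sum_(i < n) nm (x i) ^+ 2)%:C.
Proof. by rewrite rmorph_sum /=; apply: eq_bigr => i _; rewrite nm_sqr. Qed.

Lemma l2ip_partial x n : \sum_(i < n) nm (x i) ^+ 2 <= complex.Re (l2ip x x).
Proof.
apply/ler_addgt0Pr => e /(l2ip_lim x x)[n0 h0].
have := h0 _ (leq_maxr n n0); rewrite nmB => /(le_trans (normr_Re_le _)).
rewrite raddfB l2ip_sumxx /= ler_distl => /andP[h _].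
suff : \sum_(i < n) nm (x i) ^+ 2 <= \sum_(i < maxn n n0) nm (x i) ^+ 2 by lra.
rewrite -!(big_mkord xpredT (fun i => nm (x i) ^+ 2)).
rewrite [leRHS](big_cat_nat _ (n:=n)) ?leq_maxl //= lerDl.
by apply: sumr_ge0 => i _; apply: sqr_ge0.
Qed.

Lemma l2ip_Im x : complex.Im (l2ip x x) = 0.
Proof.
apply/eqP; rewrite -normr_le0; apply/ler_addgt0Pr => e /(l2ip_lim x x)[n0 h0].
have := h0 _ (leqnn n0); rewrite nmB => /(le_trans (normr_Im_le _)).
by rewrite raddfB l2ip_sumxx /= subr0 add0r.
Qed.

Lemma l2ip_ge0 x : 0 <= l2ip x x.
Proof.
by rewrite lecE l2ip_Im /= eqxx /=; apply: le_trans (l2ip_partial x 0); rewrite big_ord0.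
Qed.

Lemma l2ip_eq0 x : l2ip x x = 0 -> x = 0.
Proof.
move=> h; apply: l2_ext => i; rewrite l2_0; apply: nm_eq0.
have := l2ip_partial x i.+1; rewrite h /= big_ord_recr /= => h1.
have : 0 <= \sum_(i < i) nm (x i) ^+ 2 by apply: sumr_ge0 => j _; apply: sqr_ge0.
by have := nm_ge0 (x i); nra.
Qed.

Lemma l2ip_le x M : (forall n, \sum_(i < n) nm (x i) ^+ 2 <= M) ->
  complex.Re (l2ip x x) <= M.
Proof.
move=> h; apply/ler_addgt0Pr => e /(l2ip_lim x x)[n0 h0].
have := h0 _ (leqnn n0); rewrite nmB => /(le_trans (normr_Re_le _)).
rewrite raddfB l2ip_sumxx /= ler_distl => /andP[_ h1]; have := h n0; lra.
Qed.

Definition l2norm x : R[i] := (Num.sqrt (complex.Re (l2ip x x)))%:C.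

Let q_ge0 x : 0 <= complex.Re (l2ip x x) := form_q_ge0 l2ip_ge0 x.

Lemma l2normD x y : l2norm (x + y) <= l2norm x + l2norm y.
Proof.
rewrite -rmorphD lecR /=; set a := Num.sqrt (complex.Re (l2ip x x)); set b := Num.sqrt (complex.Re (l2ip y y)).
rewrite -(@ler_pXn2r _ 2) ?nnegrE ?addr_ge0 ?sqrtr_ge0// sqr_sqrtr //.
have fDl := formDl l2ip_linearl; have fDr := formDr l2ip_linearl l2ip_conj.
rewrite fDl !fDr !raddfD /= sqrrD !sqr_sqrtr//.
have cs : nm (l2ip x y) <= a * b.
  rewrite -(@ler_pXn2r _ 2) ?nnegrE ?nm_ge0 ?mulr_ge0 ?sqrtr_ge0// exprMn !sqr_sqrtr//.
  exact: (form_cauchy_schwarz l2ip_linearl l2ip_conj l2ip_ge0 l2ip_eq0).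
have h1 := Re_nm (l2ip x y); have h2 := Re_nm (l2ip y x).
have e : nm (l2ip y x) = nm (l2ip x y) by rewrite l2ip_conj nm_conj.
by rewrite mulr2n; lra.
Qed.

Lemma l2normZ (c : R[i]) x : l2norm (c *: x) = `|c| * l2norm x.
Proof.
have fZl := formZl l2ip_linearl; have fZr := formZr l2ip_linearl l2ip_conj.
rewrite /l2norm fZl fZr mulrA -nm_sqr (form_q l2ip_ge0) -rmorphM /=.
by rewrite sqrtrM ?sqr_ge0// sqrtr_sqr ger0_norm ?nm_ge0// rmorphM /= -nmE.
Qed.

Lemma l2norm_eq0 x : l2norm x = 0 -> x = 0.
Proof.
move=> [] /eqP; rewrite sqrtr_eq0 => h; apply: l2ip_eq0.
by rewrite (form_q l2ip_ge0); congr (_%:C); apply/eqP; rewrite eq_le h q_ge0.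
Qed.

HB.instance Definition _ := Lmodule_isNormed.Build R[i] l2 l2normD l2normZ l2norm_eq0.

Lemma l2nm_sqr x : nm x ^+ 2 = complex.Re (l2ip x x).
Proof. by rewrite [nm x]/(Num.sqrt _) sqr_sqrtr. Qed.

Lemma l2_partial x n : \sum_(i < n) nm (x i) ^+ 2 <= nm x ^+ 2.
Proof. by rewrite l2nm_sqr l2ip_partial. Qed.

Lemma l2_nm_le x M : 0 <= M -> (forall n, \sum_(i < n) nm (x i) ^+ 2 <= M ^+ 2) -> nm x <= M.
Proof.
move=> M0 h; rewrite -(@ler_pXn2r _ 2) ?nnegrE ?nm_ge0// l2nm_sqr; exact: l2ip_le.
Qed.

Lemma l2_coord x i : nm (x i) <= nm x.
Proof.
rewrite -(@ler_pXn2r _ 2) ?nnegrE ?nm_ge0//; apply: le_trans (l2_partial x i.+1).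
by rewrite big_ord_recr /= lerDr; apply: sumr_ge0 => j _; apply: sqr_ge0.
Qed.

Lemma l2_complete (u : nat -> l2) : seq_cauchy u -> exists l, seq_lim u l.
Proof.
move=> cu.
have /choice[v hv] : forall i, exists l, seq_lim (fun n => u n i) l.
  move=> i; apply: complex_seq_lim => e /cu[n0 h0]; exists n0 => n m hn hm.
  by apply: le_trans (h0 _ _ hn hm); apply: (l2_coord (u n - u m)).
(* The Cauchy bound survives the limit on the first [k] coordinates, uniformly in [k]: each
   coordinate may contribute an error [d / k.+1], less than [d] in total. *)
have key e n0 k : 0 < e ->
    (forall n m, (n0 <= n)%N -> (n0 <= m)%N -> nm (u n - u m) <= e) ->
    forall n, (n0 <= n)%N -> \sum_(i < k) nm (u n i - v i) ^+ 2 <= e ^+ 2.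
  move=> e0 h n hn.
  apply/ler_addgt0Pr => d d0.
  have /choice[N hN] : forall i, exists m0, forall m, (m0 <= m)%N ->
      nm (u n i - v i) ^+ 2 <= nm (u n i - u m i) ^+ 2 + d / k.+1%:R.
    move=> i.
    pose d' := d / k.+1%:R.
    have d'0 : 0 < d' by rewrite divr_gt0.
    pose c := nm (u n i - v i).
    have c0 : 0 <= c := nm_ge0 _.
    have [m0 hm0] := hv i (d' / (2 * c + 1)) ltac:(by rewrite divr_gt0//; lra).
    exists m0 => m /hm0; rewrite -/d' -/c.
    rewrite ler_pdivlMr; last by lra.
    have := nm_triangle (u m i) (u n i) (v i); rewrite -/c.
    move: (nm (u n i - u m i)) (nm_ge0 (u n i - u m i)) (nm (u m i - v i)) (nm_ge0 (u m i - v i)) => a a0 b b0 h1 h2.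
    by have [/ltW ac|ca] := ltP c a; nra.
  pose m := (n0 + \sum_(i < k) N i)%N.
  have mN (i : 'I_k) : (N i <= m)%N by rewrite /m (bigD1 i)//=; lia.
  have h1 : \sum_(i < k) nm ((u n - u m) i) ^+ 2 <= e ^+ 2.
    apply: le_trans (l2_partial (u n - u m) k) _.
    by rewrite ler_pXn2r ?nnegrE ?nm_ge0 ?(ltW e0)// h// leq_addr.
  apply: (@le_trans _ _ (\sum_(i < k) (nm ((u n - u m) i) ^+ 2 + d / k.+1%:R))).
    by apply: ler_sum => i _; apply: hN.
  rewrite big_split /= lerD// sumr_const card_ord -[leLHS]mulr_natr mulrAC ler_pdivrMr//.
  by rewrite ler_pM2l// ler_nat.
have vP : v \in l2_pred.
  have [n0 h0] := cu 1 ltr01.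
  apply/asboolP; exists (2 * nm (u n0) ^+ 2 + 2) => k.
  apply: (@le_trans _ _ (\sum_(i < k) (2 * nm (u n0 i) ^+ 2 + 2 * nm (u n0 i - v i) ^+ 2))).
    apply: ler_sum => i _; have := nm_sqrD (u n0 i) (v i - u n0 i).
    by rewrite addrC subrK nmB.
  rewrite big_split /= -!mulr_sumr lerD ?ler_wpM2l ?l2_partial//.
  by have := key 1 n0 k ltr01 h0 n0 (leqnn _); rewrite expr1n; lra.
exists (L2 vP) => e e0; have [n0 h0] := cu e e0; exists n0 => n hn.
apply: l2_nm_le; first exact: ltW.
by move=> k; apply: key h0 _ hn.
Qed.

HB.instance Definition _ := Uniform_isComplete.Build l2 (complete_of_seq l2_complete).

Lemma l2ip_norm x : l2ip x x = `|x| ^+ 2.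
Proof. by rewrite nmE -rmorphXn /= l2nm_sqr -(form_q l2ip_ge0). Qed.

HB.instance Definition _ := isHilbert.Build R l2 l2ip_linearl l2ip_conj l2ip_norm.

End L2.

(** * Bounded operators, bounded families, subalgebras *)

Section HilbertTheory.
Variables (R : realType) (H : hilbertType R).
Implicit Types x y z : H.

Let il := @inner_linearl R H.
Let ic := @inner_conj R H.

Lemma inner_nm x : inner x x = (nm x ^+ 2)%:C.
Proof. by rewrite inner_norm nmE rmorphXn. Qed.

Lemma inner_ge0 x : 0 <= inner x x.
Proof. by rewrite inner_nm ler0c sqr_ge0. Qed.

Lemma inner_eq0 x : inner x x = 0 -> x = 0.
Proof.
rewrite inner_nm => -[] /eqP; rewrite sqrf_eq0 => /eqP; exact: nm_eq0.
Qed.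

Lemma innerDl x y z : inner (x + y) z = inner x z + inner y z.
Proof. exact: (formDl il). Qed.
Lemma innerZl c x z : inner (c *: x) z = c * inner x z.
Proof. exact: (formZl il). Qed.
Lemma innerDr x y z : inner z (x + y) = inner z x + inner z y.
Proof. exact: (formDr il ic). Qed.
Lemma innerZr c x z : inner z (c *: x) = Num.conj c * inner z x.
Proof. exact: (formZr il ic). Qed.
Lemma inner0l z : inner (0 : H) z = 0.
Proof. exact: (form0l il). Qed.
Lemma inner0r z : inner z (0 : H) = 0.
Proof. exact: (form0r il ic). Qed.
Lemma innerNl x z : inner (- x) z = - inner x z.
Proof. by rewrite -scaleN1r innerZl mulN1r. Qed.
Lemma innerNr x z : inner z (- x) = - inner z x.
Proof. by rewrite ic innerNl rmorphN /= -ic. Qed.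
Lemma innerBl x y z : inner (x - y) z = inner x z - inner y z.
Proof. by rewrite innerDl innerNl. Qed.
Lemma innerBr x y z : inner z (x - y) = inner z x - inner z y.
Proof. by rewrite innerDr innerNr. Qed.

Lemma inner_suml (I : Type) (s : seq I) P (F : I -> H) z :
  inner (\sum_(i <- s | P i) F i) z = \sum_(i <- s | P i) inner (F i) z.
Proof. by apply: (big_morph (fun x => inner x z)) => [x y|]; rewrite ?innerDl ?inner0l. Qed.

Lemma inner_sumr (I : Type) (s : seq I) P (F : I -> H) z :
  inner z (\sum_(i <- s | P i) F i) = \sum_(i <- s | P i) inner z (F i).
Proof. by apply: (big_morph (inner z)) => [x y|]; rewrite ?innerDr ?inner0r. Qed.

Lemma cauchy_schwarz x y : nm (inner x y) <= nm x * nm y.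
Proof.
rewrite -(@ler_pXn2r _ 2) ?nnegrE ?nm_ge0 ?mulr_ge0 ?nm_ge0// exprMn.
have := form_cauchy_schwarz il ic inner_ge0 inner_eq0 x y.
by rewrite !inner_nm.
Qed.

Lemma inner_inj x y : (forall z, inner x z = inner y z) -> x = y.
Proof.
move=> h; apply/eqP; rewrite -subr_eq0; apply/eqP/inner_eq0.
by rewrite innerBl h subrr.
Qed.

Lemma nm_le_inner x M : 0 <= M -> (forall y, nm (inner x y) <= M * nm y) -> nm x <= M.
Proof.
move=> M0 /(_ x); rewrite inner_nm nmR ger0_norm ?sqr_ge0// => h.
have := nm_ge0 x; rewrite le_eqVlt => /orP[/eqP<-//|x0].
by rewrite -(ler_pM2r x0) -expr2.
Qed.

Lemma nm_sqr_add x y : nm (x + y) ^+ 2 = nm x ^+ 2 + nm y ^+ 2 + 2 * complex.Re (inner x y).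
Proof.
apply: complexI; rewrite -inner_nm innerDl !innerDr !rmorphD /= -!inner_nm (ic x y).
suff -> : (2 * complex.Re (inner x y))%:C = inner x y + Num.conj (inner x y) by ring.
by rewrite rmorphM rmorph_nat -addcJ.
Qed.

Lemma nm_sqr_orth x y : inner x y = 0 -> nm (x + y) ^+ 2 = nm x ^+ 2 + nm y ^+ 2.
Proof. by move=> h; rewrite nm_sqr_add h /= mulr0 addr0. Qed.

End HilbertTheory.

Section CStarTheory.
Variables (R : realType) (A : cstarAlgType R).
Implicit Types x y z : A.

Lemma cmulDl x y z : cmul (x + y) z = cmul x z + cmul y z.
Proof. by have := cmul_linearl 1 x y z; rewrite !scale1r. Qed.
Lemma cmul0l z : cmul (0 : A) z = 0.
Proof. by apply: (addIr (cmul 0 z)); rewrite -cmulDl !add0r. Qed.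
Lemma cmulZl c x z : cmul (c *: x) z = c *: cmul x z.
Proof. by have := cmul_linearl c x 0 z; rewrite !addr0 cmul0l addr0. Qed.
Lemma cmulDr x y z : cmul z (x + y) = cmul z x + cmul z y.
Proof. by have := cmul_linearr 1 z x y; rewrite !scale1r. Qed.
Lemma cmul0r z : cmul z (0 : A) = 0.
Proof. by apply: (addIr (cmul z 0)); rewrite -cmulDr !add0r. Qed.
Lemma cmulZr c x z : cmul z (c *: x) = c *: cmul z x.
Proof. by have := cmul_linearr c z x 0; rewrite !addr0 cmul0r addr0. Qed.
Lemma cmulNl x z : cmul (- x) z = - cmul x z.
Proof. by rewrite -scaleN1r cmulZl scaleN1r. Qed.
Lemma cmulNr x z : cmul z (- x) = - cmul z x.
Proof. by rewrite -scaleN1r cmulZr scaleN1r. Qed.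
Lemma cmulBl x y z : cmul (x - y) z = cmul x z - cmul y z.
Proof. by rewrite cmulDl cmulNl. Qed.
Lemma cmulBr x y z : cmul z (x - y) = cmul z x - cmul z y.
Proof. by rewrite cmulDr cmulNr. Qed.
Lemma cmul_suml (I : Type) (s : seq I) P (F : I -> A) z :
  cmul (\sum_(i <- s | P i) F i) z = \sum_(i <- s | P i) cmul (F i) z.
Proof. by apply: (big_morph (fun x => cmul x z)) => [x y|]; rewrite ?cmulDl ?cmul0l. Qed.
Lemma cmul_sumr (I : Type) (s : seq I) P (F : I -> A) z :
  cmul z (\sum_(i <- s | P i) F i) = \sum_(i <- s | P i) cmul z (F i).
Proof. by apply: (big_morph (cmul z)) => [x y|]; rewrite ?cmulDr ?cmul0r. Qed.

Lemma starD x y : star (x + y) = star x + star y.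
Proof. by have := star_conjlinear 1 x y; rewrite rmorph1 !scale1r. Qed.
Lemma star0 : star (0 : A) = 0.
Proof. by apply: (addIr (star 0)); rewrite -starD !add0r. Qed.
Lemma starZ c x : star (c *: x) = Num.conj c *: star x.
Proof. by have := star_conjlinear c x 0; rewrite !addr0 star0 addr0. Qed.
Lemma starN x : star (- x) = - star x.
Proof. by rewrite -scaleN1r starZ rmorphN rmorph1 scaleN1r. Qed.
Lemma starB x y : star (x - y) = star x - star y.
Proof. by rewrite starD starN. Qed.
Lemma star_sum (I : Type) (s : seq I) P (F : I -> A) :
  star (\sum_(i <- s | P i) F i) = \sum_(i <- s | P i) star (F i).
Proof. by apply: (big_morph (@star R A)) => [x y|]; rewrite ?starD ?star0. Qed.

Lemma nm_cmul x y : nm (cmul x y) <= nm x * nm y.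
Proof. by rewrite -lecR rmorphM /= -!nmE cmul_norm. Qed.

Lemma nm_cstar x : nm (cmul (star x) x) = nm x ^+ 2.
Proof. by apply: complexI; rewrite rmorphXn /= -!nmE cstar_identity. Qed.

Lemma nm_star x : nm (star x) = nm x.
Proof.
suff le z : nm z <= nm (star z) by apply/eqP; rewrite eq_le le -{2}(starK x) le.
have := nm_ge0 z; rewrite le_eqVlt => /orP[/eqP<-|z0]; first exact: nm_ge0.
by rewrite -(ler_pM2r z0) -expr2 -nm_cstar nm_cmul.
Qed.

End CStarTheory.

(** * Norms as least bounds *)

Section Gauge.
Variables (R : realType) (V : lmodType R[i]) (Bd : R -> V -> Prop).
Hypothesis Bd_ex : forall x, exists2 M, 0 <= M & Bd M x.
Hypothesis Bd_mono : forall M M' x, M <= M' -> Bd M x -> Bd M' x.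
Hypothesis Bd_closed : forall M x, (forall e, 0 < e -> Bd (M + e) x) -> Bd M x.
Hypothesis BdD : forall M M' x y, 0 <= M -> 0 <= M' -> Bd M x -> Bd M' y -> Bd (M + M') (x + y).
Hypothesis BdZ : forall M c x, 0 <= M -> Bd M x -> Bd (nm c * M) (c *: x).
Hypothesis Bd0 : forall x, Bd 0 x -> x = 0.

Definition gauge_set x := [set M | 0 <= M /\ Bd M x].
(** The operator norm of [bop] and the supremum norm of [bfam] are both of this form. [Bd_closed]
    makes the infimum an admissible bound itself. *)
Definition gauge (x : V) : R := inf (gauge_set x).

Lemma gauge_has_inf x : has_inf (gauge_set x).
Proof. by split; [have [M ? ?] := Bd_ex x; exists M|exists 0 => M []]. Qed.

Lemma gauge_ge0 x : 0 <= gauge x.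
Proof. by apply: lb_le_inf; [exact: (gauge_has_inf x).1|move=> M []]. Qed.

Lemma gauge_Bd x : Bd (gauge x) x.
Proof.
apply: Bd_closed => e e0.
have [M [_ hM] hlt] := inf_adherent e0 (gauge_has_inf x).
exact: Bd_mono (ltW hlt) hM.
Qed.

Lemma gauge_le x M : 0 <= M -> Bd M x -> gauge x <= M.
Proof. by move=> M0 hM; apply: ge_inf; [exact: (gauge_has_inf x).2|]. Qed.

Definition gaugeC x : R[i] := (gauge x)%:C.

Lemma gaugeCD x y : gaugeC (x + y) <= gaugeC x + gaugeC y.
Proof.
rewrite -rmorphD lecR; apply: gauge_le; first by rewrite addr_ge0 ?gauge_ge0.
by apply: BdD; rewrite ?gauge_ge0//; apply: gauge_Bd.
Qed.

Lemma gaugeCZ (c : R[i]) x : gaugeC (c *: x) = `|c| * gaugeC x.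
Proof.
rewrite nmE -rmorphM; congr (_%:C); apply/eqP; rewrite eq_le; apply/andP; split.
  by apply: gauge_le; rewrite ?mulr_ge0 ?nm_ge0 ?gauge_ge0//; apply/BdZ/gauge_Bd/gauge_ge0.
have [->|c0] := eqVneq c 0; first by rewrite nm0 mul0r gauge_ge0.
have nc : 0 < nm c.
  rewrite lt_neqAle nm_ge0 andbT eq_sym; apply/eqP => /nm_eq0 h.
  by rewrite h eqxx in c0.
rewrite mulrC -ler_pdivlMr//; apply: gauge_le; first by rewrite divr_ge0 ?gauge_ge0 ?nm_ge0.
rewrite -[x in Bd _ x](scalerK c0); suff -> : gauge (c *: x) / nm c = nm c^-1 * gauge (c *: x).
  exact/BdZ/gauge_Bd/gauge_ge0.
rewrite mulrC; congr (_ * _); apply: complexI.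
by rewrite fmorphV /= -!nmE normfV.
Qed.

Lemma gaugeC_eq0 x : gaugeC x = 0 -> x = 0.
Proof. by move=> [] h; apply: Bd0; rewrite -h; apply: gauge_Bd. Qed.

End Gauge.

(** * The C*-algebra of bounded operators *)

Section BoundedOperators.
Variables (R : realType) (H : hilbertType R).

(** An operator is a bounded map that has an adjoint. Linearity then follows from the adjoint
    relation, and the adjoint operation is available before the Riesz theorem. *)
Definition bop_pred : {pred (H -> H)} := fun f => `[< exists g M,
  (forall x y, inner (f x) y = inner x (g y)) /\ forall x, nm (f x) <= M * nm x >].

Lemma bop_submod_closed : submod_closed bop_pred.
Proof.
split.
  apply/asboolP; exists 0, 0; split=> [x y|x].
    by rewrite /= inner0l inner0r.
  by rewrite nm0 mul0r.
move=> c f f' /asboolP[g [M [hg hM]]] /asboolP[g' [M' [hg' hM']]]; apply/asboolP.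
exists (fun y => Num.conj c *: g y + g' y), (nm c * M + M'); split=> [x y|x].
  by rewrite innerDl innerZl innerDr innerZr conjCK hg hg'.
apply: le_trans (nmD (c *: f x) (f' x)) _; rewrite nmZ mulrDl -mulrA.
by apply: lerD (hM' x); rewrite ler_wpM2l ?nm_ge0.
Qed.

HB.instance Definition _ := GRing.isSubmodClosed.Build _ _ bop_pred bop_submod_closed.

Record bop := Bop { bopval :> H -> H; _ : bopval \in bop_pred }.
HB.instance Definition _ := [isSub for bopval].
HB.instance Definition _ := [Choice of bop by <:].
HB.instance Definition _ := [SubChoice_isSubLmodule of bop by <:].

Implicit Types a b : bop.

Lemma bop_ext a b : (forall x, a x = b x) -> a = b.
Proof. by move=> h; apply: val_inj; apply/funext. Qed.

Lemma bop_addE a b x : (a + b) x = a x + b x. Proof. by []. Qed.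
Lemma bop_scaleE c a x : (c *: a) x = c *: a x. Proof. by []. Qed.
Lemma bop_zeroE x : (0 : bop) x = 0. Proof. by []. Qed.
Lemma bop_oppE a x : (- a) x = - a x. Proof. by []. Qed.

Lemma bop_adj a : exists b, forall x y, inner (a x) y = inner x (b y).
Proof.
case: a => f /= /[dup] fP /asboolP[g [M [hg hM]]].
have M0 : exists2 M', 0 <= M' & forall x, nm (f x) <= M' * nm x.
  exists `|M| => // x; apply: le_trans (hM x) _.
  by rewrite ler_wpM2r ?nm_ge0// ler_norm.
case: M0 => {hM}{}M M0 hM.
have gP : g \in bop_pred.
  apply/asboolP; exists f, M; split=> [x y|x].
    by rewrite inner_conj -hg -inner_conj.
  apply: nm_le_inner => [|y]; first by rewrite mulr_ge0 ?nm_ge0.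
  rewrite inner_conj -hg nm_conj; apply: le_trans (cauchy_schwarz _ _) _.
  by rewrite mulrAC ler_wpM2r ?nm_ge0.
by exists (Bop gP).
Qed.

Definition bstar a : bop := projT1 (cid (bop_adj a)).

Lemma bstarP a x y : inner (a x) y = inner x (bstar a y).
Proof. exact: (projT2 (cid (bop_adj a))). Qed.

Lemma bstarPr a x y : inner x (a y) = inner (bstar a x) y.
Proof. by rewrite inner_conj bstarP -inner_conj. Qed.

Lemma bstar_unique a b : (forall x y, inner (a x) y = inner x (b y)) -> bstar a = b.
Proof.
move=> h; apply: bop_ext => y; apply: inner_inj => z.
by rewrite inner_conj -bstarP h -inner_conj.
Qed.

Lemma bopD a x y : a (x + y) = a x + a y.
Proof. by apply: inner_inj => z; rewrite innerDl !bstarP innerDl. Qed.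
Lemma bopZ a c x : a (c *: x) = c *: a x.
Proof. by apply: inner_inj => z; rewrite innerZl !bstarP innerZl. Qed.
Lemma bop0 a : a 0 = 0.
Proof. by have := bopZ a 0 0; rewrite !scale0r. Qed.
Lemma bopN a x : a (- x) = - a x.
Proof. by rewrite -scaleN1r bopZ scaleN1r. Qed.
Lemma bopB a x y : a (x - y) = a x - a y.
Proof. by rewrite bopD bopN. Qed.
Lemma bop_sum a (I : Type) (s : seq I) P (F : I -> H) :
  a (\sum_(i <- s | P i) F i) = \sum_(i <- s | P i) a (F i).
Proof. by apply: (big_morph a) => [x y|]; rewrite ?bopD ?bop0. Qed.

Definition bop_bound (M : R) a := forall x, nm (a x) <= M * nm x.

Lemma bop_bound_ex a : exists2 M, 0 <= M & bop_bound M a.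
Proof.
case: a => f fP; have /asboolP[g [M [hg hM]]] := fP.
exists `|M| => // x; apply: le_trans (hM x) _.
by rewrite ler_wpM2r ?nm_ge0// ler_norm.
Qed.

Lemma bop_bound_mono M M' a : M <= M' -> bop_bound M a -> bop_bound M' a.
Proof. by move=> h hM x; apply: le_trans (hM x) _; rewrite ler_wpM2r ?nm_ge0. Qed.

Lemma bop_bound_closed M a : (forall e, 0 < e -> bop_bound (M + e) a) -> bop_bound M a.
Proof.
move=> h x; apply/ler_addgt0Pr => e e0.
have x0 := nm_ge0 x.
have := h (e / (nm x + 1)) ltac:(by rewrite divr_gt0//; lra) x.
rewrite mulrDl => /le_trans; apply; rewrite lerD2l mulrAC ler_pdivrMr; last by lra.
by nra.
Qed.

Lemma bop_boundD M M' a b : 0 <= M -> 0 <= M' ->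
  bop_bound M a -> bop_bound M' b -> bop_bound (M + M') (a + b).
Proof.
by move=> _ _ ha hb x; apply: le_trans (nmD (a x) (b x)) _; rewrite mulrDl lerD.
Qed.

Lemma bop_boundZ M c a : 0 <= M -> bop_bound M a -> bop_bound (nm c * M) (c *: a).
Proof. by move=> M0 ha x; rewrite bop_scaleE nmZ -mulrA ler_wpM2l ?nm_ge0. Qed.

Lemma bop_bound0 a : bop_bound 0 a -> a = 0.
Proof.
move=> h; apply: bop_ext => x; apply: nm_le0.
by have := h x; rewrite mul0r.
Qed.

HB.instance Definition _ := Lmodule_isNormed.Build R[i] bop
  (gaugeCD bop_bound_ex bop_bound_mono bop_bound_closed bop_boundD)
  (gaugeCZ bop_bound_ex bop_bound_mono bop_bound_closed bop_boundZ)
  (gaugeC_eq0 bop_bound_ex bop_bound_mono bop_bound_closed bop_bound0).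

Lemma bop_nm a x : nm (a x) <= nm a * nm x.
Proof. exact: (gauge_Bd bop_bound_ex bop_bound_mono bop_bound_closed). Qed.

Lemma bop_nm_le a M : 0 <= M -> (forall x, nm (a x) <= M * nm x) -> nm a <= M.
Proof. by move=> M0 h; apply: (gauge_le bop_bound_ex). Qed.

Lemma bstar_nm_le a : nm (bstar a) <= nm a.
Proof.
apply: bop_nm_le => [|x]; first exact: nm_ge0.
apply: nm_le_inner => [|y]; first by rewrite mulr_ge0 ?nm_ge0.
rewrite -bstarPr; apply: le_trans (cauchy_schwarz _ _) _.
by rewrite [leRHS]mulrAC mulrC ler_wpM2r ?nm_ge0// bop_nm.
Qed.

Lemma bstarK a : bstar (bstar a) = a.
Proof. by apply: bstar_unique => x y; rewrite -bstarPr. Qed.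

Lemma bstar_conjlinear (c : R[i]) a b : bstar (c *: a + b) = Num.conj c *: bstar a + bstar b.
Proof.
apply: bstar_unique => x y; rewrite !bop_addE !bop_scaleE innerDl innerZl !bstarP.
by rewrite innerDr innerZr conjCK.
Qed.

(** The pointwise limit must again have an adjoint: the adjoints also form a Cauchy sequence, and
    their pointwise limit is the adjoint of the limit. *)
Lemma bop_complete (u : nat -> bop) : seq_cauchy u -> exists l, seq_lim u l.
Proof.
move=> cu.
have pw (v : nat -> bop) : seq_cauchy v -> forall x, exists l, seq_lim (fun n => v n x) l.
  move=> cv x; apply: seq_lim_exists => e e0; have x0 := nm_ge0 x.
  have [n0 h0] := cv (e / (nm x + 1)) ltac:(by rewrite divr_gt0//; lra).
  exists n0 => n m hn hm; apply: le_trans (bop_nm (v n - v m) x) _.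
  apply: le_trans (ler_wpM2r x0 (h0 _ _ hn hm)) _.
  by rewrite mulrAC ler_pdivrMr; [nra|lra].
have cs : seq_cauchy (fun n => bstar (u n)).
  move=> e /cu[n0 h0]; exists n0 => n m hn hm.
  suff -> : bstar (u n) - bstar (u m) = bstar (u n - u m).
    exact: le_trans (bstar_nm_le _) (h0 _ _ hn hm).
  have := bstar_conjlinear (-1) (u m) (u n).
  by rewrite !scaleN1r rmorphN rmorph1 scaleN1r ![- _ + _]addrC => ->.
have /choice[f hf] := pw _ cu; have /choice[g hg] := pw _ cs.
have inner_lim (w : nat -> H) l y : seq_lim w l -> seq_lim (fun n => inner (w n) y) (inner l y).
  move=> h e e0; have y0 := nm_ge0 y.
  have [n0 h0] := h (e / (nm y + 1)) ltac:(by rewrite divr_gt0//; lra).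
  exists n0 => n /h0 hn; rewrite -innerBl; apply: le_trans (cauchy_schwarz _ _) _.
  apply: le_trans (ler_wpM2r y0 hn) _.
  by rewrite mulrAC ler_pdivrMr; [nra|lra].
have key e n0 : 0 < e -> (forall n m, (n0 <= n)%N -> (n0 <= m)%N -> nm (u n - u m) <= e) ->
    forall n x, (n0 <= n)%N -> nm (u n x - f x) <= e * nm x.
  move=> e0 h0 n x hn.
  apply: (@seq_lim_le _ _ (fun m => u n x - u m x) _ _ n0).
    move=> d /(hf x)[m0 hm0]; exists m0 => m /hm0 hd.
    by rewrite opprB addrC addrA subrK nmB.
  move=> m hm; apply: le_trans (bop_nm (u n - u m) x) _.
  by rewrite ler_wpM2r ?nm_ge0// h0.
have fP : f \in bop_pred.
  have [n0 h0] := cu 1 ltr01.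
  apply/asboolP; exists g, (nm (u n0) + 1); split=> [x y|x].
    apply: (seq_lim_unique (inner_lim _ _ y (hf x))).
    have := seq_lim_conj (inner_lim _ _ x (hg y)).
    rewrite -inner_conj; congr (seq_lim _ _); apply/funext => n.
    by rewrite -inner_conj -bstarP.
  have := key 1 n0 ltr01 h0 n0 x (leqnn _); have := bop_nm (u n0) x.
  have := nmD (f x - u n0 x) (u n0 x); rewrite subrK nmB; lra.
exists (Bop fP) => e e0; have [n0 h0] := cu e e0; exists n0 => n hn.
by apply: bop_nm_le => [|x]; [exact: ltW|exact: (key e n0 e0 h0 n x hn)].
Qed.

HB.instance Definition _ := Uniform_isComplete.Build bop (complete_of_seq bop_complete).

Lemma bmul_subproof a b : (a \o b) \in bop_pred.
Proof.
apply/asboolP; exists (bstar b \o bstar a), (nm a * nm b); split=> [x y|x] /=.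
  by rewrite !bstarP.
by apply: le_trans (bop_nm _ _) _; rewrite -mulrA ler_wpM2l ?nm_ge0 ?bop_nm.
Qed.

Definition bmul a b := Bop (bmul_subproof a b).

Lemma bmulA a b c : bmul a (bmul b c) = bmul (bmul a b) c.
Proof. exact: bop_ext. Qed.

Lemma bmul_linearl (k : R[i]) a b c : bmul (k *: a + b) c = k *: bmul a c + bmul b c.
Proof. exact: bop_ext. Qed.

Lemma bmul_linearr (k : R[i]) a b c : bmul a (k *: b + c) = k *: bmul a b + bmul a c.
Proof. apply: bop_ext => x; change (a (k *: b x + c x) = k *: a (b x) + a (c x)).
by rewrite bopD bopZ. Qed.

Lemma bmul_nm a b : nm (bmul a b) <= nm a * nm b.
Proof.
apply: bop_nm_le => [|x]; first by rewrite mulr_ge0 ?nm_ge0.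
by apply: le_trans (bop_nm a (b x)) _; rewrite -mulrA ler_wpM2l ?nm_ge0 ?bop_nm.
Qed.

Lemma bmul_norm a b : `|bmul a b| <= `|a| * `|b|.
Proof. by rewrite !nmE -rmorphM lecR bmul_nm. Qed.

Lemma bstarM a b : bstar (bmul a b) = bmul (bstar b) (bstar a).
Proof. by apply: bstar_unique => x y /=; rewrite !bstarP. Qed.

Lemma bstar_identity a : `|bmul (bstar a) a| = `|a| ^+ 2.
Proof.
rewrite !nmE -rmorphXn; congr (_%:C); apply/eqP; rewrite eq_le; apply/andP; split.
  apply: le_trans (bmul_nm _ _) _; rewrite expr2 ler_wpM2r ?nm_ge0//.
  exact: bstar_nm_le.
set c := nm (bmul _ _); have c0 : 0 <= c := nm_ge0 _.
have : nm a <= Num.sqrt c.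
  apply: bop_nm_le => [|x]; first exact: sqrtr_ge0.
  rewrite -(@ler_pXn2r _ 2) ?nnegrE ?mulr_ge0 ?nm_ge0 ?sqrtr_ge0//.
  rewrite exprMn sqr_sqrtr//.
  have -> : nm (a x) ^+ 2 = nm (inner (bmul (bstar a) a x) x).
    by rewrite /= -bstarPr /= inner_nm nmR ger0_norm ?sqr_ge0.
  apply: le_trans (cauchy_schwarz _ _) _; rewrite expr2 mulrA.
  by rewrite ler_wpM2r ?nm_ge0// bop_nm.
by rewrite -(@ler_pXn2r _ 2) ?nnegrE ?nm_ge0 ?sqrtr_ge0// sqr_sqrtr.
Qed.

HB.instance Definition _ := isCStarAlgebra.Build R bop
  bmulA bmul_linearl bmul_linearr bmul_norm bstarK bstar_conjlinear bstarM bstar_identity.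

Lemma bop_mulE a b x : cmul a b x = a (b x). Proof. by []. Qed.

Lemma bop_starP a x y : inner (a x) y = inner x (star a y).
Proof. exact: bstarP. Qed.

Lemma bop_starPr a x y : inner x (a y) = inner (star a x) y.
Proof. exact: bstarPr. Qed.

Lemma bop_star_unique a b : (forall x y, inner (a x) y = inner x (b y)) -> star a = b.
Proof. exact: bstar_unique. Qed.

Lemma bop_of_adjoint (f g : H -> H) M : (forall x y, inner (f x) y = inner x (g y)) ->
  (forall x, nm (f x) <= M * nm x) -> {a : bop | forall x, a x = f x}.
Proof.
move=> h1 h2; have fP : f \in bop_pred by apply/asboolP; exists g, M.
by exists (Bop fP).
Qed.

End BoundedOperators.

(** * Bounded families in a C*-algebra *)

Section BoundedFamilies.
Variables (R : realType) (I : Type) (B : cstarAlgType R).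

Definition bfam_pred : {pred (I -> B)} := fun F => `[< exists M, forall i, nm (F i) <= M >].

Lemma bfam_submod_closed : submod_closed bfam_pred.
Proof.
split; first by apply/asboolP; exists 0 => i; rewrite nm0.
move=> c f g /asboolP[M hM] /asboolP[M' hM']; apply/asboolP.
exists (nm c * M + M') => i; apply: le_trans (nmD (c *: f i) (g i)) _; rewrite nmZ.
by apply: lerD (hM' i); rewrite ler_wpM2l ?nm_ge0.
Qed.

HB.instance Definition _ := GRing.isSubmodClosed.Build _ _ bfam_pred bfam_submod_closed.

Record bfam := Bfam { bfamval :> I -> B; _ : bfamval \in bfam_pred }.
HB.instance Definition _ := [isSub for bfamval].
HB.instance Definition _ := [Choice of bfam by <:].
HB.instance Definition _ := [SubChoice_isSubLmodule of bfam by <:].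

Implicit Types F G : bfam.

Lemma bfam_ext F G : (forall i, F i = G i) -> F = G.
Proof. by move=> h; apply: val_inj; apply/funext. Qed.

Lemma bfam_addE F G i : (F + G) i = F i + G i. Proof. by []. Qed.
Lemma bfam_scaleE c F i : (c *: F) i = c *: F i. Proof. by []. Qed.
Lemma bfam_oppE F i : (- F) i = - F i. Proof. by []. Qed.
Lemma bfam_zeroE i : (0 : bfam) i = 0. Proof. by []. Qed.

Definition bfam_bound (M : R) F := forall i, nm (F i) <= M.

Lemma bfam_bound_ex F : exists2 M, 0 <= M & bfam_bound M F.
Proof.
case: F => F FP; have /asboolP[M hM] := FP.
by exists `|M| => // i; apply: le_trans (hM i) (ler_norm _).
Qed.

Lemma bfam_bound_mono M M' F : M <= M' -> bfam_bound M F -> bfam_bound M' F.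
Proof. by move=> h hM i; apply: le_trans (hM i) h. Qed.

Lemma bfam_bound_closed M F : (forall e, 0 < e -> bfam_bound (M + e) F) -> bfam_bound M F.
Proof. by move=> h i; apply/ler_addgt0Pr => e /h/(_ i). Qed.

Lemma bfam_boundD M M' F G : 0 <= M -> 0 <= M' ->
  bfam_bound M F -> bfam_bound M' G -> bfam_bound (M + M') (F + G).
Proof. by move=> _ _ hF hG i; apply: le_trans (nmD (F i) (G i)) (lerD _ _). Qed.

Lemma bfam_boundZ M c F : 0 <= M -> bfam_bound M F -> bfam_bound (nm c * M) (c *: F).
Proof. by move=> M0 hF i; rewrite bfam_scaleE nmZ ler_wpM2l ?nm_ge0. Qed.

Lemma bfam_bound0 F : bfam_bound 0 F -> F = 0.
Proof. by move=> h; apply: bfam_ext => i; apply/nm_le0/h. Qed.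

HB.instance Definition _ := Lmodule_isNormed.Build R[i] bfam
  (gaugeCD bfam_bound_ex bfam_bound_mono bfam_bound_closed bfam_boundD)
  (gaugeCZ bfam_bound_ex bfam_bound_mono bfam_bound_closed bfam_boundZ)
  (gaugeC_eq0 bfam_bound_ex bfam_bound_mono bfam_bound_closed bfam_bound0).

Lemma bfam_nm F i : nm (F i) <= nm F.
Proof. exact: (gauge_Bd bfam_bound_ex bfam_bound_mono bfam_bound_closed). Qed.

Lemma bfam_nm_le F M : 0 <= M -> (forall i, nm (F i) <= M) -> nm F <= M.
Proof. by move=> M0 h; apply: (gauge_le bfam_bound_ex). Qed.

Lemma bfam_complete (u : nat -> bfam) : seq_cauchy u -> exists l, seq_lim u l.
Proof.
move=> cu.
have /choice[f hf] : forall i, exists l, seq_lim (fun n => u n i) l.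
  move=> i; apply: seq_lim_exists => e /cu[n0 h0]; exists n0 => n m hn hm.
  exact: le_trans (bfam_nm (u n - u m) i) (h0 _ _ hn hm).
have key e n0 : 0 < e -> (forall n m, (n0 <= n)%N -> (n0 <= m)%N -> nm (u n - u m) <= e) ->
    forall n i, (n0 <= n)%N -> nm (u n i - f i) <= e.
  move=> e0 h0 n i hn.
  apply: (@seq_lim_le _ _ (fun m => u n i - u m i) _ _ n0).
    move=> d /(hf i)[m0 hm0]; exists m0 => m /hm0 hd.
    by rewrite opprB addrC addrA subrK nmB.
  by move=> m hm; apply: le_trans (bfam_nm (u n - u m) i) (h0 _ _ _ _).
have fP : f \in bfam_pred.
  have [n0 h0] := cu 1 ltr01.
  apply/asboolP; exists (nm (u n0) + 1) => i.
  have := key 1 n0 ltr01 h0 n0 i (leqnn _); have := bfam_nm (u n0) i.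
  have := nmD (f i - u n0 i) (u n0 i); rewrite subrK nmB; lra.
exists (Bfam fP) => e e0; have [n0 h0] := cu e e0; exists n0 => n hn.
by apply: bfam_nm_le => [|x]; [exact: ltW|exact: (key e n0 e0 h0 n x hn)].
Qed.

HB.instance Definition _ := Uniform_isComplete.Build bfam (complete_of_seq bfam_complete).

Lemma bfam_mul_subproof F G : (fun i => cmul (F i) (G i)) \in bfam_pred.
Proof.
apply/asboolP; exists (nm F * nm G) => i.
by apply: le_trans (nm_cmul _ _) _; rewrite ler_pM ?nm_ge0 ?bfam_nm.
Qed.

Definition bfam_mul F G := Bfam (bfam_mul_subproof F G).

Lemma bfam_star_subproof F : (fun i => star (F i)) \in bfam_pred.
Proof. by apply/asboolP; exists (nm F) => i; rewrite nm_star bfam_nm. Qed.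

Definition bfam_star F := Bfam (bfam_star_subproof F).

Lemma bfam_mulA F G K : bfam_mul F (bfam_mul G K) = bfam_mul (bfam_mul F G) K.
Proof. by apply: bfam_ext => i /=; rewrite cmulA. Qed.

Lemma bfam_mul_linearl (k : R[i]) F G K :
  bfam_mul (k *: F + G) K = k *: bfam_mul F K + bfam_mul G K.
Proof. by apply: bfam_ext => i; apply: cmul_linearl. Qed.

Lemma bfam_mul_linearr (k : R[i]) F G K :
  bfam_mul F (k *: G + K) = k *: bfam_mul F G + bfam_mul F K.
Proof. by apply: bfam_ext => i; apply: cmul_linearr. Qed.

Lemma bfam_mul_nm F G : nm (bfam_mul F G) <= nm F * nm G.
Proof.
apply: bfam_nm_le => [|i]; first by rewrite mulr_ge0 ?nm_ge0.
by apply: le_trans (nm_cmul _ _) _; rewrite ler_pM ?nm_ge0 ?bfam_nm.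
Qed.

Lemma bfam_mul_norm F G : `|bfam_mul F G| <= `|F| * `|G|.
Proof. by rewrite !nmE -rmorphM lecR bfam_mul_nm. Qed.

Lemma bfam_starK F : bfam_star (bfam_star F) = F.
Proof. by apply: bfam_ext => i /=; rewrite starK. Qed.

Lemma bfam_star_conjlinear (c : R[i]) F G :
  bfam_star (c *: F + G) = Num.conj c *: bfam_star F + bfam_star G.
Proof. by apply: bfam_ext => i; apply: star_conjlinear. Qed.

Lemma bfam_starM F G : bfam_star (bfam_mul F G) = bfam_mul (bfam_star G) (bfam_star F).
Proof. by apply: bfam_ext => i /=; rewrite starM. Qed.

Lemma bfam_star_identity F : `|bfam_mul (bfam_star F) F| = `|F| ^+ 2.
Proof.
rewrite !nmE -rmorphXn; congr (_%:C); apply/eqP; rewrite eq_le; apply/andP; split.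
  apply: le_trans (bfam_mul_nm _ _) _; rewrite expr2 ler_wpM2r ?nm_ge0//.
  by apply: bfam_nm_le => [|i]; rewrite ?nm_ge0 //= nm_star bfam_nm.
set c := nm (bfam_mul _ _); have c0 : 0 <= c := nm_ge0 _.
have : nm F <= Num.sqrt c.
  apply: bfam_nm_le => [|i]; first exact: sqrtr_ge0.
  rewrite -(@ler_pXn2r _ 2) ?nnegrE ?nm_ge0 ?sqrtr_ge0// sqr_sqrtr// -nm_cstar.
  exact: (bfam_nm (bfam_mul (bfam_star F) F) i).
by rewrite -(@ler_pXn2r _ 2) ?nnegrE ?nm_ge0 ?sqrtr_ge0// sqr_sqrtr.
Qed.

HB.instance Definition _ := isCStarAlgebra.Build R bfam
  bfam_mulA bfam_mul_linearl bfam_mul_linearr bfam_mul_norm bfam_starK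
  bfam_star_conjlinear bfam_starM bfam_star_identity.

Lemma bfam_mulE F G i : cmul F G i = cmul (F i) (G i). Proof. by []. Qed.
Lemma bfam_starE F i : star F i = star (F i). Proof. by []. Qed.

Lemma bfam_of_bound (F : I -> B) M : (forall i, nm (F i) <= M) ->
  {a : bfam | forall i, a i = F i}.
Proof.
by move=> h; have FP : F \in bfam_pred by [apply/asboolP; exists M]; exists (Bfam FP).
Qed.

End BoundedFamilies.

Section Subalgebra.
Variables (R : realType) (A : cstarAlgType R) (S : set A) (HS : cstar_subalgebra S).

(** The proof that [S] is a subalgebra is an argument so that the algebraic structures can be
    attached to the predicate, and the type [subalg] can depend on that proof. *)
Definition subalg_pred of cstar_subalgebra S : {pred A} := fun x => `[< S x >].

Lemma subalg_submod_closed : submod_closed (subalg_pred HS).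
Proof.
have [[S0 Sl] _ _ _] := HS; split; first exact/asboolP.
by move=> c x y /asboolP Sx /asboolP Sy; apply/asboolP/Sl.
Qed.

HB.instance Definition _ := GRing.isSubmodClosed.Build _ _ (subalg_pred HS) subalg_submod_closed.

Record subalg := SubAlg { subval : A; _ : subval \in subalg_pred HS }.
HB.instance Definition _ := [isSub for subval].
HB.instance Definition _ := [Choice of subalg by <:].
HB.instance Definition _ := [SubChoice_isSubLmodule of subalg by <:].

Implicit Types x y : subalg.

Lemma subval_inj : injective subval. Proof. exact: val_inj. Qed.
Lemma subvalP x : S (subval x). Proof. by case: x => x /= /asboolP. Qed.
Lemma subval_linear (c : R[i]) x y : subval (c *: x + y) = c *: subval x + subval y.
Proof. by []. Qed.
Lemma subval_add x y : subval (x + y) = subval x + subval y. Proof. by []. Qed.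
Lemma subval_sub x y : subval (x - y) = subval x - subval y. Proof. by []. Qed.

Lemma subval_ex (a : A) : S a -> {x | subval x = a}.
Proof. by move=> Sa; have aP : a \in subalg_pred HS by [exact/asboolP]; exists (SubAlg aP). Qed.

Definition subnorm x : R[i] := `|subval x|.

Lemma subnormD x y : subnorm (x + y) <= subnorm x + subnorm y.
Proof. exact: ler_normD. Qed.
Lemma subnormZ (c : R[i]) x : subnorm (c *: x) = `|c| * subnorm x.
Proof. exact: normrZ. Qed.
Lemma subnorm_eq0 x : subnorm x = 0 -> x = 0.
Proof. by move=> h; apply: subval_inj; apply: normr0_eq0. Qed.

HB.instance Definition _ := Lmodule_isNormed.Build R[i] subalg subnormD subnormZ subnorm_eq0.

Lemma subval_nm x : nm (subval x) = nm x. Proof. by []. Qed.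

Lemma subalg_complete (u : nat -> subalg) : seq_cauchy u -> exists l, seq_lim u l.
Proof.
move=> cu; have [l hl] := @seq_lim_exists _ A (fun n => subval (u n)) cu.
have Sl : S l.
  have [_ _ _ cS] := HS; apply: (closedE cS) => e e0.
  have [n0 h0] := hl (e / 2) ltac:(lra); exists (subval (u n0)); first exact: subvalP.
  by rewrite nmB; have := h0 _ (leqnn n0); lra.
by have [x hx] := subval_ex Sl; exists x => e /hl; rewrite -hx.
Qed.

HB.instance Definition _ := Uniform_isComplete.Build subalg (complete_of_seq subalg_complete).

Lemma submul_subproof x y : cmul (subval x) (subval y) \in subalg_pred HS.
Proof. by have [_ SM _ _] := HS; apply/asboolP/SM; apply: subvalP. Qed.
Definition submul x y := SubAlg (submul_subproof x y).
Lemma substar_subproof x : star (subval x) \in subalg_pred HS.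
Proof. by have [_ _ Ss _] := HS; apply/asboolP/Ss; apply: subvalP. Qed.
Definition substar x := SubAlg (substar_subproof x).

Lemma submulA x y z : submul x (submul y z) = submul (submul x y) z.
Proof. by apply: subval_inj => /=; rewrite cmulA. Qed.
Lemma submul_linearl (c : R[i]) x y z : submul (c *: x + y) z = c *: submul x z + submul y z.
Proof. by apply: subval_inj => /=; rewrite cmul_linearl. Qed.
Lemma submul_linearr (c : R[i]) x y z : submul x (c *: y + z) = c *: submul x y + submul x z.
Proof. by apply: subval_inj => /=; rewrite cmul_linearr. Qed.
Lemma submul_norm x y : `|submul x y| <= `|x| * `|y|.
Proof. exact: cmul_norm. Qed.
Lemma substarK x : substar (substar x) = x.
Proof. by apply: subval_inj => /=; rewrite starK. Qed.
Lemma substar_conjlinear (c : R[i]) x y : substar (c *: x + y) = Num.conj c *: substar x + substar y.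
Proof. by apply: subval_inj => /=; rewrite star_conjlinear. Qed.
Lemma substarM x y : substar (submul x y) = submul (substar y) (substar x).
Proof. by apply: subval_inj => /=; rewrite starM. Qed.
Lemma substar_identity x : `|submul (substar x) x| = `|x| ^+ 2.
Proof. exact: cstar_identity. Qed.

HB.instance Definition _ := isCStarAlgebra.Build R subalg
  submulA submul_linearl submul_linearr submul_norm substarK substar_conjlinear
  substarM substar_identity.

Lemma subval_mul x y : subval (cmul x y) = cmul (subval x) (subval y). Proof. by []. Qed.
Lemma subval_star x : subval (star x) = star (subval x). Proof. by []. Qed.

End Subalgebra.

(** * Compact operators *)

Section TotallyBounded.
Variable R : realType.

Definition totally_bounded (V : normedZmodType R[i]) (S : set V) :=
  forall e : R, 0 < e -> exists s : seq V, forall x, S x -> exists2 y, y \in s & nm (x - y) <= e.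

Lemma totally_bounded_approx (V : normedZmodType R[i]) (S : set V) :
  (forall e : R, 0 < e -> exists2 S', totally_bounded S' &
     forall x, S x -> exists2 y, S' y & nm (x - y) <= e) -> totally_bounded S.
Proof.
move=> h e e0; have [S' tS' SS'] := h (e / 2) ltac:(lra).
have [s hs] := tS' (e / 2) ltac:(lra).
exists s => x /SS'[y /hs[z zs yz] xy]; exists z => //.
by have := nm_triangle y x z; lra.
Qed.

Lemma totally_boundedD (V : normedZmodType R[i]) (S S' T : set V) :
  totally_bounded S -> totally_bounded S' ->
  (forall x, T x -> exists y z, [/\ S y, S' z & x = y + z]) -> totally_bounded T.
Proof.
move=> tS tS' hT e e0.
have [s hs] := tS (e / 2) ltac:(lra); have [s' hs'] := tS' (e / 2) ltac:(lra).
exists [seq y + z | y <- s, z <- s'] => x /hT[y [z [/hs[y' ys ny] /hs'[z' zs nz] ->]]].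
exists (y' + z'); first by apply/allpairsP; exists (y', z').
by rewrite opprD addrACA; apply: le_trans (nmD _ _) _; lra.
Qed.

Lemma real_grid (M e : R) : 0 < e ->
  exists s : seq R, forall a, `|a| <= M -> exists2 b, b \in s & `|a - b| <= e.
Proof.
move=> e0; have [M0|M0] := ltP M 0.
  by exists [::] => a; rewrite leNgt (lt_le_trans M0).
exists [seq k%:R * e - M | k <- iota 0 (Num.truncn (2 * M / e)).+1] => a aM.
have [a1 a2] : - M <= a /\ a <= M by move: aM; rewrite ler_norml => /andP[].
have t0 : 0 <= (a + M) / e by rewrite divr_ge0 ?(ltW e0)//; lra.
exists ((Num.truncn ((a + M) / e))%:R * e - M).
  apply/mapP; exists (Num.truncn ((a + M) / e)) => //.
  rewrite mem_iota add0n ltnS /=; apply: le_truncn; rewrite ler_pM2r ?invr_gt0//; lra.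
have /andP[h1 h2] := truncn_itv t0.
move: (Num.truncn _) h1 h2 => t; rewrite ler_pdivlMr// ltr_pdivrMr//.
rewrite -[t.+1%:R]natr1 [(_ + 1) * e]mulrDl mul1r ler_norml.
by move: (t%:R * e) => u h1 h2; apply/andP; split; lra.
Qed.

Lemma totally_bounded_disc (V : normedModType R[i]) (x : V) M :
  totally_bounded [set c *: x | c in [set c : R[i] | nm c <= M]].
Proof.
move=> e e0; have x0 := nm_ge0 x.
have d0 : 0 < e / (2 * nm x + 1) by rewrite divr_gt0//; lra.
have [s hs] := real_grid M d0.
exists [seq (a +i* b) *: x | a <- s, b <- s] => _ [c cM <-].
have [a as1 ha] := hs _ (le_trans (normr_Re_le c) cM).
have [b bs hb] := hs _ (le_trans (normr_Im_le c) cM).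
exists ((a +i* b) *: x); first by apply/allpairsP; exists (a, b).
rewrite -scalerBl nmZ.
have : nm (c - (a +i* b)) <= 2 * (e / (2 * nm x + 1)).
  apply: le_trans (nm_Re_Im _) _; rewrite !raddfB /=; lra.
move=> /(ler_wpM2r x0)/le_trans; apply.
by rewrite mulrAC mulrA ler_pdivrMr; nra.
Qed.

Lemma compact_totally_bounded (V : normedModType R[i]) (S : set V) :
  compact (closure S) -> totally_bounded S.
Proof.
rewrite compact_cover => cS e e0.
have [|x Sx|D _ hD] := cS V (closure S) (fun x => ball x e%:C).
- by move=> x _; apply: ball_open; rewrite ltcR.
- by exists x => //; apply: ballxx; rewrite ltcR.
exists (finmap.enum_fset D) => x /subset_closure /hD[y /= yD].
by rewrite -ball_normE /= nmE ltcR nmB => /ltW h; exists y.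
Qed.

(** An ultrafilter that contains [closure S] contains one of finitely many small balls covering it.
    It is therefore Cauchy, and converges by completeness. *)
Lemma totally_bounded_compact (V : completeNormedModType R[i]) (S : set V) :
  totally_bounded S -> compact (closure S).
Proof.
move=> tS; rewrite compact_ultra => F UF FS.
have : cauchy_ex F.
  move=> e e0; have e1 : e = (complex.Re e)%:C by rewrite RRe_real// gtr0_real.
  have re0 : 0 < complex.Re e by rewrite -ltcR -e1.
  have [s hs] := tS (complex.Re e / 3) ltac:(lra).
  have : F (\bigcup_(y in [set` s]) ball y e).
    apply: filterS FS => x /closure_nm/(_ (complex.Re e / 3) ltac:(lra))[x' /hs[y ys ny] nx].
    exists y => //; rewrite -ball_normE /= nmE e1 ltcR nmB.
    by have := nm_triangle x' x y; lra.
  elim: s {hs} => [|y s IH].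
    by rewrite (_ : [set` [::]] = set0) ?bigcup_set0; [move/filter_not_empty|apply/seteqP; split].
  have [Fy|nFy] := in_ultra_setVsetC (ball y e) UF; first by exists y.
  move=> Fu; apply: IH; apply: filterS (filterI Fu nFy) => x [[z /= ]].
  rewrite inE => /orP[/eqP->//|zs] zx _.
  by exists z.
move=> /cauchy_exP/cauchy_cvg/cvg_ex[p Fp]; exists p; split=> //.
apply: closed_closure => B /Fp FB.
by have [x [Bx Sx]] := filter_ex (filterI FB FS); exists x.
Qed.

End TotallyBounded.

Section RankOne.
Variables (R : realType) (H : hilbertType R).

HB.instance Definition _ (a : bop H) := GRing.isLinear.Build R[i] H H *:%R (bopval a)
  (fun c x y => etrans (bopD a (c *: x) y) (congr1 (fun z => z + a y) (bopZ a c x))).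

Lemma rank_one_ex (x y : H) : {a : bop H | forall z, a z = inner z y *: x}.
Proof.
apply: (@bop_of_adjoint _ _ _ (fun z => inner z x *: y) (nm x * nm y)).
  by move=> u v; rewrite innerZl innerZr -inner_conj mulrC.
move=> u; rewrite nmZ; have := ler_wpM2r (nm_ge0 x) (cauchy_schwarz u y).
by move/le_trans; apply; rewrite [leRHS]mulrC mulrA mulrAC.
Qed.

Definition rank_one x y : bop H := proj1_sig (rank_one_ex x y).

Lemma rank_oneE x y z : rank_one x y z = inner z y *: x.
Proof. exact: (proj2_sig (rank_one_ex x y)). Qed.

Lemma rank_one_star x y : star (rank_one x y) = rank_one y x.
Proof.
apply: bop_star_unique => u v; rewrite !rank_oneE innerZl innerZr -inner_conj.
by rewrite mulrC.
Qed.

Lemma rank_one_mull (a : bop H) x y : cmul a (rank_one x y) = rank_one (a x) y.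
Proof. by apply: bop_ext => z; rewrite bop_mulE !rank_oneE bopZ. Qed.

Lemma rank_one_mulr (a : bop H) x y : cmul (rank_one x y) a = rank_one x (star a y).
Proof. by apply: bop_ext => z; rewrite bop_mulE !rank_oneE bop_starP. Qed.

Lemma rank_one_mul x y u v : cmul (rank_one x y) (rank_one u v) = inner u y *: rank_one x v.
Proof.
by apply: bop_ext => z; rewrite bop_mulE bop_scaleE !rank_oneE innerZl mulrC scalerA.
Qed.

Lemma rank_one_nm x y : nm (rank_one x y) <= nm x * nm y.
Proof.
apply: bop_nm_le => [|z]; first by rewrite mulr_ge0 ?nm_ge0.
rewrite rank_oneE nmZ; have := ler_wpM2r (nm_ge0 x) (cauchy_schwarz z y).
by move/le_trans; apply; rewrite [leRHS]mulrC mulrA mulrAC.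
Qed.

Lemma rank_oneDl x x' y : rank_one (x + x') y = rank_one x y + rank_one x' y.
Proof. by apply: bop_ext => z; rewrite bop_addE !rank_oneE scalerDr. Qed.
Lemma rank_oneZl c x y : rank_one (c *: x) y = c *: rank_one x y.
Proof. by apply: bop_ext => z; rewrite bop_scaleE !rank_oneE !scalerA mulrC. Qed.
Lemma rank_oneBl x x' y : rank_one (x - x') y = rank_one x y - rank_one x' y.
Proof. by rewrite rank_oneDl -scaleN1r rank_oneZl scaleN1r. Qed.
Lemma rank_oneBr x y y' : rank_one x (y - y') = rank_one x y - rank_one x y'.
Proof.
by rewrite -[LHS]starK rank_one_star rank_oneBl starB !rank_one_star.
Qed.

Lemma nm_le1 (x : H) : (`|x| <= 1) = (nm x <= 1).
Proof. by rewrite nmE -[X in _ <= X]/((1 : R)%:C) lecR. Qed.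

Definition unit_ball : set H := [set x | nm x <= 1].

Definition tb_operator (a : H -> H) := totally_bounded (a @` unit_ball).

Lemma tb_operator_compact (f : {linear H -> H}) : tb_operator f -> compact_operator f.
Proof.
move=> tf; apply: totally_bounded_compact.
rewrite (_ : [set x : H | `|x| <= 1] = unit_ball)//.
by apply/seteqP; split=> x; rewrite /unit_ball /= nm_le1.
Qed.

Lemma compact_tb_operator (f : {linear H -> H}) : compact_operator f -> tb_operator f.
Proof.
move=> /compact_totally_bounded.
rewrite (_ : [set x : H | `|x| <= 1] = unit_ball)//.
by apply/seteqP; split=> x; rewrite /unit_ball /= nm_le1.
Qed.

Lemma tb_operator_rank_one x y : tb_operator (rank_one x y).
Proof.
move=> e e0; have [s hs] := totally_bounded_disc x (nm y) e0.
exists s => _ [z z1 <-]; apply: hs; exists (inner z y); last by rewrite rank_oneE.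
by apply: le_trans (cauchy_schwarz _ _) _; rewrite -[leRHS]mul1r ler_wpM2r ?nm_ge0.
Qed.

Lemma tb_operatorD (a b : bop H) : tb_operator a -> tb_operator b -> tb_operator (a + b).
Proof.
move=> ta tb; apply: totally_boundedD ta tb _ => _ [z z1 <-].
by exists (a z), (b z); split; [exists z|exists z|].
Qed.

Lemma tb_operator0 : tb_operator (0 : bop H).
Proof. by move=> e e0; exists [:: 0] => _ [z z1 <-]; exists 0; rewrite ?inE// subrr nm0 ltW. Qed.

Lemma tb_operator_approx (a : bop H) :
  (forall e, 0 < e -> exists2 b : bop H, tb_operator b & nm (a - b) <= e) -> tb_operator a.
Proof.
move=> h; apply: totally_bounded_approx => e /h[b tb ab]; exists (b @` unit_ball) => //.
move=> _ [z z1 <-]; exists (b z); first by exists z.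
apply: le_trans (bop_nm (a - b) z) _; rewrite -[leRHS]mulr1.
by rewrite ler_pM ?nm_ge0.
Qed.

Lemma tb_operator_bound (f : {linear H -> H}) : tb_operator f ->
  exists2 M, 0 <= M & forall x, nm (f x) <= M * nm x.
Proof.
move=> /(_ 1 ltr01)[s hs].
(* [s] is a finite [1]-net of the image of the unit ball; the sum of the norms bounds each of its
   points. *)
pose M := \sum_(y <- s) nm y + 1.
have M0 : 0 <= M by rewrite addr_ge0 ?ler01//; apply: sumr_ge0 => *; apply: nm_ge0.
have hM x : nm x <= 1 -> nm (f x) <= M.
  move=> x1; have [|y ys hy] := hs (f x); first by exists x.
  have : nm y <= \sum_(y <- s) nm y.
    by rewrite (big_rem y)//= lerDl; apply: sumr_ge0 => *; apply: nm_ge0.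
  have := nmD (f x - y) y; rewrite subrK /M; lra.
exists M => // x; have [x0|x0] := eqVneq (nm x) 0.
  by rewrite (nm_eq0 x0) linear0 !nm0 mulr0.
have xp : 0 < nm x by rewrite lt_neqAle eq_sym x0 nm_ge0.
have := hM ((nm x)^-1%:C *: x); rewrite linearZ !nmZ nmR ger0_norm ?invr_ge0 ?nm_ge0//.
by rewrite mulVf// => /(_ (lexx _)); rewrite ler_pdivrMl// mulrC.
Qed.

End RankOne.

(** * Finite matrices and compact operators in an orthonormal basis *)

Section Basis.
Variables (R : realType) (H : hilbertType R) (e : nat -> H).
Hypothesis he : forall i j, inner (e i) (e j) = (i == j)%:R.
Hypothesis hd : closure [set x | exists (n : nat) (c : nat -> R[i]),
                       x = \sum_(i < n) c i *: e i] = setT.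

Definition cut n : bop H := \sum_(i < n) rank_one (e i) (e i).

Lemma bop_sumE (I : Type) (s : seq I) P (F : I -> bop H) x :
  (\sum_(i <- s | P i) F i) x = \sum_(i <- s | P i) F i x.
Proof. by apply: (big_morph (fun a : bop H => a x)). Qed.

Lemma cutE n x : cut n x = \sum_(i < n) inner x (e i) *: e i.
Proof. by rewrite bop_sumE; apply: eq_bigr => i _; rewrite rank_oneE. Qed.

Lemma cut_star n : star (cut n) = cut n.
Proof. by rewrite star_sum; apply: eq_bigr => i _; rewrite rank_one_star. Qed.

Lemma inner_cut n x j : (j < n)%N -> inner (cut n x) (e j) = inner x (e j).
Proof.
move=> jn; rewrite cutE inner_suml (bigD1 (Ordinal jn)) //= innerZl he eqxx mulr1.
rewrite big1 ?addr0// => i ij; have {}ij : (i == j :> nat) = false by exact: negbTE.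
by rewrite innerZl he ij mulr0.
Qed.

Lemma cut_basis n i : (i < n)%N -> cut n (e i) = e i.
Proof.
move=> jn; rewrite cutE (bigD1 (Ordinal jn)) //= he eqxx scale1r.
rewrite big1 ?addr0// => k ij; have {}ij : (k == i :> nat) = false by exact: negbTE.
by rewrite he eq_sym ij scale0r.
Qed.

Lemma cut_cut m n x : (m <= n)%N -> cut m (cut n x) = cut m x.
Proof.
move=> mn; rewrite !cutE; apply: eq_bigr => i _.
by rewrite -cutE inner_cut//; apply: leq_trans mn.
Qed.

Lemma cut_cut' m n x : (m <= n)%N -> cut n (cut m x) = cut m x.
Proof.
move=> mn; rewrite (cutE m) bop_sum; apply: eq_bigr => i _.
by rewrite bopZ cut_basis//; apply: leq_trans mn.
Qed.

Lemma cut_mul m n : (m <= n)%N -> cmul (cut m) (cut n) = cut m.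
Proof. by move=> mn; apply: bop_ext => x; rewrite bop_mulE cut_cut. Qed.

Lemma cut_mul' m n : (m <= n)%N -> cmul (cut n) (cut m) = cut m.
Proof. by move=> mn; apply: bop_ext => x; rewrite bop_mulE cut_cut'. Qed.

Lemma cut_orth n x : inner (cut n x) (x - cut n x) = 0.
Proof. by rewrite bop_starP cut_star bopB cut_cut// subrr inner0r. Qed.

Lemma cut_nm n x : nm (cut n x) <= nm x.
Proof.
rewrite -(@ler_pXn2r _ 2) ?nnegrE ?nm_ge0//.
have := nm_sqr_orth (cut_orth n x); rewrite addrC subrK => ->.
by rewrite lerDl sqr_ge0.
Qed.

Lemma cut_nm1 n : nm (cut n) <= 1.
Proof. by apply: bop_nm_le => // x; rewrite mul1r cut_nm. Qed.

Lemma cut_lim x d : 0 < d -> exists n0, forall n, (n0 <= n)%N -> nm (x - cut n x) <= d.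
Proof.
move=> d0; have : [set: H] x by []; rewrite -hd => /closure_nm /(_ (d / 2) ltac:(lra)).
move=> [_ [n0 [c ->]]]; set y := \sum_(i < n0) _ => hy; exists n0 => n hn.
have yP : cut n y = y.
  rewrite bop_sum; apply: eq_bigr => i _; rewrite bopZ cut_basis//.
  exact: leq_trans (ltn_ord i) hn.
have := nm_triangle y x (cut n x); have := cut_nm n (y - x); rewrite bopB yP (nmB y x).
lra.
Qed.

Lemma basis_ext (a b : bop H) : (forall i, a (e i) = b (e i)) -> a = b.
Proof.
move=> h; apply/eqP; rewrite -subr_eq0; apply/eqP.
have {}h i : (a - b) (e i) = 0 by rewrite bop_addE bop_oppE h subrr.
apply: bop_ext => x; rewrite bop_zeroE; apply: nm_small => d d0.
have n0 := nm_ge0 (a - b).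
have [N hN] := cut_lim x (d := d / (nm (a - b) + 1)) ltac:(by rewrite divr_gt0//; lra).
have cx : (a - b) (cut N x) = 0.
  by rewrite cutE bop_sum big1// => i _; rewrite bopZ h scaler0.
have := bop_nm (a - b) (x - cut N x); rewrite bopB cx subr0 => /le_trans; apply.
apply: le_trans (ler_wpM2l n0 (hN N (leqnn _))) _.
by rewrite mulrA ler_pdivrMr; nra.
Qed.

Lemma basis_vec_ext x y : (forall j, inner x (e j) = inner y (e j)) -> x = y.
Proof.
move=> h; apply/eqP; rewrite -subr_eq0; apply/eqP.
apply: nm_small => d d0; have [N hN] := cut_lim (x - y) d0.
apply: le_trans (hN N (leqnn N)).
rewrite [cut N _]cutE big1 ?subr0// => j _.
by rewrite innerBl h subrr scale0r.
Qed.

Lemma basis_entries_ext (a b : bop H) :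
  (forall i j, inner (a (e i)) (e j) = inner (b (e i)) (e j)) -> a = b.
Proof. by move=> h; apply: basis_ext => i; apply: basis_vec_ext. Qed.

Lemma cut_basis_out n i : (n <= i)%N -> cut n (e i) = 0.
Proof.
move=> ni; rewrite cutE big1// => r _; rewrite he.
have -> : (i == r) = false by apply/negbTE; have := ltn_ord r; lia.
by rewrite scale0r.
Qed.

(** The cuts are contractions that converge pointwise to the identity, hence uniformly on a finite
    net and on all that is close to it. *)
Lemma totally_bounded_cut (S : set H) d : 0 < d -> totally_bounded S ->
  exists n0, forall n, (n0 <= n)%N -> forall x, S x -> nm (x - cut n x) <= d.
Proof.
move=> d0 tS; have [s hs] := tS (d / 3) ltac:(lra).
have [n0 hn0] : exists n0, forall n, (n0 <= n)%N ->
    forall y, y \in s -> nm (y - cut n y) <= d / 3.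
  elim: s {hs} => [|y s [n0 IH]]; first by exists 0%N.
  have [n1 h1] := cut_lim y (d := d / 3) ltac:(lra).
  exists (maxn n0 n1) => n; rewrite geq_max => /andP[l0 l1] z.
  by rewrite inE => /orP[/eqP->|/IH]; [apply: h1|apply].
exists n0 => n hn x /hs[y ys xy]; have := hn0 n hn y ys.
have := nm_triangle y x (cut n x); have := nm_triangle (cut n y) y (cut n x).
have := cut_nm n (y - x); rewrite bopB (nmB y x); lra.
Qed.

Definition fin_mx n (a : bop H) := cmul (cut n) (cmul a (cut n)) = a.

Lemma fin_mxP n a : fin_mx n a <-> cmul (cut n) a = a /\ cmul a (cut n) = a.
Proof.
split=> [h|[h1 h2]]; last by rewrite /fin_mx h2.
split; first by rewrite -{1}h cmulA cut_mul//.
by rewrite -{1}h -!cmulA cut_mul//.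
Qed.

Lemma fin_mx_mono m n a : (m <= n)%N -> fin_mx m a -> fin_mx n a.
Proof.
move=> mn /fin_mxP[h1 h2]; apply/fin_mxP; split.
  by rewrite -h1 cmulA cut_mul'.
by rewrite -h2 -cmulA cut_mul.
Qed.

Lemma fin_mx_linear n (c : R[i]) a b : fin_mx n a -> fin_mx n b -> fin_mx n (c *: a + b).
Proof. by rewrite /fin_mx => ha hb; rewrite cmul_linearl cmul_linearr ha hb. Qed.

Lemma fin_mx0 n : fin_mx n 0.
Proof. by rewrite /fin_mx cmul0l cmul0r. Qed.

Lemma fin_mx_mul n a b : fin_mx n a -> fin_mx n b -> fin_mx n (cmul a b).
Proof.
move=> /fin_mxP[h1 h2] /fin_mxP[h3 h4]; apply/fin_mxP.
by rewrite cmulA h1 -cmulA h4.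
Qed.

Lemma fin_mx_star n a : fin_mx n a -> fin_mx n (star a).
Proof.
move=> /fin_mxP[h1 h2]; apply/fin_mxP.
split; first by rewrite -[X in cmul X _]cut_star -starM h2.
by rewrite -[X in cmul _ X]cut_star -starM h1.
Qed.

Lemma fin_mx_sum n a : fin_mx n a -> a = \sum_(i < n) rank_one (e i) (star a (e i)).
Proof.
move=> /fin_mxP[h _]; rewrite -{1}h cmul_suml; apply: eq_bigr => i _.
by rewrite rank_one_mulr.
Qed.

(** Compact operators as norm limits of finite matrices; [Kset_tb] and [tb_Kset] identify them with
    the operators that map the unit ball to a totally bounded set. *)
Definition Kset : set (bop H) := closure [set a | exists n, fin_mx n a].

Lemma KsetP a : Kset a <->
  forall d, 0 < d -> exists n b, fin_mx n b /\ nm (a - b) <= d.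
Proof.
split=> [/closure_nm h d /h[b [n hb] hab]|h]; first by exists n, b; split=> //; apply: ltW.
apply/closure_nm => d d0; have [n [b [hb hab]]] := h (d / 2) ltac:(lra).
by exists b; [exists n|lra].
Qed.

Lemma fin_mx_Kset n a : fin_mx n a -> Kset a.
Proof. by move=> h; apply: subset_closure; exists n. Qed.

Lemma Kset_closed a : (forall d, 0 < d -> exists2 b, Kset b & nm (a - b) <= d) -> Kset a.
Proof.
move=> h; apply/KsetP => d d0; have [b /KsetP hb hab] := h (d / 2) ltac:(lra).
have [n [c [fc bc]]] := hb (d / 2) ltac:(lra); exists n, c; split=> //.
exact: nm_triangle2 hab bc.
Qed.

Lemma Kset_linear (c : R[i]) a b : Kset a -> Kset b -> Kset (c *: a + b).
Proof.
move=> /KsetP ha /KsetP hb; apply/KsetP => d d0; have c0 := nm_ge0 c.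
have [n [a' [fa ha']]] := ha (d / 2 / (nm c + 1)) ltac:(by rewrite divr_gt0//; lra).
have [m [b' [fb hb']]] := hb (d / 2) ltac:(lra).
exists (maxn n m), (c *: a' + b'); split.
  apply: fin_mx_linear; first exact: fin_mx_mono (leq_maxl _ _) fa.
  exact: fin_mx_mono (leq_maxr _ _) fb.
rewrite opprD addrACA -scalerBr; apply: le_trans (nmD _ _) _; rewrite nmZ.
have : nm c * nm (a - a') <= d / 2.
  apply: le_trans (ler_wpM2l c0 ha') _.
  by rewrite mulrA ler_pdivrMr; nra.
lra.
Qed.

Lemma Kset0 : Kset 0.
Proof. exact: (fin_mx_Kset (fin_mx0 0)). Qed.

Lemma KsetD a b : Kset a -> Kset b -> Kset (a + b).
Proof. by move=> ha hb; have := Kset_linear (c := 1) ha hb; rewrite scale1r. Qed.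

Lemma Kset_sum (I : Type) (s : seq I) (P : pred I) (F : I -> bop H) :
  (forall i, P i -> Kset (F i)) -> Kset (\sum_(i <- s | P i) F i).
Proof. by move=> h; elim/big_ind: _ => //; [exact: Kset0|exact: KsetD]. Qed.

Lemma Kset_star a : Kset a -> Kset (star a).
Proof.
move=> /KsetP h; apply/KsetP => d /h[n [b [fb ab]]]; exists n, (star b).
by split; [exact: fin_mx_star|rewrite -starB nm_star].
Qed.

Lemma Kset_rank_one x y : Kset (rank_one x y).
Proof.
have fin n u v : fin_mx n (rank_one (cut n u) (cut n v)).
  by apply/fin_mxP; rewrite rank_one_mull rank_one_mulr cut_star !cut_cut.
apply/KsetP => d d0; have x0 := nm_ge0 x; have y0 := nm_ge0 y.
have [n0 h0] := cut_lim x (d := d / 2 / (nm y + 1)) ltac:(by rewrite divr_gt0//; lra).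
have [n1 h1] := cut_lim y (d := d / 2 / (nm x + 1)) ltac:(by rewrite divr_gt0//; lra).
pose n := maxn n0 n1; exists n, (rank_one (cut n x) (cut n y)); split=> //.
have -> : rank_one x y - rank_one (cut n x) (cut n y) =
    rank_one (x - cut n x) y + rank_one (cut n x) (y - cut n y).
  by rewrite rank_oneBl rank_oneBr addrA subrK.
apply: le_trans (nmD _ _) _.
have := rank_one_nm (x - cut n x) y; have := rank_one_nm (cut n x) (y - cut n y).
have := h0 n (leq_maxl _ _); have := h1 n (leq_maxr _ _); have := cut_nm n x.
move: (nm (rank_one _ _)) (nm (rank_one _ _)) => r1 r2.
move: (nm (x - _)) (nm_ge0 (x - cut n x)) (nm (y - _)) (nm_ge0 (y - cut n y)) (nm (cut n x)) (nm_ge0 (cut n x)).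
move=> p p0 q q0 z z0 zx; rewrite !ler_pdivlMr; try lra.
by move=> hq hp h2 h3; nra.
Qed.

Lemma Kset_mull a b : Kset b -> Kset (cmul a b).
Proof.
move=> /KsetP hb; apply: Kset_closed => d d0; have a0 := nm_ge0 a.
have [n [c [fc bc]]] := hb (d / (nm a + 1)) ltac:(by rewrite divr_gt0//; lra).
exists (cmul a c).
  rewrite (fin_mx_sum fc) cmul_sumr; apply: Kset_sum => i _.
  by rewrite rank_one_mull; apply: Kset_rank_one.
rewrite -cmulBr; apply: le_trans (nm_cmul _ _) _.
apply: le_trans (ler_wpM2l a0 bc) _.
by rewrite mulrA ler_pdivrMr; nra.
Qed.

Lemma Kset_subalgebra : cstar_subalgebra Kset.
Proof.
split; [split; [exact: Kset0|exact: Kset_linear]|..].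
- by move=> a b _; apply: Kset_mull.
- exact: Kset_star.
- exact: closed_closure.
Qed.

Lemma Kset_tb a : Kset a -> tb_operator a.
Proof.
move=> /KsetP h; apply: tb_operator_approx => d /h[n [b [fb ab]]]; exists b => //.
rewrite (fin_mx_sum fb); elim/big_ind: _ => //; first exact: tb_operator0.
  by move=> u v; apply: tb_operatorD.
by move=> i _; apply: tb_operator_rank_one.
Qed.

Lemma tb_cut (a : bop H) d : 0 < d -> tb_operator a ->
  exists n0, forall n, (n0 <= n)%N -> nm (a - cmul (cut n) a) <= d.
Proof.
move=> d0 /(totally_bounded_cut d0)[n0 h]; exists n0 => n hn.
apply: bop_nm_le => [|x]; first exact: ltW.
have [x0|x0] := eqVneq (nm x) 0.
  by rewrite (nm_eq0 x0) bop0 nm0 mulr0.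
have xp : 0 < nm x by rewrite lt_neqAle eq_sym x0 nm_ge0.
have := h n hn (a ((nm x)^-1%:C *: x)) _; rewrite !bopZ -scalerBr nmZ.
rewrite nmR ger0_norm ?invr_ge0 ?nm_ge0// ler_pdivrMl// mulrC; apply.
exists ((nm x)^-1%:C *: x); last by rewrite bopZ.
by rewrite /unit_ball /= nmZ nmR ger0_norm ?invr_ge0 ?nm_ge0// mulVf.
Qed.

Lemma tb_Kset (a : bop H) : tb_operator a -> Kset a.
Proof.
move=> ta; apply: Kset_closed => d d0; have [n h] := tb_cut d0 ta.
exists (cmul (cut n) a); last exact: h.
rewrite cmul_suml; apply: Kset_sum => i _; rewrite rank_one_mulr; exact: Kset_rank_one.
Qed.

(** The vector is the sum of the [conj (phi (e i)) *: e i]. Its partial sums satisfy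
    [|g n|^2 = phi (g n) <= M |g n|], hence [|g n| <= M], and a series with bounded square sums
    converges. *)
Lemma riesz (phi : H -> R[i]) M : 0 <= M ->
  (forall (c : R[i]) x y, phi (c *: x + y) = c * phi x + phi y) ->
  (forall x, nm (phi x) <= M * nm x) -> exists g, forall x, phi x = inner x g.
Proof.
move=> M0 lin bd.
have phi0 : phi 0 = 0 by have := lin (-1) 0 0; rewrite scaler0 addr0 mulN1r addNr.
have phi_sum n (c : nat -> R[i]) : phi (\sum_(i < n) c i *: e i) = \sum_(i < n) c i * phi (e i).
  elim: n => [|n IH]; first by rewrite !big_ord0.
  by rewrite !big_ord_recr /= addrC lin IH addrC.
pose c i := Num.conj (phi (e i)).
pose g n := \sum_(i < n) c i *: e i.
have nm_g (m n : nat) : (m <= n)%N -> nm (g n - g m) ^+ 2 = \sum_(m <= i < n) nm (phi (e i)) ^+ 2.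
  move=> mn; rewrite /g -!(big_mkord xpredT (fun i => c i *: e i)).
  rewrite (big_cat_nat _ (n:=m)) //= addrAC subrr add0r; apply: complexI.
  rewrite -inner_nm rmorph_sum inner_suml /= [LHS]big_nat [RHS]big_nat; apply: eq_bigr => i /andP[mi ni].
  rewrite inner_sumr (bigD1_seq i) ?mem_index_iota ?mi ?iota_uniq//= big1_seq ?addr0.
    by rewrite innerZl innerZr he eqxx mulr1 nm_sqr /c conjCK mulrC.
  by move=> j /andP[ji _]; rewrite innerZl innerZr he eq_sym (negbTE ji) !mulr0.
have g_le n : nm (g n) <= M.
  have h : nm (g n) ^+ 2 <= M * nm (g n).
    have := nm_g 0%N n (leq0n _); rewrite [g 0%N]big_ord0 subr0 => hg.
    have := bd (g n); suff -> : phi (g n) = (nm (g n) ^+ 2)%:C.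
      by rewrite nmR ger0_norm ?sqr_ge0.
    rewrite phi_sum hg big_mkord rmorph_sum /=; apply: eq_bigr => i _.
    by rewrite nm_sqr /c mulrC.
  have := nm_ge0 (g n); rewrite le_eqVlt => /orP[/eqP<-//|gp].
  by rewrite -(ler_pM2r gp) -expr2.
have tl : forall d, 0 < d -> exists n0, forall n, \sum_(n0 <= i < n) nm (phi (e i)) ^+ 2 <= d.
  apply: (@partial_sum_tail _ _ (M ^+ 2)) => [i|n]; first exact: sqr_ge0.
  have := nm_g 0%N n (leq0n _); rewrite [g 0%N]big_ord0 subr0 big_mkord => <-.
  by rewrite ler_pXn2r ?nnegrE ?nm_ge0.
have cg : seq_cauchy g.
  move=> d d0; have [n0 h0] := tl (d ^+ 2) ltac:(by rewrite exprn_gt0).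
  exists n0.
  have main m n : (n0 <= m)%N -> (m <= n)%N -> nm (g n - g m) <= d.
    move=> hm mn; rewrite -(@ler_pXn2r _ 2) ?nnegrE ?nm_ge0 ?(ltW d0)// nm_g//.
    apply: le_trans (h0 n); rewrite [leRHS](big_cat_nat _ (n:=m)) //= lerDr.
    by apply: sumr_ge0 => i _; apply: sqr_ge0.
  move=> n m hn hm; have [nm'|/ltnW mn] := leqP n m; last exact: main.
  by rewrite nmB; apply: main.
have [l hl] := seq_lim_exists cg; exists l => x.
have le i : inner (e i) l = phi (e i).
  apply/eqP; rewrite -subr_eq0; apply/eqP/nm_small => d d0.
  have [n0 h0] := hl d d0; pose n := maxn n0 i.+1.
  have -> : phi (e i) = inner (e i) (g n).
    have ni : (i < n)%N by rewrite leq_maxr.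
    rewrite inner_sumr (bigD1 (Ordinal ni)) //= innerZr he eqxx mulr1 conjCK.
    rewrite big1 ?addr0// => j ij; have {}ij : (j == i :> nat) = false by exact: negbTE.
    by rewrite innerZr he eq_sym ij mulr0.
  rewrite -innerBr; apply: le_trans (cauchy_schwarz _ _) _.
  have -> : nm (e i) = 1.
    apply/eqP; rewrite -(@eqrXn2 _ 2) ?nm_ge0// expr1n; apply/eqP/complexI.
    by rewrite -inner_nm he eqxx.
  by rewrite mul1r nmB; apply: h0; rewrite leq_maxl.
apply/eqP; rewrite -subr_eq0; apply/eqP/nm_small => d d0.
have l0 := nm_ge0 l.
have [n h] := cut_lim x (d := d / (M + nm l + 1)) ltac:(by rewrite divr_gt0//; lra).
have {h} := h n (leqnn _).
have e0 : phi (cut n x) = inner (cut n x) l.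
  by rewrite cutE (phi_sum n (fun i => inner x (e i))) inner_suml; apply: eq_bigr => i _; rewrite innerZl le.
have -> : phi x - inner x l = phi (x - cut n x) - inner (x - cut n x) l.
  have -> : phi (x - cut n x) = phi x - phi (cut n x).
    by rewrite addrC -scaleN1r lin mulN1r addrC.
  by rewrite innerBl e0 opprB addrA subrK.
rewrite ler_pdivlMr; last by lra.
have := bd (x - cut n x); have := cauchy_schwarz (x - cut n x) l.
have := nmD (phi (x - cut n x)) (- inner (x - cut n x) l); rewrite nmN.
move: (nm (x - _)) (nm_ge0 (x - cut n x)) => p p0; nra.
Qed.

(** [compact_operator] speaks of arbitrary linear maps, whereas [bop] requires an adjoint; its value
    at [y] is the Riesz vector of [x |-> inner (f x) y]. *)
Lemma bounded_operator (f : {linear H -> H}) M : 0 <= M ->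
  (forall x, nm (f x) <= M * nm x) -> exists a : bop H, forall x, a x = f x.
Proof.
move=> M0 bd.
have /choice[g hg] : forall y, exists g, forall x, inner (f x) y = inner x g.
  move=> y; apply: (@riesz (fun x => inner (f x) y) (M * nm y)).
  - by rewrite mulr_ge0 ?nm_ge0.
  - by move=> c x z; rewrite linearP innerDl innerZl.
  - move=> x; apply: le_trans (cauchy_schwarz _ _) _.
    by rewrite mulrAC ler_wpM2r ?nm_ge0.
have [a ha] := bop_of_adjoint (fun x y => hg y x) bd.
by exists a.
Qed.

Lemma compact_operator_Kset (f : {linear H -> H}) :
  compact_operator f -> exists2 a, Kset a & forall x, a x = f x.
Proof.
move=> /compact_tb_operator tf; have [M M0 bd] := tb_operator_bound tf.
have [a ha] := bounded_operator M0 bd; exists a => //; apply: tb_Kset.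
by rewrite /tb_operator (_ : bopval a = f)//; apply/funext.
Qed.

Definition compacts : cstarAlgType R := subalg Kset_subalgebra.

Lemma compacts_is_l2 : is_compacts_l2 compacts.
Proof.
exists H, (fun a : compacts => bopval (subval a) : {linear H -> H}); split; first by exists e.
split.
- move=> f; split=> [/compact_operator_Kset[a Ka ha]|[a ha]].
    by have [x hx] := subval_ex Kset_subalgebra Ka; exists x => z; rewrite /= hx ha.
  apply: tb_operator_compact; rewrite /tb_operator (_ : GRing.Linear.sort f = bopval (subval a)).
    exact: (Kset_tb (subvalP a)).
  by apply/funext => x; rewrite ha.
- move=> c a b x.
  have h : subval (c *: a + b) x = c *: subval a x + subval b x by rewrite subval_linear.
  exact: h.
- by move=> a b x; exact: erefl.
- by move=> a x y; exact: esym (bop_starPr (subval a) x y).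
- move=> a; split=> [x|M M0 h].
    by rewrite [`|a|]nmE !nmE -rmorphM lecR; apply: (bop_nm (subval a)).
  have Mr : M = (complex.Re M)%:C by rewrite RRe_real// ger0_real.
  rewrite [`|a|]nmE Mr lecR; apply: (bop_nm_le (a := subval a)).
    by rewrite -ler0c -Mr.
  move=> x; have := h x; rewrite /= !nmE Mr -rmorphM lecR; exact.
Qed.

End Basis.

(** * Projections in a stable algebra *)

Section SquareRoot.
Variables (R : realType) (A : cstarAlgType R).

Lemma pow_small (r d : R) : 0 <= r -> r < 1 -> 0 < d -> exists n, r ^+ n <= d.
Proof.
move=> r0 r1 d0; have : (GRing.exp r : R^nat) @ \oo --> (0 : R).
  by apply: cvg_expr; rewrite ger0_norm.
move/cvgrPdist_le => /(_ d d0)[n _ h]; exists n.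
by have := h n (leqnn n); rewrite sub0r normrN ger0_norm ?exprn_ge0.
Qed.

(* [1 - h = (1 - d)^2], written without a unit; [d] is the fixed point of the
   contraction [x |-> (h + x^2) / 2]. *)
Lemma sqrt_one_sub (h : A) : nm h < 1 -> star h = h ->
  exists2 d, star d = d & d + d - cmul d d = h.
Proof.
move=> r1 hs; set r := nm h in r1; have r0 : 0 <= r := nm_ge0 h.
pose F (x : A) := (2^-1 : R)%:C *: (h + cmul x x).
pose u n := iter n F 0.
have nm_half (x : A) : nm ((2^-1 : R)%:C *: x) = nm x / 2.
  by rewrite nmZ nmR ger0_norm ?invr_ge0// mulrC.
have ur n : nm (u n) <= r.
  elim: n => [|n IH]; first by rewrite nm0.
  rewrite [u n.+1]/(F (u n)) /F nm_half.
  have := nmD h (cmul (u n) (u n)); have := nm_cmul (u n) (u n); rewrite -/r.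
  by have := nm_ge0 (u n); nra.
have Fl x y : nm x <= r -> nm y <= r -> nm (F x - F y) <= r * nm (x - y).
  move=> xr yr; rewrite -scalerBr nm_half opprD addrACA subrr add0r.
  have -> : cmul x x - cmul y y = cmul x (x - y) + cmul (x - y) y.
    by rewrite cmulBr cmulBl addrA subrK.
  have := nmD (cmul x (x - y)) (cmul (x - y) y).
  have := nm_cmul x (x - y); have := nm_cmul (x - y) y; have := nm_ge0 (x - y).
  by nra.
have us n : star (u n) = u n.
  elim: n => [|n IH]; first exact: star0.
  by rewrite [u n.+1]/(F (u n)) /F starZ conjRC starD starM hs IH.
have step n : nm (u n.+1 - u n) <= r ^+ n.
  elim: n => [|n IH].
    rewrite expr0 subr0; exact: le_trans (ur 1%N) (ltW r1).
  by apply: le_trans (Fl _ _ (ur n.+1) (ur n)) _; rewrite exprS ler_wpM2l.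
(* The geometric series in telescoped form: passing from [k] to [k.+1] adds at most
   [(1 - r) * r ^+ (n + k)] to both sides. *)
have tail n k : (1 - r) * nm (u (n + k)%N - u n) <= r ^+ n - r ^+ (n + k).
  elim: k => [|k IH]; first by rewrite addn0 !subrr nm0 mulr0.
  have := nm_triangle (u (n + k)%N) (u (n + k.+1)%N) (u n).
  have := step (n + k)%N; rewrite addnS exprS; move: IH.
  move: (nm (u (n + k)%N - _)) (nm (u (n + k).+1 - _)) (nm (u (n + k).+1 - _)) (r ^+ (n + k)).
  by move=> a b c p h1 h2 h3; nra.
have tail1 n k : (n <= k)%N -> nm (u k - u n) <= r ^+ n / (1 - r).
  move=> nk; rewrite ler_pdivlMr ?subr_gt0// mulrC -(subnKC nk).
  by apply: le_trans (tail _ _) _; rewrite lerBlDr lerDl exprn_ge0.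
have [d hd] : exists d, seq_lim u d.
  apply: seq_lim_exists => e e0.
  have [n0 hn0] := pow_small r0 r1 (d := e / 2 * (1 - r)) ltac:(by apply: mulr_gt0; lra).
  have {}hn0 : r ^+ n0 / (1 - r) <= e / 2 by rewrite ler_pdivrMr// subr_gt0.
  exists n0 => n m hn hm; apply: (@nm_triangle2 _ _ (u n0)); last rewrite nmB.
    exact: le_trans (tail1 _ _ hn) _.
  exact: le_trans (tail1 _ _ hm) _.
have dr : nm d <= r by apply: (seq_lim_le hd (n0 := 0%N)) => n _.
exists d.
  apply/eqP; rewrite -subr_eq0; apply/eqP/nm_small => e e0.
  have [n0 h0] := hd (e / 2) ltac:(lra).
  apply: (@nm_triangle2 _ _ (u n0)); last exact: h0.
  by rewrite nmB -[u n0 in X in X <= _]us -starB nm_star h0.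
have Fd : F d = d.
  apply/eqP; rewrite -subr_eq0; apply/eqP/nm_small => e e0.
  have [n0 h0] := hd (e / 2) ltac:(lra).
  apply: (@nm_triangle2 _ _ (u n0.+1)); last exact: h0.
  apply: le_trans (Fl _ _ dr (ur n0)) _; rewrite nmB.
  apply: le_trans (h0 n0 (leqnn _)); rewrite -[leRHS]mul1r.
  by rewrite ler_wpM2r ?nm_ge0// ltW.
have -> : d + d = h + cmul d d; last by rewrite addrK.
rewrite -{1 2}Fd /F -scalerDl -rmorphD /= (_ : 2^-1 + 2^-1 = 1 :> R) ?scale1r//; lra.
Qed.

(* A GNS-type estimate: [phi] plays the part of the state. *)
Lemma left_mul_bound (H : hilbertType R) (theta : A -> H) (phi : A -> R[i]) :
  (forall x y, theta (x - y) = theta x - theta y) ->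
  (forall (c : R) x, theta (c%:C *: x) = c%:C *: theta x) ->
  (forall x y, inner (theta x) (theta y) = phi (cmul (star y) x)) ->
  forall k l, nm (theta (cmul k l)) <= nm k * nm (theta l).
Proof.
move=> thB thZ thI k l.
(* With [1 - k'^* k' = (1 - d)^2], the difference of the squared norms of [theta l] and
   [theta (k' l)] is that of [theta ((1 - d) l)]. *)
have main k' : nm k' < 1 -> nm (theta (cmul k' l)) <= nm (theta l).
  move=> k1; pose h := cmul (star k') k'.
  have h1 : nm h < 1 by rewrite nm_cstar; have := nm_ge0 k'; nra.
  have hs : star h = h by rewrite /h starM starK.
  have [d ds dh] := sqrt_one_sub h1 hs.
  rewrite -(@ler_pXn2r _ 2) ?nnegrE ?nm_ge0//.
  suff e : nm (theta l) ^+ 2 = nm (theta (cmul k' l)) ^+ 2 + nm (theta (l - cmul d l)) ^+ 2.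
    by rewrite e lerDl sqr_ge0.
  apply: complexI; rewrite rmorphD /= -!inner_nm.
  have -> : inner (theta (cmul k' l)) (theta (cmul k' l)) = inner (theta (cmul h l)) (theta l).
    by rewrite !thI starM !cmulA.
  have -> : inner (theta (l - cmul d l)) (theta (l - cmul d l)) =
      inner (theta (l - cmul h l)) (theta l).
    rewrite !thI; congr phi; rewrite -dh starB starM ds.
    rewrite !(cmulBl, cmulDl, cmulBr, cmulDr, cmulA) !opprB !opprD.
    set a := cmul _ l; set b := cmul _ l; set c := cmul _ l.
    by rewrite !addrA; congr (_ + _); rewrite -!addrA; congr (_ + _); rewrite addrC.
  by rewrite -innerDl thB addrC subrK.
have k0 := nm_ge0 k; apply/ler_addgt0Pr => e e0.
have t0 := nm_ge0 (theta l).
(* [main] needs norm below 1, so [k] is divided by slightly more than its norm; the excess costs at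
   most [e]. *)
pose c := nm k + e / (nm (theta l) + 1).
have e1 : 0 < e / (nm (theta l) + 1) by rewrite divr_gt0//; lra.
have c0 : 0 < c by rewrite /c; lra.
have := main ((c^-1)%:C *: k); rewrite nmZ nmR ger0_norm ?invr_ge0 ?(ltW c0)//.
rewrite ltr_pdivrMl// mulr1 cmulZl thZ nmZ nmR ger0_norm ?invr_ge0 ?(ltW c0)//.
rewrite ler_pdivrMl// => /(_ _)/le_trans; apply; first by rewrite /c; lra.
rewrite /c mulrDl lerD2l mulrAC ler_pdivrMr; last by lra.
nra.
Qed.

End SquareRoot.

Section CompactsFacts.
Variables (R : realType) (K : cstarAlgType R) (H : hilbertType R).
Variable rho : K -> {linear H -> H}.
Hypothesis rhoP : compact_operator_algebra rho.
Variable e : nat -> H.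
Hypothesis he : forall i j, inner (e i) (e j) = (i == j)%:R.
Hypothesis hd : closure [set x | exists (n : nat) (c : nat -> R[i]),
                       x = \sum_(i < n) c i *: e i] = setT.

Lemma rho_sub a b x : rho (a - b) x = rho a x - rho b x.
Proof.
case: rhoP => _ lin _ _ _; have := lin (-1) b a x.
by rewrite !scaleN1r ![- _ + _]addrC.
Qed.

Lemma rho_nm_le a M : 0 <= M -> (forall x, nm (rho a x) <= M * nm x) -> nm a <= M.
Proof.
case: rhoP => _ _ _ _ /(_ a)[_ h] M0 hM; rewrite -lecR -nmE; apply: h.
  by rewrite ler0c.
by move=> x; rewrite !nmE -rmorphM lecR.
Qed.

Lemma rho_inj a b : rho a =1 rho b -> a = b.
Proof.
move=> h; apply/eqP; rewrite -subr_eq0; apply/eqP/nm_le0/rho_nm_le => // x.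
by rewrite rho_sub h subrr nm0 mul0r.
Qed.

Lemma rho_onto (b : bop H) : Kset e b -> exists a, forall x, rho a x = b x.
Proof.
move=> /(Kset_tb he) tb; case: rhoP => hc _ _ _ _.
exact/(hc (bopval b : {linear H -> H})).1/tb_operator_compact.
Qed.

Lemma compacts_shift (m : nat) : exists p v : K,
  [/\ star p = p, cmul p p = p, cmul (star v) v = p, cmul p v = 0 &
      forall x, rho p x = cut e m x].
Proof.
pose b : bop H := \sum_(i < m) rank_one (e (i + m)%N) (e i).
have [p hp] : exists a, forall x, rho a x = cut e m x.
  by apply: rho_onto; apply: Kset_sum => // i _; apply: Kset_rank_one.
have [v hv] : exists a, forall x, rho a x = b x.
  by apply: rho_onto; apply: Kset_sum => // i _; apply: Kset_rank_one.
case: rhoP => _ _ mul adj _.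
have bE x : b x = \sum_(i < m) inner x (e i) *: e (i + m)%N.
  by rewrite bop_sumE; apply: eq_bigr => i _; rewrite rank_oneE.
exists p, v; split=> //; apply: rho_inj => x; rewrite ?mul ?hp.
- by apply: inner_inj => y; rewrite adj hp bop_starPr cut_star.
- by rewrite (cut_cut he).
- apply: inner_inj => y; rewrite adj !hv cutE !bE !inner_suml.
  apply: eq_bigr => i _; rewrite !innerZl inner_sumr (bigD1 i)//= innerZr he eqxx mulr1.
  rewrite big1 ?addr0 -?inner_conj// => j ji; rewrite innerZr he eqn_add2r.
  have -> : (i == j :> nat) = false by rewrite eq_sym; exact: negbTE.
  by rewrite mulr0.
- rewrite hv bE bop_sum big1 => [|i _].
    by have := rho_sub 0 0 x; rewrite !subrr.
  rewrite bopZ cutE big1 ?scaler0// => j _; rewrite he.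
  have -> : (i + m == j)%N = false by apply/negbTE; have := ltn_ord j; lia.
  by rewrite scale0r.
Qed.

Lemma compacts_approx (k : K) d : 0 < d ->
  exists n0, forall n, (n0 <= n)%N -> forall p, (forall x, rho p x = cut e n x) ->
    nm (k - cmul p k) <= d.
Proof.
move=> d0; case: (rhoP) => hc _ mul _ _.
have /compact_tb_operator tk : compact_operator (rho k) by apply/hc; exists k.
have [M M0 bd] := tb_operator_bound tk.
have [a ha] := bounded_operator he hd M0 bd.
have [|n0 h0] := tb_cut he hd (a := a) d0.
  by rewrite /tb_operator (_ : bopval a = rho k)//; apply/funext.
exists n0 => n /h0 hn p hp; apply: rho_nm_le => [|x]; first exact: ltW.
rewrite rho_sub mul hp -ha.
by apply: le_trans (bop_nm (a - cmul (cut e n) a) x) _; rewrite ler_wpM2r ?nm_ge0.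
Qed.

End CompactsFacts.

(** The denominators of [eta] and [d] in [stable_splitting] are designed for this estimate and the
    next one. *)
Lemma frac_bound (R : realType) (e a b : R) : 0 <= e -> 0 <= a -> 0 <= b ->
  e / ((a + 1) * (b + 1)) * a * b <= e.
Proof.
move=> e0 a0 b0; have p : 0 < (a + 1) * (b + 1) by rewrite mulr_gt0//; lra.
rewrite -mulrA mulrAC ler_pdivrMr//.
have ab := mulr_ge0 a0 b0; have := mulr_ge0 e0 a0; have := mulr_ge0 e0 b0; nra.
Qed.

Lemma frac_bound' (R : realType) (d e x b : R) : 0 <= x -> 0 <= b -> 0 <= d -> 0 <= e ->
  d <= e / ((x + 1) * (b + 2)) -> d * (b + 2) * x <= e.
Proof.
move=> x0 b0 d0 e0; rewrite ler_pdivlMr ?mulr_gt0; try lra.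
by apply: le_trans; rewrite -mulrA ler_wpM2l// mulrC ler_wpM2r//; lra.
Qed.

Section StableSplitting.
Variables (R : realType) (A : cstarAlgType R) (I : Type) (H : hilbertType R).
Variable pi : I -> A -> bop H.
Hypothesis pi_linear : forall i (c : R[i]) x y, pi i (c *: x + y) = c *: pi i x + pi i y.
Hypothesis pi_mul : forall i x y, pi i (cmul x y) = cmul (pi i x) (pi i y).
Hypothesis pi_star : forall i x, pi i (star x) = star (pi i x).
Hypothesis pi_nm : forall i x, nm (pi i x) <= nm x.
Hypothesis pi_nm_le : forall x M, 0 <= M -> (forall i, nm (pi i x) <= M) -> nm x <= M.

Let piB i x y : pi i (x - y) = pi i x - pi i y.
Proof. by have := pi_linear i (-1) y x; rewrite !scaleN1r ![- _ + _]addrC. Qed.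

Let piZ i c x : pi i (c *: x) = c *: pi i x.
Proof.
have pi0 : pi i 0 = 0 by have := piB i 0 0; rewrite !subrr.
by have := pi_linear i c x 0; rewrite !addr0 pi0 addr0.
Qed.

(* [L m s s']: for projections [p] onto the first [m] basis vectors and [v] the
   shift of these vectors by [m], [s] and [s'] are the images of the same sum
   of tensors [a (x) k] multiplied by [1 (x) p], resp. [1 (x) v p], up to a
   common factor on the right. *)
Lemma stable_splitting : stable A -> exists L : nat -> A -> A -> Prop,
  (forall m s s' t t', L m s s' -> L m t t' ->
     cmul (star s') s' = cmul (star s) s /\ cmul (star s) t' = 0) /\
  (forall x e, cmul x x = x -> 0 < e -> exists m s s', L m s s' /\ nm (s - x) <= e).
Proof.
move=> [K [T [[H' [rho [[ee [he hd]] rhoP]]] [tau [tauM tauS _ tauD]] [f [[fM fS] [g fK gK]]]]]].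
have f_inj : injective f := can_inj fK.
have gB x y : g (x - y) = g x - g y by apply: f_inj; rewrite linearB !gK.
have g0 : g 0 = 0 by have := gB 0 0; rewrite !subrr.
have gZ c x : g (c *: x) = c *: g x by apply: f_inj; rewrite linearZ !gK.
have gM x y : g (cmul x y) = cmul (g x) (g y) by apply: f_inj; rewrite fM !gK.
have gS x : g (star x) = star (g x) by apply: f_inj; rewrite fS !gK.
(* No continuity of [g] is assumed: each vector state of [pi i], pulled back along [g], gives a
   seminorm to which [left_mul_bound] applies. *)
have g_bound t l : nm (g (cmul t l)) <= nm t * nm (g l).
  apply: pi_nm_le => [|i]; first by rewrite mulr_ge0 ?nm_ge0.
  apply: bop_nm_le => [|v]; first by rewrite mulr_ge0 ?nm_ge0.
  have := @left_mul_bound R T H (fun y => pi i (g y) v) (fun y => inner (pi i (g y) v) v).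
  move=> /(_ _ _ _ t l) h; apply: le_trans (h _ _ _) _.
  - by move=> x y; rewrite gB piB.
  - by move=> c x; rewrite gZ piZ.
  - by move=> x y; rewrite gM gS pi_mul pi_star bop_mulE bop_starPr.
  rewrite -mulrA ler_wpM2l ?nm_ge0//; apply: le_trans (bop_nm _ _) _.
  by rewrite ler_wpM2r ?nm_ge0.
(* The same argument inside [K], with the functional [y |-> inner (pi i (g (tau (cmul (star a) a)
   y)) v) v]. It avoids any cross-norm property of the norm on [T]. *)
have tau_bound a k l : nm (g (tau a (cmul k l))) <= nm k * nm (g (tau a l)).
  apply: pi_nm_le => [|i]; first by rewrite mulr_ge0 ?nm_ge0.
  apply: bop_nm_le => [|v]; first by rewrite mulr_ge0 ?nm_ge0.
  have := @left_mul_bound R K H (fun y => pi i (g (tau a y)) v)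
     (fun y => inner (pi i (g (tau (cmul (star a) a) y)) v) v).
  move=> /(_ _ _ _ k l) h; apply: le_trans (h _ _ _) _.
  - by move=> x y; rewrite linearBr gB piB.
  - by move=> c x; rewrite linearZr_LR gZ piZ.
  - move=> x y; rewrite -tauM -tauS gM gS pi_mul pi_star bop_mulE.
    by rewrite bop_starPr.
  rewrite -mulrA ler_wpM2l ?nm_ge0//; apply: le_trans (bop_nm _ _) _.
  by rewrite ler_wpM2r ?nm_ge0.
have /choice[P /choice[V PV]] := compacts_shift rhoP he hd.
(* [S k l] is [1 (x) k] times the sum of the tensors in [l], written without a unit. *)
pose S (k : K) (l : seq (A * K)) := \sum_(p <- l) tau p.1 (cmul k p.2).
have SS k k' l l' : cmul (star (S k l)) (S k' l') =
    \sum_(p <- l) \sum_(q <- l') tau (cmul (star p.1) q.1)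
       (cmul (star p.2) (cmul (cmul (star k) k') q.2)).
  rewrite /S star_sum cmul_suml; apply: eq_bigr => p _.
  rewrite cmul_sumr; apply: eq_bigr => q _.
  by rewrite tauS tauM starM !cmulA.
have SG k k' l l' x y : cmul (star (cmul (g (S k l)) x)) (cmul (g (S k' l')) y) =
    cmul (star x) (cmul (g (\sum_(p <- l) \sum_(q <- l') tau (cmul (star p.1) q.1)
       (cmul (star p.2) (cmul (cmul (star k) k') q.2)))) y).
  by rewrite -SS gM gS starM !cmulA.
(* Since [v^* v = p] and [p v = 0], replacing [p] by [v p] keeps [s^* s] and makes mixed products
   vanish, whatever the lists and right factors are. *)
exists (fun m s s' => exists l x, s = cmul (g (S (P m) l)) x /\
          s' = cmul (g (S (cmul (V m) (P m)) l)) x).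
split.
  move=> m s s' t t' [l [x [-> ->]]] [l' [y [_ ->]]] {s s' t t'}.
  have [pS pp vv pv _] := PV m.
  rewrite !SG; split.
    congr (cmul _ (cmul (g _) _)); apply: eq_bigr => p _; apply: eq_bigr => q _.
    by rewrite starM pS -(cmulA (P m)) (cmulA _ (V m)) vv !pp.
  rewrite (_ : \sum_(p <- l) _ = 0).
    by rewrite g0 cmul0l cmul0r.
  rewrite big1// => p _; rewrite big1// => q _.
  by rewrite pS (cmulA (P m)) pv !cmul0l cmul0r linear0r.
move=> x e xx e0.
have x0 := nm_ge0 x; have X0 := nm_ge0 (f x).
(* The bound [1] gives [|t0| <= |f x| + 1]; the other one brings the error of [h2] below [e / 2]. *)
pose d := Num.min 1 (e / 2 / ((nm x + 1) * (nm (f x) + 2))).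
have dpos : 0 < d by rewrite lt_min ltr01 divr_gt0 ?mulr_gt0//; lra.
have : [set: T] (f x) by []; rewrite -tauD => /closure_nm /(_ d dpos)[_ [l ->]] /ltW.
set t0 := \sum_(p <- l) _ => ht0.
pose C := \sum_(p <- l) \sum_(q <- l) nm (g (tau (cmul p.1 q.1) q.2)).
have C0 : 0 <= C by apply: sumr_ge0 => p _; apply: sumr_ge0 => q _; apply: nm_ge0.
pose eta := e / 2 / ((C + 1) * (nm x + 1)).
have eta0 : 0 < eta by rewrite divr_gt0 ?mulr_gt0//; lra.
have [m hm] : exists m, forall p, p \in l -> nm (p.2 - cmul (P m) p.2) <= eta.
  suff [m hm] : exists m0, forall m, (m0 <= m)%N -> forall p, p \in l ->
      nm (p.2 - cmul (P m) p.2) <= eta by exists m; apply: hm.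
  elim: (l) => [|p l' [m IH]]; first by exists 0%N.
  have [n0 h0] := compacts_approx rhoP he hd p.2 eta0.
  exists (maxn n0 m) => k; rewrite geq_max => /andP[nk mk] q.
  rewrite inE => /orP[/eqP->|]; last exact: IH.
  by apply: h0 nk _ _; case: (PV k).
(* These are the tensors of [t0 t0] rather than [t0]: the truncation error [p.2 - P m p.2] then
   stands to the left of some [q.2], where [tau_bound] applies. *)
pose ll := [seq (cmul p.1 q.1, cmul p.2 q.2) | p <- l, q <- l].
exists m, (cmul (g (S (P m) ll)) x), (cmul (g (S (cmul (V m) (P m)) ll)) x).
split; first by exists ll, x.
have tt : cmul t0 t0 = \sum_(p <- l) \sum_(q <- l) tau (cmul p.1 q.1) (cmul p.2 q.2).
  by rewrite cmul_suml; apply: eq_bigr => p _; rewrite cmul_sumr; apply: eq_bigr => q _.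
have SE : S (P m) ll = \sum_(p <- l) \sum_(q <- l) tau (cmul p.1 q.1) (cmul (P m) (cmul p.2 q.2)).
  by rewrite /S /ll big_allpairs_dep.
have g_sum (J : Type) (s : seq J) (F : J -> T) : g (\sum_(j <- s) F j) = \sum_(j <- s) g (F j).
  by apply: f_inj; rewrite gK linear_sum; apply: eq_bigr => j _; rewrite gK.
have h1 : nm (g (S (P m) ll) - g (cmul t0 t0)) <= eta * C.
  rewrite nmB -gB tt SE -sumrB g_sum; apply: le_trans (nm_sum _ _ _) _.
  rewrite /C mulr_sumr !big_seq; apply: ler_sum => p pl.
  rewrite -sumrB g_sum; apply: le_trans (nm_sum _ _ _) _.
  rewrite mulr_sumr; apply: ler_sum => q _.
  rewrite -linearBr cmulA -cmulBl; apply: le_trans (tau_bound _ _ _) _.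
  by rewrite ler_wpM2r ?nm_ge0// hm.
have gf : g (f x) = x by rewrite fK.
have h2 : nm (cmul (g (cmul t0 t0)) x - x) <= d * (nm (f x) + 2) * nm x.
  have tb : nm (t0 - f x) <= d by rewrite nmB.
  have nt0 : nm t0 <= nm (f x) + 1.
    have := nmD (t0 - f x) (f x); rewrite subrK.
    have : d <= 1 by rewrite ge_min lexx.
    lra.
  (* By [x x = x] the error is a sum of terms with right factor [f x], and [g_bound] compares these
     with [g (f x) = x]. *)
  have e1 : cmul (g (cmul t0 t0)) x - x =
      g (cmul (cmul t0 (t0 - f x)) (f x)) + g (cmul (t0 - f x) (f x)).
    rewrite !gM !gB gf !cmulBr !cmulBl xx -!cmulA xx.
    by rewrite addrA subrK.
  rewrite e1; apply: (@nmD_le _ _ _ _ ((nm (f x) + 1) * d * nm x) (d * nm x)).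
  - apply: le_trans (g_bound _ _) _; rewrite gf ler_wpM2r//.
    by apply: le_trans (nm_cmul _ _) _; rewrite ler_pM ?nm_ge0.
  - by apply: le_trans (g_bound _ _) _; rewrite gf ler_wpM2r.
  - by rewrite -mulrDl; apply: ler_wpM2r => //; have := dpos; nra.
apply: (@nm_triangle2 _ _ (cmul (g (cmul t0 t0)) x)).
  rewrite -cmulBl; apply: le_trans (nm_cmul _ _) _.
  apply: le_trans (ler_wpM2r x0 h1) _; apply: frac_bound => //.
  by rewrite divr_ge0// ltW.
apply: le_trans h2 _.
apply: frac_bound' => //; [exact: ltW|by rewrite divr_ge0// ltW|].
by rewrite ge_min lexx orbT.
Qed.

End StableSplitting.

(** * Luzin families *)

Section OrderOnSet.
Variable T : Type.

Record set_order := SetOrder {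
  so_set :> set T;
  so_le : T -> T -> Prop;
  so_refl : forall x, so_set x -> so_le x x;
  so_anti : forall x y, so_le x y -> so_le y x -> x = y;
  so_trans : forall x y z, so_le x y -> so_le y z -> so_le x z;
  so_total : forall x y, so_set x -> so_set y -> so_le x y \/ so_le y x
}.

Variable C : set_order.

Definition so_sort := {x : T | so_set C x}.
HB.instance Definition _ := gen_eqMixin so_sort.
HB.instance Definition _ := gen_choiceMixin so_sort.

Definition so_leb (x y : so_sort) : bool := `[< so_le C (sval x) (sval y) >].
Lemma so_val_inj (x y : so_sort) : sval x = sval y -> x = y.
Proof. by case: x y => [x hx] [y hy] /= e; subst y; congr exist; apply: Prop_irrelevance. Qed.

Lemma so_leb_anti : antisymmetric so_leb.
Proof. by move=> x y /andP[/asboolP h1 /asboolP h2]; apply/so_val_inj/(so_anti h1 h2). Qed.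

Lemma so_leb_trans : transitive so_leb.
Proof. by move=> y x z /asboolP h1 /asboolP h2; apply/asboolP/(so_trans h1 h2). Qed.

Lemma so_leb_total : total so_leb.
Proof.
move=> [x hx] [y hy]; apply/orP.
by case: (so_total hx hy) => h; [left|right]; apply/asboolP.
Qed.

HB.instance Definition _ := Order.isOrder.Build (Order.Disp tt tt) so_sort
  (fun _ _ => erefl) (fun _ _ => erefl) (fun _ _ => erefl)
  so_leb_anti so_leb_trans so_leb_total
  : Order.isOrder (Order.Disp tt tt) so_sort.

Lemma so_leE (x y : so_sort) : (x <= y)%O = `[< so_le C (sval x) (sval y) >].
Proof. by []. Qed.

End OrderOnSet.

(* Zorn's lemma on orders with countable initial segments, ordered by end
   extension, replaces a transfinite recursion of length omega_1. *)
Section UncountableChain.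
Variables (T : Type) (Q : T -> T -> Prop) (L : set T -> T -> Prop).
Hypothesis extend : forall S : set T, countable S ->
  (forall s t, S s -> S t -> s <> t -> Q s t) ->
  exists t, (forall s, S s -> [/\ s <> t, Q s t & Q t s]) /\ L S t.

Local Notation rel_ := (T -> T -> Prop).

(** The field of [r] is coded as the set of [x] with [r x x], so that a single relation carries both
    the set and its order. *)
Record good_order (r : rel_) : Prop := GoodOrder {
  go_field : forall x y, r x y -> r x x /\ r y y;
  go_anti : forall x y, r x y -> r y x -> x = y;
  go_trans : forall x y z, r x y -> r y z -> r x z;
  go_total : forall x y, r x x -> r y y -> r x y \/ r y x;
  go_count : forall x, r x x -> countable [set s | r s x];
  go_pair : forall x y, r x x -> r y y -> x <> y -> Q x y;
  go_step : forall x, r x x -> L [set s | r s x /\ s <> x] x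
}.

(** By the second clause nothing new enters below an old element. Initial segments are thus
    unchanged in extensions and unions, and with them [go_count] and [go_step]. *)
Definition end_ext (r r' : rel_) :=
  (forall x y, r x y -> r' x y) /\ (forall x y, r' x y -> r y y -> r x y).

Lemma end_ext_trans r1 r2 r3 : end_ext r1 r2 -> end_ext r2 r3 -> end_ext r1 r3.
Proof.
move=> [a b] [c d]; split=> [x y /a/c//|x y h3 h1].
by apply: b => //; apply: d => //; apply: a.
Qed.

Lemma end_ext_anti r1 r2 : end_ext r1 r2 -> end_ext r2 r1 -> r1 = r2.
Proof.
move=> [a _] [b _]; apply/funext => x; apply/funext => y.
by apply/propext; split; [apply: a|apply: b].
Qed.

Lemma good_order_union (F : set rel_) : (forall r, F r -> good_order r) ->
  total_on F end_ext ->
  let u x y := exists2 r, F r & r x y in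
  good_order u /\ forall r, F r -> end_ext r u.
Proof.
move=> gF tF u.
have ext r : F r -> end_ext r u.
  move=> Fr; split=> [x y h|x y [r' Fr' h'] hy]; first by exists r.
  have [[_ h]|[h _]] := tF r r' Fr Fr'; first exact: h.
  exact: h.
have dir r r' : F r -> F r' -> exists r'', [/\ F r'', end_ext r r'' & end_ext r' r''].
  move=> Fr Fr'; have [h|h] := tF r r' Fr Fr'; first by exists r'.
  by exists r.
have two x y : u x x -> u y y -> exists r, [/\ F r, r x x & r y y].
  move=> [r Fr rx] [r' Fr' ry]; have [r'' [Fr'' [h _] [h' _]]] := dir _ _ Fr Fr'.
  by exists r''; split; [|apply: h|apply: h'].
have seg r x : F r -> r x x -> [set s | u s x] = [set s | r s x].
  move=> Fr rx; apply/seteqP; split=> s /=; last by exists r.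
  by move=> us; apply: (ext r Fr).2.
split=> //; constructor.
- by move=> x y [r Fr /(go_field (gF r Fr))[hx hy]]; split; exists r.
- move=> x y [r Fr h] [r' Fr' h'].
  have [r'' [Fr'' [k _] [k' _]]] := dir _ _ Fr Fr'.
  by apply: (go_anti (gF _ Fr'')) (k _ _ h) (k' _ _ h').
- move=> x y z [r Fr h] [r' Fr' h'].
  have [r'' [Fr'' [k _] [k' _]]] := dir _ _ Fr Fr'.
  by exists r'' => //; apply: (go_trans (gF _ Fr'')) (k _ _ h) (k' _ _ h').
- move=> x y /two h /h[r [Fr rx ry]].
  by have [h'|h'] := go_total (gF r Fr) rx ry; [left|right]; exists r.
- by move=> x [r Fr rx]; rewrite (seg r x)//; apply: (go_count (gF r Fr)).
- by move=> x y /two h /h[r [Fr rx ry]]; apply: (go_pair (gF r Fr)).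
- move=> x [r Fr rx]; have := go_step (gF r Fr) rx.
  have -> // : [set s | u s x /\ s <> x] = [set s | r s x /\ s <> x].
  have e := seg r x Fr rx; apply/seteqP; split=> s /= [h1 h2]; split=> //.
    by have : [set s | u s x] s by []; rewrite e.
  by have : [set s | r s x] s by []; rewrite -e.
Qed.

(** If the field of a maximal order were countable, [extend] would provide a further element to put
    on top of it. *)
Lemma uncountable_chain : exists C : set_order T,
  [/\ ~ countable (so_set C),
      forall x, so_set C x -> countable [set s | so_le C s x /\ so_set C s],
      forall x y, so_set C x -> so_set C y -> x <> y -> Q x y &
      forall x, so_set C x -> L [set s | [/\ so_le C s x, so_set C s & s <> x]] x].
Proof.
pose G := {r : rel_ | good_order r}.
pose RR (r r' : G) : bool := `[< end_ext (sval r) (sval r') >].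
have [||||r rmax] := @Zorn G RR.
- by move=> r; apply/asboolP.
- by move=> r s t /asboolP h /asboolP h'; apply/asboolP/(end_ext_trans h h').
- move=> [r hr] [s hs] /asboolP /= h /asboolP /= h'.
  have e := end_ext_anti h h'; subst s; congr exist; exact: Prop_irrelevance.
- move=> F tF.
  have gF : forall r, [set sval r | r in F] r -> good_order r by move=> _ [[r hr] _ <-].
  have tF' : total_on [set sval r | r in F] end_ext.
    move=> _ _ [r Fr <-] [s Fs <-].
    by have [/asboolP|/asboolP] := tF r s Fr Fs; [left|right].
  have [gu hu] := good_order_union gF tF'.
  exists (exist _ _ gu) => s Fs; apply/asboolP; apply: hu; by exists s.
case: r rmax => r gr rmax.
pose D := [set x | r x x].
have Dle x y : r x y -> D x /\ D y by move=> /(go_field gr).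
exists (@SetOrder T D r (fun x h => h) (go_anti gr) (go_trans gr) (go_total gr)).
split=> /=.
- move=> cD.
  have [|t [ht Lt]] := extend cD; first by move=> s t hs ht; apply: (go_pair gr).
  have tD : ~ D t by move=> /ht[].
  (* [r'] is [r] with [t] added as largest element. *)
  pose r' x y := r x y \/ (y = t /\ (D x \/ x = t)).
  have r't x : r' t x -> x = t by move=> [/Dle[]//|[]].
  have r'x x : r' x x <-> D x \/ x = t.
    by split=> [[|[-> _]]|[|->]]; [left|right|left|right; split; [|right]].
  have r'D x y : D y -> r' x y -> r x y by move=> Dy [//|[yt _]]; rewrite yt in Dy.
  have gr' : good_order r'.
    constructor.
    + move=> x y [/Dle[Dx Dy]|[-> [Dx|->]]]; rewrite !r'x; split; by [left|right].
    + move=> x y [h|[-> _]]; last by move=> /r't.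
      by move=> [|[xt _]]; [apply: (go_anti gr)|have [] := Dle _ _ h; rewrite xt].
    + move=> x y z [h|[-> hx]]; last first.
        by move=> /r't ->; right.
      move=> [h'|[-> _]]; first by left; apply: (go_trans gr) h h'.
      by right; split=> //; left; have [] := Dle _ _ h.
    + move=> x y; rewrite !r'x => -[Dx|->] [Dy|->].
      * by have [h|h] := go_total gr Dx Dy; [left; left|right; left].
      * by left; right; split=> //; left.
      * by right; right; split=> //; left.
      * by left; right; split=> //; right.
    + move=> x; rewrite r'x => -[Dx|->].
        have : countable [set s | r s x] := go_count gr Dx.
        by apply: sub_countable; apply: subset_card_le => s /=; apply: r'D.
      have : countable (\bigcup_(i in [set: bool]) (if i then D else [set t])).
        by apply: bigcup_countable => [|[] _]; [exact: countableP| |exact: countable1].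
      apply: sub_countable; apply: subset_card_le => s /= [/Dle[Ds _]|[_ [Ds|->]]].
      * by exists true.
      * by exists true.
      * by exists false.
    + move=> x y; rewrite !r'x => -[Dx|->] [Dy|->] xy.
      * exact: (go_pair gr).
      * by have [] := ht _ Dx.
      * by have [] := ht _ Dy.
      * by [].
    + move=> x; rewrite r'x => -[Dx|->].
        have -> : [set s | r' s x /\ s <> x] = [set s | r s x /\ s <> x].
          apply/seteqP; split=> s /= [h1 h2]; split=> //; first exact: r'D.
          by left.
        exact: (go_step gr).
      have -> // : [set s | r' s t /\ s <> t] = D.
      apply/seteqP; split=> s /=.
        by move=> [[/Dle[]//|[_ [//|->]]]] /(_ erefl).
      by move=> Ds; split; [right; split=> //; left|move=> st; rewrite st in Ds].
  have ext : end_ext r r' by split=> [x y|x y h Dy]; [left|apply: r'D].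
  have := rmax (exist _ r' gr') ltac:(by apply/asboolP) => -[e].
  by apply: tD; rewrite /D -e /=; right; split=> //; right.
- move=> x Dx; apply: sub_countable (go_count gr Dx); apply: subset_card_le.
  by move=> s /= [].
- by move=> x y; apply: (go_pair gr).
- move=> x Dx; have := go_step gr Dx.
  have -> // : [set s | r s x /\ s <> x] = [set s | [/\ r s x, D s & s <> x]].
  apply/seteqP; split=> s /=; last by case.
  by move=> [h1 h2]; split=> //; have [] := Dle _ _ h1.
Qed.

End UncountableChain.

(** * Adding a datum to a countable almost disjoint family *)

Section LuzinStep.
Variables (U : Type) (u0 : U) (act : U -> nat -> U).
Local Notation datum := ((nat -> nat) * (nat -> U))%type.
Implicit Types (s t : datum) (S : set datum).

Definition almost_disjoint s t := exists N, forall n, (N <= n)%N -> s.1 n <> t.1 n.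

(** As [e] is injective, all but finitely many [s] in [S] meet [t] beyond a given bound, and with a
    given twist [j]. *)
Definition luzin S t := exists e : datum -> nat, {in S &, injective e} /\
  forall s, S s -> forall j, (j <= e s)%N -> exists n,
    [/\ (e s <= n)%N, t.1 n = s.1 n & t.2 n = act (s.2 n) j].

(** Each [P k] holds of at most one value, so finitely many values are excluded. *)
Lemma nat_set_avoid (P : nat -> nat -> Prop) :
  (forall k v v', P k v -> P k v' -> v = v') ->
  forall n, exists v, forall k w, (k <= n)%N -> P k w -> w <> v.
Proof.
move=> uP n.
have [B hB] : exists B : nat -> nat, forall k w, P k w -> (w <= B k)%N.
  have /choice[B hB] : forall k, exists b, forall w, P k w -> (w <= b)%N.
    move=> k; have [[w Pw]|nP] := pselect (exists w, P k w); last first.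
      by exists 0%N => w Pw; case: nP; exists w.
    by exists w => w' Pw'; rewrite (uP _ _ _ Pw Pw').
  by exists B.
exists (\sum_(k < n.+1) B k).+1 => k w kn /hB wB wv.
have kn' : (k < n.+1)%N by [].
have : (B k <= \sum_(k < n.+1) B k)%N by rewrite (bigD1 (Ordinal kn')) //= leq_addr.
by rewrite wv in wB; lia.
Qed.

Lemma increasing_above (B : nat -> nat) : exists N : nat -> nat,
  injective N /\ forall m, (B m <= N m)%N.
Proof.
exists (fun m => \sum_(i < m.+1) (B i).+1)%N.
have lt m m' : (m < m')%N -> (\sum_(i < m.+1) (B i).+1 < \sum_(i < m'.+1) (B i).+1)%N.
  elim: m' => // m' IH; rewrite ltnS leq_eqVlt => /orP[/eqP->|/IH h].
    by rewrite [X in (_ < X)%N]big_ord_recr /=; lia.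
  by apply: leq_trans h _; rewrite [X in (_ <= X)%N]big_ord_recr /= leq_addr.
split=> [m m' e|m]; last by rewrite big_ord_recr /=; lia.
by case: (ltngtP m m') => // /lt; rewrite e ltnn.
Qed.

(** Number the data by [e] and reserve a column for each pair [j <= k], in which [t] agrees with
    datum [k] up to the twist [j]. In any other column [n], [t] avoids the data numbered up to [n].
    Every datum thus has finitely many prescribed meetings with [t], and no others far out. *)
Lemma luzin_step S : countable S ->
  (forall s t, S s -> S t -> s <> t -> almost_disjoint s t) ->
  exists t, (forall s, S s -> [/\ s <> t, almost_disjoint s t & almost_disjoint t s])
    /\ luzin S t.
Proof.
move=> /countable_injP[e einj] ad.
pose is_ k s := S s /\ e s = k.
have is_uniq k s s' : is_ k s -> is_ k s' -> s = s'.
  by move=> [hs ks] [hs' ks']; apply: einj; rewrite ?inE// ks ks'.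
(* Only finitely many data have a number below [k], so their separation bounds can be summed. *)
have /choice[b hb] : forall k, exists b, forall s s', is_ k s -> S s' -> (e s' < k)%N ->
    forall n, (b <= n)%N -> s.1 n <> s'.1 n.
  move=> k.
  have /choice[b hb] : forall i, exists b, forall s s', is_ k s -> is_ i s' -> i <> k ->
      forall n, (b <= n)%N -> s.1 n <> s'.1 n.
    move=> i; have [[s [s' [hs hs' ik]]]|none] :=
      pselect (exists s s', [/\ is_ k s, is_ i s' & i <> k]); last first.
      by exists 0%N => s s' hs hs' ik; case: none; exists s, s'.
    have [|b hb] := ad s s' hs.1 hs'.1.
      by move=> ss; apply: ik; rewrite -hs.2 -hs'.2 ss.
    by exists b => r r' hr hr' _; rewrite (is_uniq _ _ _ hr hs) (is_uniq _ _ _ hr' hs').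
  exists (\sum_(i < k) b i)%N => s s' hs hs' lt n hn; apply: (hb (e s')) => //.
    by move=> ek; rewrite ek ltnn in lt.
  by apply: leq_trans hn; rewrite (bigD1 (Ordinal lt)) //= leq_addr.
(* The reserved column [N k j] lies past [b k], so that agreeing there with datum [k] means avoiding
   all earlier data, and past [k], as [luzin] asks. *)
have [N0 [Ninj hN0]] := increasing_above
  (fun m => if @unpickle (nat * nat)%type m is Some (k, j) then (b k + k)%N else 0%N).
pose N (k j : nat) := N0 (pickle (k, j)).
have Nb k j : (b k + k <= N k j)%N by have := hN0 (pickle (k, j)); rewrite pickleK.
have Ninj2 k j k' j' : N k j = N k' j' -> k = k' /\ j = j'.
  by move=> /Ninj /(pcan_inj pickleK)[].
pose des n k j s := [/\ (j <= k)%N, is_ k s & n = N k j].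
have /choice[t ht] : forall n, exists p : nat * U,
    (forall k j s, des n k j s -> p = (s.1 n, act (s.2 n) j)) /\
    ((forall k j s, ~ des n k j s) -> forall s, S s -> (e s <= n)%N -> s.1 n <> p.1).
  move=> n; have [[k [j [s hd]]]|none] := pselect (exists k j s, des n k j s).
    exists (s.1 n, act (s.2 n) j); split=> [k' j' s' hd'|]; last by move=> /(_ k j s).
    case: hd hd' => _ hs nk [_ hs' nk'].
    have [kk jj] : k = k' /\ j = j' by apply: Ninj2; rewrite -nk -nk'.
    by subst k' j'; rewrite (is_uniq _ _ _ hs hs').
  have [|v hv] := @nat_set_avoid (fun k v => exists2 s, is_ k s & s.1 n = v) _ n.
    by move=> k v v' [s hs <-] [s' hs' <-]; rewrite (is_uniq _ _ _ hs hs').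
  exists (v, u0); split=> [k j s hd|_ s Ss es]; first by case: none; exists k, j, s.
  by apply: (hv (e s)) => //; exists s.
pose tt : datum := (fun n => (t n).1, fun n => (t n).2).
have adt s : S s -> almost_disjoint s tt.
  move=> Ss; pose i := e s.
  (* Beyond this bound no column is reserved for a number up to [i]. A column reserved for a later
     [k] lies past [b k], where datum [k] differs from [s]. *)
  exists (i + \sum_(k < i.+1) \sum_(j < k.+1) (N k j).+1)%N => n hn /=.
  have [[k [j [s' hd]]]|none] := pselect (exists k j s', des n k j s'); last first.
    apply: (ht n).2 => //; last by apply: leq_trans hn; apply: leq_addr.
    by move=> k j s' hd; apply: none; exists k, j, s'.
  have -> := (ht n).1 _ _ _ hd; case: hd => jk hs' nk /=.
  have [ki|ik] := leqP k i.
    have : (N k j < n)%N; last by rewrite -nk ltnn.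
    have ki' : (k < i.+1)%N by []; have jk' : (j < k.+1)%N by [].
    apply: leq_trans hn; rewrite (bigD1 (Ordinal ki')) //= (bigD1 (Ordinal jk')) //=.
    by lia.
  move=> /esym; apply: (hb k) => //.
  by rewrite nk; apply: leq_trans (Nb k j); apply: leq_addr.
exists tt; split.
  move=> s Ss; have [M hM] := adt s Ss; split; last 1 first.
  - by exists M => n /hM h /esym.
  - by move=> st; apply: (hM M) => //; rewrite -st.
  - by exists M.
exists e; split=> // s Ss j js; exists (N (e s) j).
have hd : des (N (e s) j) (e s) j s by split.
have := (ht (N (e s) j)).1 _ _ _ hd => h; rewrite /= h; split=> //.
by apply: leq_trans (Nb _ _); apply: leq_addl.
Qed.

End LuzinStep.

Section InfinitePredecessors.
Variables (T : Type) (C : set_order T).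
Hypothesis countC : forall x, so_set C x -> countable [set s | so_le C s x /\ so_set C s].

(** The initial segments below the terms of a sequence in [X] cover only countably many elements. So
    some [t] in [X] is below none of the terms, hence above all of them. *)
Lemma uncountable_infinite_pred (X : set T) : X `<=` so_set C -> ~ countable X ->
  exists2 t, X t & infinite_set [set s | [/\ X s, so_le C s t & s <> t]].
Proof.
move=> XC nX.
have iX : infinite_set X by move=> /finite_set_countable.
have [f finj] : exists f : nat -> T, injective f /\ forall n, X (f n).
  have /infiniteP/card_leP[g] := iX.
  pose i (n : nat) : [set: nat] := SigSub (mem_set (I : [set: nat] n)).
  exists (fun n => val (g (i n))); split=> [m n /val_inj|n]; last exact/set_mem/valP.
  have ginj : {in [set: [set: nat]] &, injective g} by exact: inj.
  by move=> /ginj; rewrite !in_setT => /(_ isT isT) /(congr1 val).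
have [t Xt ht] : exists2 t, X t & forall n, ~ so_le C t (f n).
  apply: contrapT => h; apply: nX.
  have : countable (\bigcup_(n in [set: nat]) [set s | so_le C s (f n) /\ so_set C s]).
    by apply: bigcup_countable => [|n _]; [exact: countableP|apply/countC/XC; case: finj].
  apply: sub_countable; apply: subset_card_le => x Xx.
  have [n hn] : exists n, so_le C x (f n).
    by apply: contrapT => hn; apply: h; exists x => // n hx; apply: hn; exists n.
  by exists n => //; split=> //; apply: XC.
exists t => //; case: finj => finj fX.
apply: (@sub_infinite_set _ (range f)).
  move=> _ [n _ <-]; split=> //.
    by case: (so_total (XC _ Xt) (XC _ (fX n))) => // /ht.
  by move=> ft; apply: (ht n); rewrite ft; apply/so_refl/XC.
apply/infiniteP; have : (range f #= [set: nat])%card by apply: inj_card_eq => x y _ _ /finj.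
by rewrite card_eq_le => /andP[].
Qed.

End InfinitePredecessors.

Lemma pigeonhole_countable (T : Type) (X : set T) (K : countType) (c : T -> K) :
  ~ countable X -> exists k, ~ countable [set x | X x /\ c x = k].
Proof.
move=> nX; apply: contrapT => h; apply: nX.
have : countable (\bigcup_(k in [set: K]) [set x | X x /\ c x = k]).
  apply: bigcup_countable => [|k _]; first exact: countableP.
  by apply: contrapT => hk; apply: h; exists k.
by apply: sub_countable; apply: subset_card_le => x Xx; exists (c x).
Qed.

(** * Unitaries of finite type *)

Section FiniteTypeUnitaries.
Variables (R : realType) (H : hilbertType R) (e : nat -> H).
Hypothesis he : forall i j, inner (e i) (e j) = (i == j)%:R.

(** [ftu_cut] is the finite type condition: conjugation maps the [n] by [n] corner to itself for all
    large [n] ([conj_by_fin]). *)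
Record ft_unitary := FTUnitary {
  ftu :> bop H;
  ftuK : forall x, star ftu (ftu x) = x;
  ftuKV : forall x, ftu (star ftu x) = x;
  ftu_cut : exists L, forall n, (L <= n)%N -> cmul ftu (cut e n) = cmul (cut e n) ftu
}.

Lemma bid_ex : {a : bop H | forall x, a x = x}.
Proof. by apply: (@bop_of_adjoint _ _ id id 1) => // x; rewrite mul1r. Qed.

Lemma ft_id_ex : exists u : ft_unitary, forall x, u x = x.
Proof.
have [a ha] := bid_ex.
have sa : star a = a by apply: bop_star_unique => x y; rewrite !ha.
by unshelve eexists (@FTUnitary a _ _ _) => // [x|x|]; rewrite ?sa ?ha//;
  exists 0%N => n _; apply: bop_ext => x; rewrite !bop_mulE !ha.
Qed.

Lemma ft_mul_ex (u v : ft_unitary) : exists w : ft_unitary, forall x, w x = u (v x).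
Proof.
have [[L hL] [L' hL']] := (ftu_cut u, ftu_cut v).
unshelve eexists (@FTUnitary (cmul (ftu u) (ftu v)) _ _ _) => // [x|x|].
- by rewrite starM !bop_mulE !ftuK.
- by rewrite starM !bop_mulE !ftuKV.
exists (maxn L L') => n; rewrite geq_max => /andP[h h'].
by rewrite -cmulA hL'// cmulA hL// cmulA.
Qed.

Lemma ftu_star_cut (u : ft_unitary) : exists L, forall n, (L <= n)%N ->
  cmul (star (ftu u)) (cut e n) = cmul (cut e n) (star (ftu u)).
Proof.
have [L hL] := ftu_cut u; exists L => n /hL h.
by have := congr1 (@star R (bop H)) h; rewrite !starM !cut_star => ->.
Qed.

Lemma ftu_nm (u : ft_unitary) x : nm (u x) = nm x.
Proof.
apply/eqP; rewrite -(@eqrXn2 _ 2) ?nm_ge0//; apply/eqP/complexI.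
by rewrite -!inner_nm bop_starP ftuK.
Qed.

Definition conj_by (u : ft_unitary) (a : bop H) := cmul (ftu u) (cmul a (star (ftu u))).
Definition conj_by' (u : ft_unitary) (a : bop H) := cmul (star (ftu u)) (cmul a (ftu u)).

Lemma conj_byK u a : conj_by' u (conj_by u a) = a.
Proof.
by apply: bop_ext => x; rewrite /conj_by' /conj_by !bop_mulE !ftuK.
Qed.
Lemma conj_byK' u a : conj_by u (conj_by' u a) = a.
Proof.
by apply: bop_ext => x; rewrite /conj_by' /conj_by !bop_mulE !ftuKV.
Qed.
Lemma conj_by'_linear u (c : R[i]) a b : conj_by' u (c *: a + b) = c *: conj_by' u a + conj_by' u b.
Proof. by rewrite /conj_by' cmul_linearl cmul_linearr. Qed.
Lemma conj_by_linear u (c : R[i]) a b : conj_by u (c *: a + b) = c *: conj_by u a + conj_by u b.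
Proof. by rewrite /conj_by cmul_linearl cmul_linearr. Qed.
Lemma conj_by'_mul u a b : conj_by' u (cmul a b) = cmul (conj_by' u a) (conj_by' u b).
Proof. by apply: bop_ext => x; rewrite /conj_by' !bop_mulE ftuKV. Qed.
Lemma conj_by_mul u a b : conj_by u (cmul a b) = cmul (conj_by u a) (conj_by u b).
Proof. by apply: bop_ext => x; rewrite /conj_by !bop_mulE ftuK. Qed.
Lemma conj_by'_star u a : conj_by' u (star a) = star (conj_by' u a).
Proof. by rewrite /conj_by' !starM starK !cmulA. Qed.
Lemma conj_by_star u a : conj_by u (star a) = star (conj_by u a).
Proof. by rewrite /conj_by !starM starK !cmulA. Qed.

Lemma conj_by_nm u a : nm (conj_by u a) <= nm a.
Proof.
apply: bop_nm_le => [|x]; first exact: nm_ge0.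
rewrite /conj_by !bop_mulE ftu_nm; apply: le_trans (bop_nm _ _) _.
by rewrite -{2}(ftuKV u x) ftu_nm.
Qed.
Lemma conj_by'_nm u a : nm (conj_by' u a) <= nm a.
Proof.
apply: bop_nm_le => [|x]; first exact: nm_ge0.
rewrite /conj_by' !bop_mulE -(ftu_nm u) ftuKV; apply: le_trans (bop_nm _ _) _.
by rewrite ftu_nm.
Qed.

Lemma conj_by_fin u : exists L, forall n, (L <= n)%N -> forall a, fin_mx e n a ->
  fin_mx e n (conj_by u a) /\ fin_mx e n (conj_by' u a).
Proof.
have [[L hL] [L' hL']] := (ftu_cut u, ftu_star_cut u).
exists (maxn L L') => n; rewrite geq_max => /andP[h h'] a /(fin_mxP he)[a1 a2].
split; apply/(fin_mxP he); rewrite /conj_by /conj_by'.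
  by rewrite cmulA -hL// -cmulA (cmulA (cut e n)) a1 -!cmulA hL'// (cmulA a) a2.
by rewrite cmulA -hL'// -cmulA (cmulA (cut e n)) a1 -!cmulA hL// (cmulA a) a2.
Qed.

Lemma basis_nm i : nm (e i) = 1.
Proof.
apply/eqP; rewrite -(@eqrXn2 _ 2) ?nm_ge0// expr1n; apply/eqP/complexI.
by rewrite -inner_nm he eqxx.
Qed.

(* Householder reflection *)
Lemma reflection_ex L (z : H) : cut e L z = z -> z != 0 ->
  exists u : ft_unitary, forall x,
    u x = x - (inner x z * (2 / nm z ^+ 2)%:C) *: z.
Proof.
move=> cz z0; have [a ha] := bid_ex.
have zp : nm z ^+ 2 != 0.
  by rewrite sqrf_eq0; apply: contraNneq z0 => /nm_eq0 ->.
pose b : bop H := a - (2 / nm z ^+ 2)%:C *: rank_one z z.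
have bE x : b x = x - (inner x z * (2 / nm z ^+ 2)%:C) *: z.
  by rewrite bop_addE bop_oppE bop_scaleE rank_oneE ha scalerA mulrC.
have sa : star a = a by apply: bop_star_unique => x y; rewrite !ha.
have sb : star b = b by rewrite starB starZ rank_one_star conjRC sa.
have bb x : b (b x) = x.
  rewrite !bE innerBl innerZl inner_nm -mulrA -rmorphM /= divfK//.
  rewrite -addrA -opprD -scalerDl -mulrDl.
  have -> : inner x z + (inner x z - inner x z * 2%:C) = 0.
    have -> : (2 : R)%:C = 2%:R :> R[i] by rewrite rmorph_nat.
    by ring.
  by rewrite mul0r scale0r subr0.
unshelve eexists (@FTUnitary b _ _ _) => // [x|x|]; rewrite ?sb ?bb//.
exists L => n Ln; apply: bop_ext => x.
have cnz : cut e n z = z by rewrite -cz (cut_cut' he).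
by rewrite !bop_mulE !bE bopB bopZ cnz bop_starP cut_star cnz.
Qed.

(** A reflection along [e 0 - c *: w] exchanges the two vectors if both are unit vectors with a real
    inner product; the phase of [c] is chosen for this. *)
Lemma transitive_unitary L (w : H) : cut e L w = w -> w != 0 ->
  exists (u : ft_unitary) (c : R[i]), u (e 0%N) = c *: w /\ nm c = (nm w)^-1.
Proof.
move=> cw w0.
have nw : 0 < nm w by rewrite lt_neqAle nm_ge0 andbT eq_sym; apply: contraNneq w0 => /nm_eq0 ->.
have [c [nc [r rE]]] : exists c : R[i], nm c = (nm w)^-1 /\
    exists r : R, inner (e 0%N) (c *: w) = r%:C.
  pose al := inner (e 0%N) w.
  have [al0|al0] := eqVneq al 0.
    exists ((nm w)^-1%:C); rewrite nmR ger0_norm ?invr_ge0 ?nm_ge0//; split=> //.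
    by exists 0; rewrite innerZr -/al al0 mulr0.
  have na : nm al != 0 by apply: contraNneq al0 => /nm_eq0 ->.
  (* With the phase of [al], the inner product of [e 0] and [c *: w] is [nm al / nm w]. *)
  exists (al / (nm al * nm w)%:C); split.
    rewrite nmM -fmorphV /= nmR ger0_norm ?invr_ge0 ?mulr_ge0 ?nm_ge0//.
    by rewrite invfM mulrA mulfV// mul1r.
  exists (nm al / nm w); rewrite innerZr -/al rmorphM /= -fmorphV /= conjRC.
  rewrite mulrAC [_ * al]mulrC -nm_sqr -rmorphM; congr (_%:C).
  by rewrite expr2 invfM mulrA mulfK.
pose z := e 0%N - c *: w.
have ncw : nm (c *: w) = 1 by rewrite nmZ nc mulVf// gt_eqF.
have e0z : inner (e 0%N) z = (1 - r)%:C by rewrite innerBr he eqxx rE rmorphB rmorph1.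
have nz : nm z ^+ 2 = 2 * (1 - r).
  apply: complexI; rewrite -inner_nm {1}/z innerBl e0z (inner_conj z) /z innerBl.
  rewrite rE inner_nm ncw expr1n -rmorphB /= conjRC -rmorphB /=; congr (_%:C); ring.
(* The reflection degenerates when [e 0] already equals [c *: w]; the identity then does. *)
have [z0|z0] := eqVneq z 0.
  have [u hu] := ft_id_ex; exists u, c; split=> //; rewrite hu.
  by apply/eqP; rewrite -subr_eq0 -/z z0.
have [|u hu] := @reflection_ex (maxn L 1) z _ z0.
  rewrite /z bopB bopZ (cut_basis he) ?leq_maxr// -{1}cw (cut_cut' he) ?leq_maxl//.
  by rewrite cw.
exists u, c; split=> //; rewrite hu e0z nz -rmorphM /=.
have r1 : 1 - r != 0.
  apply: contraNneq z0 => h; have := nz; rewrite h mulr0 => /eqP.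
  by rewrite sqrf_eq0 => /eqP/nm_eq0->.
rewrite (_ : (1 - r) * (2 / (2 * (1 - r))) = 1); last by field.
by rewrite rmorph1 scale1r /z opprB addrC subrK.
Qed.

Definition rational_vector (s : seq (rat * rat)) : H :=
  \sum_(i < size s) (ratr (nth (0, 0) s i).1 +i* ratr (nth (0, 0) s i).2 : R[i]) *: e i.

Lemma rational_dense (d : R) (a : R) : 0 < d -> exists q : rat, `|a - ratr q| <= d.
Proof.
move=> d0; have [q] := @rat_in_itvoo R (a - d) (a + d) ltac:(lra).
rewrite in_itv /= => /andP[h1 h2]; exists q; rewrite ler_norml; apply/andP; split; lra.
Qed.

Lemma rational_complex_dense (d : R) (c : R[i]) : 0 < d ->
  exists q : rat * rat, nm (c - (ratr q.1 +i* ratr q.2)) <= d.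
Proof.
move=> d0; have [p hp] := @rational_dense (d / 2) (complex.Re c) ltac:(lra).
have [q hq] := @rational_dense (d / 2) (complex.Im c) ltac:(lra).
by exists (p, q); apply: le_trans (nm_Re_Im _) _; rewrite !raddfB /=; lra.
Qed.

Lemma rational_vector_dense n (w : H) d : cut e n w = w -> 0 < d ->
  exists s, nm (w - rational_vector s) <= d.
Proof.
move=> cw d0; have d1 : 0 < d / n.+1%:R by rewrite divr_gt0.
have /choice[q hq] := fun i => rational_complex_dense (inner w (e i)) d1.
exists (mkseq q n).
have -> : rational_vector (mkseq q n) =
    \sum_(i < n) (ratr (q i).1 +i* ratr (q i).2 : R[i]) *: e i.
  by rewrite /rational_vector size_mkseq; apply: eq_bigr => i _; rewrite nth_mkseq.
rewrite -{1}cw cutE -sumrB; apply: le_trans (nm_sum _ _ _) _.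
apply: (@le_trans _ _ (\sum_(i < n) d / n.+1%:R)).
  by apply: ler_sum => i _; rewrite -scalerBl nmZ basis_nm mulr1.
rewrite sumr_const card_ord -[leLHS]mulr_natr mulrAC ler_pdivrMr//.
by rewrite ler_pM2l// ler_nat.
Qed.

Lemma norming_unitaries : exists g : nat -> ft_unitary, forall n (w : H),
  cut e n w = w -> 1 / 2 <= nm w -> exists j, 1 / 4 <= nm (inner w (g j (e 0%N))).
Proof.
have [u0 _] := ft_id_ex.
have rat_cut s : cut e (size s) (rational_vector s) = rational_vector s.
  by rewrite bop_sum; apply: eq_bigr => i _; rewrite bopZ (cut_basis he).
have /choice[g hg] : forall j, exists u : ft_unitary, forall s, unpickle j = Some s ->
    rational_vector s != 0 -> exists c : R[i], u (e 0%N) = c *: rational_vector s /\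
      nm c = (nm (rational_vector s))^-1.
  move=> j; case: (unpickle j) => [s|]; last by exists u0.
  have [s0|s0] := eqVneq (rational_vector s) 0.
    by exists u0 => s' [<-]; rewrite s0 eqxx.
  have [u [c hu]] := transitive_unitary (rat_cut s) s0.
  by exists u => s' [<-] _; exists c.
exists g => n w cw nw.
(* A rational [v] within [1/8] of [w] has norm at least [3/8], and [w] pairs with the normalized [v]
   to at least [3/8 - 1/8 = 1/4]. *)
have [s hs] := @rational_vector_dense n w (1 / 8) cw ltac:(lra).
set v := rational_vector s in hs.
have nv : 3 / 8 <= nm v by have := nmD (w - v) v; rewrite subrK; lra.
have v0 : v != 0 by apply: contraTneq nv => ->; rewrite nm0; lra.
exists (pickle s); have [c [-> nc]] := hg (pickle s) s (pickleK s) v0.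
rewrite -/v in nc *; rewrite innerZr nmM nm_conj nc [leRHS]mulrC ler_pdivlMr; last by lra.
have h1 : nm v ^+ 2 = nm (inner v v) by rewrite inner_nm nmR ger0_norm ?sqr_ge0.
have h2 := cauchy_schwarz (w - v) v.
have h3 := nmD (inner v v - inner w v) (inner w v).
rewrite subrK -innerBl -h1 in h3.
have h4 := cauchy_schwarz (v - w) v; rewrite (nmB v w) in h4.
by have := nm_ge0 v; nra.
Qed.

End FiniteTypeUnitaries.

(** * Tensor products of operators *)

Lemma ler_sum_subset (R : realType) (T : eqType) (s s' : seq T) (F : T -> R) :
  (forall x, 0 <= F x) -> uniq s -> {subset s <= s'} ->
  \sum_(x <- s) F x <= \sum_(x <- s') F x.
Proof.
move=> F0; elim: s s' => [|x s IH] s' /=.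
  by move=> _ _; rewrite big_nil; apply: sumr_ge0.
move=> /andP[xs us] ss'; rewrite big_cons (big_rem x (ss' x (mem_head x s))) /=.
rewrite lerD2l; apply: IH => // y ys; apply: rem_mem.
  by apply: contraNneq xs => <-.
by apply: ss'; rewrite inE ys orbT.
Qed.

Lemma seq_bounded (T : eqType) (s : seq T) (f : T -> nat) :
  exists N, forall x, x \in s -> (f x < N)%N.
Proof.
elim: s => [|x s [N IH]]; first by exists 0%N.
exists (maxn N (f x).+1) => y; rewrite inE => /orP[/eqP->|/IH h]; first by rewrite leq_maxr.
by apply: leq_trans h _; rewrite leq_maxl.
Qed.

Definition l2h (R : realType) : hilbertType R := Hilbert.clone R (l2 R) _.

Section L2Basis.
Variable R : realType.
Local Notation l2 := (l2h R).

Lemma l2h_nm_le (x : l2) M : 0 <= M -> (forall n, \sum_(i < n) nm (x i) ^+ 2 <= M ^+ 2) -> nm x <= M.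
Proof. exact: l2_nm_le. Qed.
Lemma l2h_partial (x : l2) n : \sum_(i < n) nm (x i) ^+ 2 <= nm x ^+ 2.
Proof. exact: l2_partial. Qed.
Lemma l2h_ext (x y : l2) : (forall i, x i = y i) -> x = y.
Proof. exact: l2_ext. Qed.

Lemma l2_sum_uniq (x : l2) (s : seq nat) : uniq s -> \sum_(i <- s) nm (x i) ^+ 2 <= nm x ^+ 2.
Proof.
move=> us; have [N hN] := seq_bounded s id.
apply: le_trans (l2h_partial x N); rewrite -(big_mkord xpredT (fun i => nm (x i) ^+ 2)).
apply: ler_sum_subset => // [i|i /hN]; first exact: sqr_ge0.
by rewrite mem_index_iota.
Qed.

Lemma l2_delta_subproof i : (fun k : nat => (k == i)%:R : R[i]) \in @l2_pred R.
Proof.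
apply/asboolP; exists 1 => n.
apply: (@le_trans _ _ (\sum_(k < n | k == i :> nat) 1)).
  rewrite [leRHS]big_mkcond /=; apply: ler_sum => k _.
  by case: eqP => _; rewrite ?nm1 ?nm0 ?expr1n ?expr0n.
have [ni|ni] := ltnP i n; last first.
  by rewrite big1 ?ler01// => k /eqP ki; have := ltn_ord k; rewrite ki ltnNge ni.
by rewrite (big_pred1 (Ordinal ni)).
Qed.

Definition l2e i : l2 := L2 (l2_delta_subproof i).

Lemma l2eE i k : l2e i k = (k == i)%:R. Proof. by []. Qed.

Lemma l2_scaleE (c : R[i]) (x : l2) k : (c *: x) k = c * x k. Proof. by []. Qed.
Lemma l2_subE (x y : l2) k : (x - y) k = x k - y k. Proof. by []. Qed.

Lemma l2_inner_e (x : l2) i : inner x (l2e i) = x i.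
Proof.
apply: (seq_lim_unique (l2ip_lim x (l2e i))) => d d0; exists i.+1 => n ni.
rewrite /l2ip_sum (bigD1 (Ordinal ni)) //= eqxx conjC1 mulr1.
rewrite big1 ?addr0 ?subrr ?nm0 ?(ltW d0)// => k ki.
have -> : (k == i :> nat) = false by exact: negbTE.
by rewrite conjC0 mulr0.
Qed.

Lemma l2e_orthonormal i j : inner (l2e i) (l2e j) = (i == j)%:R.
Proof. by rewrite l2_inner_e l2eE eq_sym. Qed.

Lemma l2_sumE (I : Type) (s : seq I) P (F : I -> l2) k :
  (\sum_(i <- s | P i) F i) k = \sum_(i <- s | P i) F i k.
Proof. by apply: (big_morph (fun x : l2 => x k)). Qed.

Lemma l2e_dense : closure [set x | exists (n : nat) (c : nat -> R[i]),
  x = \sum_(i < n) c i *: l2e i] = setT.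
Proof.
apply/seteqP; split=> // x _; apply/closure_nm => d d0.
have [n hn] : exists n0, forall n, \sum_(n0 <= i < n) nm (x i) ^+ 2 <= (d / 2) ^+ 2.
  apply: (@partial_sum_tail _ _ (nm x ^+ 2)) => [i|m|]; first exact: sqr_ge0.
    exact: l2h_partial.
  by rewrite exprn_gt0//; lra.
exists (\sum_(i < n) x i *: l2e i); first by exists n, x.
set y := \sum_(i < n) _.
have yE k : y k = if (k < n)%N then x k else 0.
  have -> : y k = \sum_(i < n) x i * (k == i :> nat)%:R by rewrite l2_sumE.
  case: ifP => kn.
    rewrite (bigD1 (Ordinal kn)) //= eqxx mulr1 big1 ?addr0// => j jk.
    have -> : (k == j :> nat) = false by rewrite eq_sym; exact: negbTE.
    by rewrite mulr0.
  rewrite big1// => j _.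
  have -> : (k == j :> nat) = false by apply/negbTE; have := ltn_ord j; lia.
  by rewrite mulr0.
suff : nm (x - y) <= d / 2 by lra.
apply: l2h_nm_le => [|m]; first lra.
apply: le_trans (hn m).
have sub k : (x - y) k = if (k < n)%N then 0 else x k.
  by rewrite l2_subE yE; case: ifP => _; rewrite ?subrr ?subr0.
have [mn|nm'] := leqP m n.
  rewrite big_geq// big1// => k _; rewrite sub.
  by rewrite (leq_trans (ltn_ord k) mn) nm0 expr0n.
pose z k := if (k < n)%N then 0 else x k.
have -> : \sum_(i < m) nm ((x - y) i) ^+ 2 = \sum_(i < m) nm (z i) ^+ 2.
  by apply: eq_bigr => i _; rewrite sub.
rewrite -(big_mkord xpredT (fun k => nm (z k) ^+ 2)) (big_cat_nat _ (n:=n)) ?(ltnW nm')//=.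
rewrite big_nat big1 ?add0r => [|k /andP[_ kn]]; last by rewrite /z kn nm0 expr0n.
rewrite !big_nat; apply: ler_sum => k /andP[nk _].
by rewrite /z ltnNge nk.
Qed.

Lemma l2_bounded_operator (F : l2 -> nat -> R[i]) M : 0 <= M ->
  (forall (c : R[i]) x y m, F (c *: x + y) m = c * F x m + F y m) ->
  (forall x n, \sum_(m < n) nm (F x m) ^+ 2 <= (M * nm x) ^+ 2) ->
  exists2 a : bop l2, forall x m, a x m = F x m & nm a <= M.
Proof.
move=> M0 lin bd.
have FP x : F x \in @l2_pred R by apply/asboolP; exists ((M * nm x) ^+ 2); apply: bd.
pose f x : l2 := L2 (FP x).
have f_lin : linear f by move=> c x y; apply: l2h_ext => m; apply: lin.
pose lf := GRing.isLinear.Build R[i] l2 l2 *:%R f f_lin.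
pose ff : {linear l2 -> l2} := HB.pack f lf.
have fb x : nm (f x) <= M * nm x by apply: l2h_nm_le => [|n]; [rewrite mulr_ge0 ?nm_ge0|exact: bd].
have [a ha] := bounded_operator l2e_orthonormal l2e_dense (f := ff) M0 fb.
exists a => [x m|]; first by rewrite ha.
by apply: bop_nm_le => // x; rewrite ha; exact: fb.
Qed.

End L2Basis.

(** * Operators on l_2 (x) l_2 = l_2 that act on one factor *)

Section Amplification.
Variable R : realType.
Local Notation l2 := (l2h R).
Local Notation e := (@l2e R).
Variables (p : nat * nat -> nat) (q : nat -> nat * nat).
Hypotheses (pK : cancel p q) (qK : cancel q p).

(** This is [x |-> x (x) e_j], when the basis vector of index [m] is read as the tensor of those of
    indices [(q m).1] and [(q m).2]. *)
Lemma leg_ex j : exists2 v : bop l2,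
  forall x m, v x m = if (q m).2 == j then x (q m).1 else 0 & nm v <= 1.
Proof.
apply: l2_bounded_operator => [//|c x y m|x n].
  by case: ifP => _; rewrite ?mulr0 ?addr0.
rewrite mul1r.
pose s := [seq (q m).1 | m <- iota 0 n & (q m).2 == j].
have us : uniq s.
  rewrite map_inj_in_uniq ?filter_uniq ?iota_uniq// => m m'.
  rewrite !mem_filter => /andP[/eqP h _] /andP[/eqP h' _] h1.
  by rewrite -(qK m) -(qK m') [q m]surjective_pairing [q m']surjective_pairing h h' h1.
apply: le_trans (l2_sum_uniq x us); rewrite big_map big_filter.
rewrite -(big_mkord xpredT (fun m => nm (if (q m).2 == j then x (q m).1 else 0) ^+ 2)).
rewrite [X in X <= _]big_mkcond [X in _ <= X]big_mkcond /index_iota subn0 /=.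
by apply: ler_sum => m _; case: ifP; rewrite ?nm0 ?expr0n.
Qed.

Definition leg j : bop l2 := projT1 (cid2 (leg_ex j)).

Lemma legE j x m : leg j x m = if (q m).2 == j then x (q m).1 else 0.
Proof. by rewrite /leg; case: cid2. Qed.

Lemma leg_nm j : nm (leg j) <= 1.
Proof. by rewrite /leg; case: cid2. Qed.

Lemma leg_e i j : leg j (e i) = e (p (i, j)).
Proof.
apply: l2h_ext => m; rewrite legE !l2eE; case: eqP => [h|h]; last first.
  by case: eqP => // mE; case: h; rewrite mE pK.
congr (_%:R); congr nat_of_bool; apply/eqP/eqP => [<-|->]; last by rewrite pK.
by rewrite -h -surjective_pairing qK.
Qed.

Lemma leg_starE j x i : star (leg j) x i = x (p (i, j)).
Proof. by rewrite -l2_inner_e -bop_starPr leg_e l2_inner_e. Qed.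

Lemma leg_star_leg j l x : star (leg j) (leg l x) = if j == l then x else 0.
Proof.
apply: l2h_ext => i; by rewrite leg_starE legE pK /=; case: eqP.
Qed.

Lemma leg_ext x y : (forall j, star (leg j) x = star (leg j) y) -> x = y.
Proof.
move=> h; apply: l2h_ext => m; have := congr1 (fun z : l2 => z (q m).1) (h (q m).2).
by rewrite !leg_starE -surjective_pairing qK.
Qed.

(** Bessel's inequality for the orthogonal ranges of the legs: [y] is the projection of [x] on the
    first [n] of them. *)
Lemma leg_bessel x n : \sum_(j < n) nm (star (leg j) x) ^+ 2 <= nm x ^+ 2.
Proof.
pose y := \sum_(j < n) leg j (star (leg j) x).
have xy : inner y x = (\sum_(j < n) nm (star (leg j) x) ^+ 2)%:C.
  rewrite inner_suml rmorph_sum /=; apply: eq_bigr => j _.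
  by rewrite bop_starP inner_nm.
have yy : inner y y = (\sum_(j < n) nm (star (leg j) x) ^+ 2)%:C.
  rewrite {1}/y inner_suml rmorph_sum /=; apply: eq_bigr => j _.
  rewrite bop_starP bop_sum (bigD1 j)//= leg_star_leg eqxx big1 ?addr0 ?inner_nm//.
  move=> l lj; rewrite leg_star_leg; have -> // : (j == l :> nat) = false.
  by rewrite eq_sym; exact: negbTE.
have : nm (y + (x - y)) ^+ 2 = nm y ^+ 2 + nm (x - y) ^+ 2.
  by apply: nm_sqr_orth; rewrite innerBr xy yy subrr.
rewrite addrC subrK => ->.
have -> : nm y ^+ 2 = \sum_(j < n) nm (star (leg j) x) ^+ 2.
  by apply: complexI; rewrite -inner_nm yy.
by rewrite lerDl sqr_ge0.
Qed.

(** [a (x) 1] acts as [a] on each leg. For the norm, finitely many coordinates are enclosed in a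
    rectangle and summed leg by leg. *)
Lemma amp_ex (a : bop l2) : exists2 b : bop l2,
  forall x m, b x m = a (star (leg (q m).2) x) (q m).1 & nm b <= nm a.
Proof.
apply: l2_bounded_operator => [|c x y m|x n]; first exact: nm_ge0.
  by rewrite bopD bopZ bopD bopZ.
pose F (ij : nat * nat) := nm (a (star (leg ij.2) x) ij.1) ^+ 2.
have [I hI] := seq_bounded (iota 0 n) (fun m => (q m).1).
have [J hJ] := seq_bounded (iota 0 n) (fun m => (q m).2).
apply: (@le_trans _ _ (\sum_(ij <- [seq (i, j) | j <- iota 0 J, i <- iota 0 I]) F ij)).
  rewrite -(big_mkord xpredT (fun m => F (q m))) /index_iota subn0 -(big_map q xpredT F).
  apply: ler_sum_subset => [ij||ij]; first exact: sqr_ge0.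
    by rewrite map_inj_uniq ?iota_uniq//; apply: can_inj qK.
  move=> /mapP[m mn ->]; apply/allpairsP; exists ((q m).2, (q m).1).
  by rewrite !mem_iota !add0n /= hI ?hJ// -surjective_pairing.
rewrite big_allpairs_dep /=; apply: (@le_trans _ _ (\sum_(j <- iota 0 J) nm a ^+ 2 * nm (star (leg j) x) ^+ 2)).
  apply: ler_sum => j _; apply: le_trans (l2_sum_uniq (a (star (leg j) x)) (iota_uniq 0 I)) _.
  by rewrite -exprMn ler_pXn2r ?nnegrE ?mulr_ge0 ?nm_ge0 ?bop_nm.
rewrite -mulr_sumr exprMn ler_wpM2l ?sqr_ge0//; apply: le_trans (leg_bessel x J).
by rewrite -(big_mkord xpredT (fun j => nm (star (leg j) x) ^+ 2)) /index_iota subn0.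
Qed.

Definition amp (a : bop l2) : bop l2 := projT1 (cid2 (amp_ex a)).

Lemma amp_nm a : nm (amp a) <= nm a.
Proof. by rewrite /amp; case: cid2. Qed.

Lemma amp_leg a j x : star (leg j) (amp a x) = a (star (leg j) x).
Proof.
by apply: l2h_ext => i; rewrite leg_starE /amp; case: cid2 => b hb _ /=; rewrite hb pK.
Qed.

Lemma leg_amp a j x : amp a (leg j x) = leg j (a x).
Proof.
apply: leg_ext => l; rewrite amp_leg !leg_star_leg; case: eqP => // _; exact: bop0.
Qed.

Lemma amp_linear (c : R[i]) a b : amp (c *: a + b) = c *: amp a + amp b.
Proof.
apply: bop_ext => x; apply: leg_ext => j.
rewrite amp_leg; transitivity (star (leg j) (c *: amp a x + amp b x)); last by [].
have lin (v : bop l2) (y z : l2) : v (c *: y + z) = c *: v y + v z by rewrite bopD bopZ.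
rewrite lin.
by exact: (congr2 (fun u v : l2 => c *: u + v) (esym (amp_leg a j x)) (esym (amp_leg b j x))).
Qed.

Lemma amp_mul a b : amp (cmul a b) = cmul (amp a) (amp b).
Proof.
by apply: bop_ext => x; apply: leg_ext => j; rewrite bop_mulE !amp_leg bop_mulE.
Qed.

Lemma amp_entry a m n : inner (amp a (e m)) (e n) =
  if (q m).2 == (q n).2 then inner (a (e (q m).1)) (e (q n).1) else 0.
Proof.
have h k : e k = leg (q k).2 (e (q k).1) by rewrite leg_e -surjective_pairing qK.
rewrite {1}(h m) {1}(h n) leg_amp bop_starP leg_star_leg.
by case: eqP => // _; rewrite inner0r.
Qed.

Lemma amp_star a : amp (star a) = star (amp a).
Proof.
apply: (basis_entries_ext (@l2e_orthonormal R) (@l2e_dense R)) => m n; rewrite -[RHS]bop_starPr [RHS]inner_conj !amp_entry eq_sym.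
case: eqP => _; last by rewrite conjC0.
by rewrite -bop_starPr inner_conj.
Qed.

End Amplification.

Lemma nat_pairing : exists p : nat * nat -> nat, exists q : nat -> nat * nat,
  cancel p q /\ cancel q p.
Proof.
have /card_set_bijP[f] := card_nat2.
by rewrite setTT_bijective => -[g fK gK]; exists f, g.
Qed.

Section TensorOperators.
Variables (R : realType) (H : hilbertType R) (e : nat -> H).
Hypothesis he : forall i j, inner (e i) (e j) = (i == j)%:R.
Hypothesis hd : closure [set x | exists (n : nat) (c : nat -> R[i]),
  x = \sum_(i < n) c i *: e i] = setT.
Variables (p : nat * nat -> nat) (q : nat -> nat * nat).
Hypotheses (qK : cancel q p).
(* [V j] and [V' j] identify [H] with [H (x) e_j] and [e_j (x) H]; [amp1 a] and
   [amp2 k] are [a (x) 1] and [1 (x) k]. *)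
Variables (V V' : nat -> bop H) (amp1 amp2 : bop H -> bop H).
Hypothesis leg_basis : forall i j, V j (e i) = e (p (i, j)).
Hypothesis leg_basis' : forall i j, V' i (e j) = e (p (i, j)).
Hypothesis leg_orth : forall j l x, star (V j) (V l x) = if j == l then x else 0.
Hypothesis leg_cross : forall i j y, star (V j) (V' i y) = inner y (e j) *: e i.
Hypothesis leg_norm : forall j, nm (V j) <= 1.
Hypothesis amp1_star_leg : forall a j x, star (V j) (amp1 a x) = a (star (V j) x).
Hypothesis amp1_leg : forall a j x, amp1 a (V j x) = V j (a x).
Hypothesis amp2_leg' : forall k i x, amp2 k (V' i x) = V' i (k x).
Hypothesis amp1_linear : forall (c : R[i]) a b, amp1 (c *: a + b) = c *: amp1 a + amp1 b.
Hypothesis amp2_linear : forall (c : R[i]) a b, amp2 (c *: a + b) = c *: amp2 a + amp2 b.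
Hypothesis amp1_mul : forall a b, amp1 (cmul a b) = cmul (amp1 a) (amp1 b).
Hypothesis amp2_mul : forall a b, amp2 (cmul a b) = cmul (amp2 a) (amp2 b).
Hypothesis amp1_star : forall a, amp1 (star a) = star (amp1 a).
Hypothesis amp2_star : forall a, amp2 (star a) = star (amp2 a).
Hypothesis amp1_nm : forall a, nm (amp1 a) <= nm a.
Hypothesis amp2_nm : forall a, nm (amp2 a) <= nm a.

Lemma basis_leg m : e m = V (q m).2 (e (q m).1).
Proof. by rewrite leg_basis -surjective_pairing qK. Qed.

Lemma amp2_leg k j l i : star (V j) (amp2 k (V l (e i))) = inner (k (e l)) (e j) *: e i.
Proof. by rewrite leg_basis -leg_basis' amp2_leg' leg_cross. Qed.

Lemma entry12 a k l i j y : inner (cmul (amp1 a) (amp2 k) (V l (e i))) (V j y) =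
  inner (k (e l)) (e j) * inner (a (e i)) y.
Proof. by rewrite bop_mulE (bop_starPr (V j)) amp1_star_leg amp2_leg bopZ innerZl. Qed.

Lemma entry21 a k l i j y : inner (cmul (amp2 k) (amp1 a) (V l (e i))) (V j y) =
  inner (k (e l)) (e j) * inner (a (e i)) y.
Proof.
rewrite bop_mulE (bop_starPr (V j)) amp1_leg.
suff -> : star (V j) (amp2 k (V l (a (e i)))) = inner (k (e l)) (e j) *: a (e i).
  by rewrite innerZl.
have [w hw] := @bid_ex R H.
(* [amp2_leg] concerns basis vectors; as an identity between bounded operators it extends to the
   vector [a (e i)]. *)
pose b : bop H := inner (k (e l)) (e j) *: w.
have bE x : b x = inner (k (e l)) (e j) *: x by rewrite -{2}(hw x).
have eb : cmul (star (V j)) (cmul (amp2 k) (V l)) = b.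
  apply: (basis_ext he hd) => n.
  by rewrite bE; exact: amp2_leg.
by rewrite -bE -eb.
Qed.

Definition tens a k := cmul (amp1 a) (amp2 k).

Lemma tens_entry a k m n : inner (tens a k (e m)) (e n) =
  inner (k (e (q m).2)) (e (q n).2) * inner (a (e (q m).1)) (e (q n).1).
Proof.
have := entry12 a k (q m).2 (q m).1 (q n).2 (e (q n).1).
by rewrite -(basis_leg m) -(basis_leg n).
Qed.

Lemma amp_commute a k : cmul (amp2 k) (amp1 a) = tens a k.
Proof.
apply: (basis_entries_ext he hd) => m n; rewrite tens_entry.
have := entry21 a k (q m).2 (q m).1 (q n).2 (e (q n).1).
by rewrite -(basis_leg m) -(basis_leg n).
Qed.

Lemma tens_linearl k (c : R[i]) a b : tens (c *: a + b) k = c *: tens a k + tens b k.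
Proof. by rewrite /tens amp1_linear cmul_linearl. Qed.

Lemma tens_linearr a (c : R[i]) k l : tens a (c *: k + l) = c *: tens a k + tens a l.
Proof. by rewrite /tens amp2_linear cmul_linearr. Qed.

Lemma tens_mul a k b l : cmul (tens a k) (tens b l) = tens (cmul a b) (cmul k l).
Proof.
rewrite /tens amp1_mul amp2_mul -!cmulA; congr (cmul _ _).
by rewrite !cmulA (amp_commute b k).
Qed.

Lemma tens_star a k : star (tens a k) = tens (star a) (star k).
Proof. by rewrite -(amp_commute (star a)) /tens starM -amp1_star -amp2_star. Qed.

Lemma tens_nm a k : nm (tens a k) <= nm a * nm k.
Proof. by apply: le_trans (nm_cmul _ _) _; apply: ler_pM; rewrite ?nm_ge0//; [exact: amp1_nm|exact: amp2_nm]. Qed.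

Definition slice j l (c : bop H) : bop H := cmul (star (V j)) (cmul c (V l)).

Lemma slice_linear j l (k : R[i]) c d : slice j l (k *: c + d) = k *: slice j l c + slice j l d.
Proof. by rewrite /slice cmul_linearl cmul_linearr. Qed.

Lemma slice_nm j l c : nm (slice j l c) <= nm c.
Proof.
have V1 := leg_norm.
apply: le_trans (nm_cmul _ _) _; rewrite nm_star -[leRHS]mul1r; apply: ler_pM; rewrite ?nm_ge0//; first exact: V1.
by apply: le_trans (nm_cmul _ _) _; rewrite -[leRHS]mulr1; apply: ler_pM; rewrite ?nm_ge0//; exact: V1.
Qed.

Lemma slice_tens j l a k : slice j l (tens a k) = inner (k (e l)) (e j) *: a.
Proof.
apply: (basis_entries_ext he hd) => m n; rewrite bop_scaleE innerZl -(entry12 a k l m j (e n)).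
by rewrite (bop_starPr (V j)).
Qed.

Lemma slice_entry (c : bop H) m n : inner (c (e m)) (e n) =
  inner (slice (q n).2 (q m).2 c (e (q m).1)) (e (q n).1).
Proof. by rewrite {1}(basis_leg m) {1}(basis_leg n) (bop_starPr (V _)). Qed.

(** A finite matrix meets finitely many legs, so it is the finite sum of its slices tensored with
    matrix units. *)
Lemma slice_sum M : exists J0, forall c, fin_mx e M c ->
  c = \sum_(j < J0) \sum_(l < J0) tens (slice j l c) (rank_one (e j) (e l)).
Proof.
have [J0 hJ0] := seq_bounded (iota 0 M) (fun m => (q m).2).
have fin m : (J0 <= (q m).2)%N -> cut e M (e m) = 0.
  move=> hm; apply: (cut_basis_out he); rewrite leqNgt; apply: contraTN hm => mM.
  by rewrite -ltnNge; apply: hJ0; rewrite mem_iota add0n.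
exists J0 => c /(fin_mxP he)[c1 c2]; apply: (basis_entries_ext he hd) => m n.
have -> : inner ((\sum_(j < J0) \sum_(l < J0) tens (slice j l c) (rank_one (e j) (e l))) (e m)) (e n) =
    \sum_(j < J0) \sum_(l < J0) ((q m).2 == l :> nat)%:R * (j == (q n).2 :> nat)%:R *
       inner (slice j l c (e (q m).1)) (e (q n).1).
  rewrite bop_sumE inner_suml; apply: eq_bigr => j _.
  rewrite bop_sumE inner_suml; apply: eq_bigr => l _.
  by rewrite tens_entry rank_oneE innerZl !he.
have [mJ|mJ] := ltnP (q m).2 J0; last first.
  have -> : c (e m) = 0 by rewrite -c2 bop_mulE fin ?bop0.
  rewrite inner0l big1// => j _; rewrite big1// => l _.
  have -> : ((q m).2 == l :> nat) = false by apply/negbTE; have := ltn_ord l; lia.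
  by rewrite !mul0r.
have [nJ|nJ] := ltnP (q n).2 J0; last first.
  have -> : inner (c (e m)) (e n) = 0.
    by rewrite -c1 bop_mulE bop_starP cut_star fin ?inner0r.
  rewrite big1// => j _; rewrite big1// => l _.
  have -> : (j == (q n).2 :> nat) = false by apply/negbTE; have := ltn_ord j; lia.
  by rewrite mulr0 mul0r.
rewrite slice_entry (bigD1 (Ordinal nJ)) //= (bigD1 (Ordinal mJ)) //= !eqxx !mul1r.
rewrite big1 ?addr0 => [|l lm]; last first.
  have -> : ((q m).2 == l :> nat) = false by rewrite eq_sym; exact: negbTE.
  by rewrite !mul0r.
rewrite big1 ?addr0// => j jn; rewrite big1// => l _.
have -> : (j == (q n).2 :> nat) = false by exact: negbTE.
by rewrite mulr0 mul0r.
Qed.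

Lemma leg_star_cut j M : exists N0, forall N, (N0 <= N)%N ->
  cmul (cut e N) (cmul (star (V j)) (cut e M)) = cmul (star (V j)) (cut e M).
Proof.
have [N0 hN0] := seq_bounded (iota 0 M) (fun m => (q m).1).
exists N0 => N hN; apply: (basis_ext he hd) => m.
rewrite !bop_mulE; have [mM|mM] := ltnP m M; last first.
  by rewrite (cut_basis_out he)// !bop0.
rewrite (cut_basis he)// (basis_leg m) leg_orth.
case: eqP => _; last by rewrite bop0.
rewrite (cut_basis he)//; apply: leq_trans hN; apply: hN0.
by rewrite mem_iota add0n.
Qed.

Lemma slice_fin j l M : exists N0, forall N, (N0 <= N)%N ->
  forall c, fin_mx e M c -> fin_mx e N (slice j l c).
Proof.
have [N1 h1] := leg_star_cut j M; have [N2 h2] := leg_star_cut l M.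
exists (maxn N1 N2) => N; rewrite geq_max => /andP[/h1 {}h1 /h2 {}h2] c /(fin_mxP he)[c1 c2].
have {}h2 : cmul (cmul (cut e M) (V l)) (cut e N) = cmul (cut e M) (V l).
  by have := congr1 (@star R (bop H)) h2; rewrite !starM starK !cut_star.
apply/(fin_mxP he); rewrite /slice; split.
  by rewrite -{1 2}c1 -!cmulA (cmulA (cut e M)) !cmulA -(cmulA (cut e N)) h1.
by rewrite -{1 2}c2 -!cmulA (cmulA (cut e M)) h2.
Qed.

Lemma tens_fin n : exists N0, forall N, (N0 <= N)%N -> forall a k,
  fin_mx e n a -> fin_mx e n k -> fin_mx e N (tens a k).
Proof.
have [N0 hN0] := seq_bounded [seq (i, j) | i <- iota 0 n, j <- iota 0 n] p.
exists N0 => N hN a k fa fk.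
(* One side is enough: the other one follows by taking adjoints. *)
have key (b l : bop H) : cmul b (cut e n) = b -> cmul l (cut e n) = l ->
    cmul (tens b l) (cut e N) = tens b l.
  move=> hb hl; apply: (basis_ext he hd) => m.
  rewrite bop_mulE; have [mN|mN] := ltnP m N.
    by rewrite (cut_basis he).
  have out i := @cut_basis_out R H e he n i.
  rewrite (cut_basis_out he)// bop0; apply/esym/(basis_vec_ext he hd) => r; rewrite inner0l tens_entry.
  have [n1|n1] := leqP n (q m).1.
    by rewrite -hb bop_mulE out// bop0 inner0l mulr0.
  have [n2|n2] := leqP n (q m).2.
    by rewrite -hl bop_mulE out// bop0 inner0l mul0r.
  have : (m < N0)%N; last by lia.
  rewrite -(qK m) [q m]surjective_pairing; apply: hN0; apply/allpairsP.
  by exists (q m); rewrite !mem_iota !add0n.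
have [a1 a2] := (fin_mxP he _ _).1 fa.
have [k1 k2] := (fin_mxP he _ _).1 fk.
apply/(fin_mxP he); split; last exact: key.
have := key (star a) (star k); rewrite -tens_star -(cut_star e n) -!starM a1 k1.
move=> /(_ erefl erefl) /(congr1 (@star R (bop H))).
by rewrite starM cut_star starK.
Qed.

(* [tn a k] is [a (x) k] on l_2 (x) l_2 = l_2; [sl j l c] is the [(j, l)] entry
   of [c], seen as a matrix of operators on the first factor. *)
Record tensor_ops := TensorOps {
  tn : bop H -> bop H -> bop H;
  sl : nat -> nat -> bop H -> bop H;
  tn_linearl : forall k (c : R[i]) a b, tn (c *: a + b) k = c *: tn a k + tn b k;
  tn_linearr : forall a (c : R[i]) k l, tn a (c *: k + l) = c *: tn a k + tn a l;
  tn_mul : forall a k b l, cmul (tn a k) (tn b l) = tn (cmul a b) (cmul k l);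
  tn_star : forall a k, star (tn a k) = tn (star a) (star k);
  tn_nm : forall a k, nm (tn a k) <= nm a * nm k;
  tn_fin : forall n, exists N0, forall N, (N0 <= N)%N -> forall a k,
    fin_mx e n a -> fin_mx e n k -> fin_mx e N (tn a k);
  sl_linear : forall j l (k : R[i]) c d, sl j l (k *: c + d) = k *: sl j l c + sl j l d;
  sl_nm : forall j l c, nm (sl j l c) <= nm c;
  sl_tn : forall j l a k, sl j l (tn a k) = inner (k (e l)) (e j) *: a;
  sl_fin : forall j l M, exists N0, forall N, (N0 <= N)%N ->
    forall c, fin_mx e M c -> fin_mx e N (sl j l c);
  sl_sum : forall M, exists J, forall c, fin_mx e M c ->
    c = \sum_(j < J) \sum_(l < J) tn (sl j l c) (rank_one (e j) (e l)) }.

Definition tensor_ops_of_legs : tensor_ops :=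
  TensorOps tens_linearl tens_linearr tens_mul tens_star tens_nm tens_fin
    slice_linear slice_nm slice_tens slice_fin slice_sum.

End TensorOperators.

Lemma l2h_tensor_ops (R : realType) : exists t : tensor_ops (@l2e R), True.
Proof.
have [p [q [pK qK]]] := nat_pairing.
(* The flipped pairing exchanges the two factors, so the amplification built from it is
   [1 (x) k]. *)
pose p' (ij : nat * nat) := p (ij.2, ij.1).
pose q' m := ((q m).2, (q m).1).
have pK' : cancel p' q' by move=> [i j]; rewrite /q' /p' pK.
have qK' : cancel q' p' by move=> m; rewrite /q' /p' /= -surjective_pairing qK.
have cross i j y : star (leg R qK j) (leg R qK' i y) = inner y (@l2e R j) *: (@l2e R i).
  rewrite l2_inner_e; apply: l2h_ext => k.
  rewrite (leg_starE pK) legE l2_scaleE l2eE /q' pK /=.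
  by case: eqP => _; rewrite ?mulr1 ?mulr0.
suff t : tensor_ops (@l2e R) by exists t.
have := (tensor_ops_of_legs (@l2e_orthonormal R) (@l2e_dense R) qK
  (V := leg R qK) (V' := leg R qK') (amp1 := amp pK qK) (amp2 := amp pK' qK')
  (leg_e R pK qK) (fun i j => leg_e R pK' qK' j i) (leg_star_leg pK qK) cross
  (leg_nm R qK) (amp_leg pK qK) (leg_amp pK qK) (leg_amp pK' qK')
  (amp_linear pK qK) (amp_linear pK' qK') (amp_mul pK qK) (amp_mul pK' qK')
  (amp_star pK qK) (amp_star pK' qK') (amp_nm pK qK) (amp_nm pK' qK')).
by [].
Qed.

(** * Closures of algebras *)

Lemma closure_nmle (R : realType) (V : normedModType R[i]) (S : set V) x :
  closure S x <-> forall d, 0 < d -> exists2 y, S y & nm (x - y) <= d.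
Proof.
split=> [/closure_nm h d /h[y Sy /ltW yd]|h]; first by exists y.
apply/closure_nm => d d0; have [y Sy yd] := h (d / 2) ltac:(lra).
by exists y => //; apply: le_lt_trans yd _; lra.
Qed.

Lemma eventually_all (T : eqType) (s : seq T) (Q : T -> nat -> Prop) :
  (forall x, exists N0, forall N, (N0 <= N)%N -> Q x N) ->
  exists N0, forall N, (N0 <= N)%N -> forall x, x \in s -> Q x N.
Proof.
move=> /choice[n hn]; have [N0 hN0] := seq_bounded s n.
by exists N0 => N hN x xs; apply: hn; apply: leq_trans hN; apply/ltnW/hN0.
Qed.

Lemma bilinear_approx (R : realType) (X Y Z : normedZmodType R[i]) (m : X -> Y -> Z) x y d :
  (forall x x' y, m (x - x') y = m x y - m x' y) ->
  (forall x y y', m x (y - y') = m x y - m x y') ->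
  (forall x y, nm (m x y) <= nm x * nm y) -> 0 < d ->
  exists2 d', 0 < d' & forall x' y', nm (x - x') <= d' -> nm (y - y') <= d' ->
    nm (m x y - m x' y') <= d.
Proof.
move=> ml mr mn d0; have x0 := nm_ge0 x; have y0 := nm_ge0 y.
pose D := nm x + nm y + 1; have D0 : 0 < D by rewrite /D; lra.
(* The cap [1] keeps [|x'| <= |x| + 1]. *)
exists (Num.min 1 (d / D)) => [|x' y']; first by rewrite lt_min ltr01 divr_gt0.
rewrite !le_min => /andP[h1 h2] /andP[k1 k2].
have xn : nm x' <= nm x + 1 by have := nmD (x' - x) x; rewrite subrK nmB; lra.
have -> : d = d / D * nm y + (nm x + 1) * (d / D).
  have h : d / D * D = d by rewrite divfK// gt_eqF.
  by rewrite -{1}h /D; ring.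
apply: (nm_triangle_le (z := m x' y) _ _ (lexx _)).
  by rewrite -ml; apply: le_trans (mn _ _) _; rewrite ler_wpM2r.
by rewrite -mr; apply: le_trans (mn _ _) _; apply: ler_pM; rewrite ?nm_ge0.
Qed.

Section Spanned.
Variables (R : realType) (A : lmodType R[i]).

(** In contrast to [finite_dim], the spanning vectors lie in [S]. They can thus be lifted to a
    subalgebra containing [S], and their combinations stay in [S] when [S] is a subspace. *)
Definition spanned (S : set A) := exists (n : nat) (v : 'I_n -> A),
  (forall i, S (v i)) /\
  forall x, S x -> exists c : 'I_n -> R[i], x = \sum_(i < n) c i *: v i.

(** A space separated by finitely many functionals is finite-dimensional: split off the kernel of
    one functional and a vector on which it does not vanish. *)
Lemma functionals_spanned (ls : seq (A -> R[i])) (S : set A) : S 0 ->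
  (forall (c : R[i]) x y, S x -> S y -> S (c *: x + y)) ->
  (forall l, l \in ls -> forall (c : R[i]) x y, l (c *: x + y) = c * l x + l y) ->
  (forall x, S x -> (forall l, l \in ls -> l x = 0) -> x = 0) -> spanned S.
Proof.
elim: ls S => [|l ls IH] S S0 Slin ll sep.
  exists 0%N, (fun _ => 0); split=> // x Sx; exists (fun _ => 0).
  by rewrite big_ord0; apply: sep.
have lin := ll l (mem_head _ _).
have l0 : l 0 = 0.
  by have := lin (-1) 0 0; rewrite scaler0 addr0 mulN1r addNr.
have [n [v [vS hv]]] : spanned [set x | S x /\ l x = 0].
  apply: IH => [//|c x y [Sx lx] [Sy ly]|l' hl'|x [Sx lx] h].
  - by split; [exact: Slin|rewrite lin lx ly mulr0 addr0].
  - by apply: ll; rewrite inE hl' orbT.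
  - by apply: sep => // l'; rewrite inE => /orP[/eqP->|/h].
have [[x0 Sx0 lx0]|nx] := pselect (exists2 x0, S x0 & l x0 != 0); last first.
  exists n, v; split=> [i|x Sx]; first by have [] := vS i.
  by apply: hv; split=> //; apply: contrapT => /eqP lx; apply: nx; exists x.
exists n.+1, (fun i => if unlift ord0 i is Some j then v j else x0); split=> [i|x Sx].
  by case: unlift => // j; have [] := vS j.
have [|c hc] := hv (- (l x / l x0) *: x0 + x).
  by split; [exact: Slin|rewrite lin mulNr divfK// addrC subrr].
exists (fun i => if unlift ord0 i is Some j then c j else l x / l x0).
rewrite big_ord_recl unlift_none; under eq_bigr do rewrite liftK.
by rewrite -hc addrA -scalerDl subrr scale0r add0r.
Qed.

End Spanned.

Section ClosureAlgebra.
Variables (R : realType) (A : cstarAlgType R).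

Lemma closure_linear (S : set A) : linear_subspace S -> linear_subspace (closure S).
Proof.
move=> [S0 Sl]; split; first exact: subset_closure.
move=> c x y /closure_nmle hx /closure_nmle hy; apply/closure_nmle => d d0.
have c0 := nm_ge0 c.
have d1 : 0 < d / (nm c + 1) / 2 by rewrite !divr_gt0//; lra.
have [x' Sx' xx'] := hx _ d1; have [y' Sy' yy'] := hy (d / 2) ltac:(lra).
exists (c *: x' + y'); first exact: Sl.
rewrite opprD addrACA -scalerBr; apply: (nmD_le (p := d / 2) _ yy'); last by lra.
rewrite nmZ; apply: le_trans (ler_wpM2l c0 xx') _.
rewrite !mulrA ler_pM2r ?invr_gt0; last lra.
by rewrite ler_pdivrMr; nra.
Qed.

Lemma closure_mul (S S' S'' : set A) : (forall x y, S x -> S' y -> S'' (cmul x y)) ->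
  forall x y, closure S x -> closure S' y -> closure S'' (cmul x y).
Proof.
move=> Sm x y /closure_nmle hx /closure_nmle hy; apply/closure_nmle => d d0.
have [d' d'0 h] := bilinear_approx x y (@cmulBl _ _) (fun x y y' => cmulBr y y' x) (@nm_cmul _ A) d0.
have [x' Sx' xx'] := hx _ d'0; have [y' Sy' yy'] := hy _ d'0.
by exists (cmul x' y'); [exact: Sm|exact: h].
Qed.

Lemma closure_subalgebra (S : set A) : linear_subspace S ->
  (forall x y, S x -> S y -> S (cmul x y)) -> (forall x, S x -> S (star x)) ->
  cstar_subalgebra (closure S).
Proof.
move=> Sl Sm Ss; split; [exact: closure_linear|exact: closure_mul| |exact: closed_closure].
move=> x /closure_nmle hx; apply/closure_nmle => d d0; have [y Sy xy] := hx d d0.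
by exists (star y); [exact: Ss|rewrite -starB nm_star].
Qed.

Variables (S : set A) (HS : cstar_subalgebra S).

Lemma subval_sum (I : Type) (s : seq I) P (F : I -> subalg HS) :
  subval (\sum_(i <- s | P i) F i) = \sum_(i <- s | P i) subval (F i).
Proof. exact: (big_morph (@subval R A S HS) (@subval_add R A S HS) (erefl _)). Qed.

Lemma closure_subval (F : set A) : F `<=` S -> S `<=` closure F ->
  closure [set x : subalg HS | F (subval x)] = setT.
Proof.
move=> FS SF; apply/seteqP; split=> // x _; apply/closure_nmle => d d0.
have /closure_nmle /(_ d d0)[y Fy xy] := SF _ (subvalP x).
have [z hz] := subval_ex HS (FS _ Fy).
by exists z; [rewrite /= hz|rewrite -subval_nm subval_sub hz].
Qed.

Lemma AF_of_family (F : set (set A)) : F !=set0 ->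
  (forall X, F X -> [/\ cstar_subalgebra X, spanned X & X `<=` S]) ->
  (forall X Y, F X -> F Y -> exists Z, [/\ F Z, X `<=` Z & Y `<=` Z]) ->
  S `<=` closure (\bigcup_(X in F) X) -> AF (subalg HS).
Proof.
move=> [X0 FX0] FP dir dense.
pose lft (X : set A) := [set x : subalg HS | X (subval x)].
exists [set lft X | X in F]; split.
- by exists (lft X0); exists X0.
- move=> _ [X FX <-]; have [[[X_0 Xl] Xm Xs Xc] [n [v [vX hv]]] XS] := FP X FX; split.
    split; first by split=> [//|c x y]; exact: Xl.
    + by move=> x y; exact: Xm.
    + by move=> x; exact: Xs.
    move=> x /closure_nmle hx; apply: Xc; apply/closure_nmle => d d0.
    by have [y Xy xy] := hx d d0; exists (subval y).
  have /choice[w hw] : forall i, exists w : subalg HS, subval w = v i.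
    by move=> i; have [w] := subval_ex HS (XS _ (vX i)); exists w.
  exists n, w => x /hv[c xc]; exists c; apply: subval_inj.
  rewrite xc; under eq_bigr do rewrite -hw.
  by rewrite subval_sum.
- move=> _ _ [X FX <-] [Y FY <-]; have [Z [FZ XZ YZ]] := dir _ _ FX FY.
  by exists (lft Z); split; [exists Z|move=> x; exact: XZ|move=> x; exact: YZ].
rewrite -(@closure_subval (\bigcup_(X in F) X)) //; last first.
  by move=> x [X FX Xx]; have [_ _] := FP X FX; exact.
congr closure; apply/seteqP; split=> x; first by move=> [_ [X FX <-] Xx]; exists X.
by move=> [X FX Xx]; exists (lft X) => //; exists X.
Qed.

(** For each [i], the combinations of the spanning vectors with rational complex coefficients are
    countably many and dense in [X i]. *)
Lemma separable_of_spanned (I : countType) (X : I -> set A) :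
  (forall i, linear_subspace (X i) /\ spanned (X i)) -> (forall i, X i `<=` S) ->
  S `<=` closure (\bigcup_i X i) -> separable (subalg HS).
Proof.
move=> XP XS dense.
pose q (s : seq (rat * rat)) k : R[i] := ratr (nth (0, 0) s k).1 +i* ratr (nth (0, 0) s k).2.
have /choice[w hw] : forall i, exists w : seq (rat * rat) -> subalg HS,
    (forall s, X i (subval (w s))) /\
    forall x d, X i x -> 0 < d -> exists s, nm (x - subval (w s)) <= d.
  move=> i; have [[X0 Xl] [n [v [vX hv]]]] := XP i.
  have comb s : X i (\sum_(k < n) q s k *: v k).
    by elim/big_ind: _ => [//|x y Xx Xy|k _]; [rewrite -[x]scale1r|rewrite -[_ *: _]addr0]; exact: Xl.
  have /choice[w hw] : forall s, exists w : subalg HS, subval w = \sum_(k < n) q s k *: v k.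
    by move=> s; have [w] := subval_ex HS (XS _ _ (comb s)); exists w.
  exists w; split=> [s|x d /hv[c ->] d0]; first by rewrite hw.
  pose D := \sum_(k < n) nm (v k) + 1.
  have D0 : 0 < D by rewrite /D ltr_wpDl// sumr_ge0// => k _; exact: nm_ge0.
  have /choice[r hr] := fun k => @rational_complex_dense _ (d / D)
    (if insub k is Some k' then c k' else 0) (divr_gt0 d0 D0).
  exists (mkseq r n); rewrite hw -sumrB; apply: le_trans (nm_sum _ _ _) _.
  apply: (@le_trans _ _ (\sum_(k < n) d / D * nm (v k))).
    apply: ler_sum => k _; rewrite -scalerBl nmZ ler_wpM2r ?nm_ge0//.
    by have := hr k; rewrite valK /q nth_mkseq.
  rewrite -mulr_sumr mulrAC ler_pdivrMr// ler_pM2l// /D; lra.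
exists (range (fun i : I * seq (rat * rat) => w i.1 i.2)); split.
  exact: (@card_le_trans _ _ _ setT _ _ (card_image_le _ _) (countableP _)).
apply/seteqP; split=> // x _; apply/closure_nmle => d d0.
have d2 : 0 < d / 2 by lra.
have /closure_nmle /(_ _ d2)[y [i _ Xy] xy] := dense _ (subvalP x).
have [s hs] := (hw i).2 y (d / 2) Xy d2.
exists (w i s); first by exists (i, s).
rewrite -subval_nm subval_sub; exact: nm_triangle2 xy hs.
Qed.

End ClosureAlgebra.

(** * The algebra of a family of graphs *)

Definition square N (p : nat * nat) := (p.1 < N)%N && (p.2 < N)%N.

Lemma square_mono M N p : (M <= N)%N -> square M p -> square N p.
Proof. by rewrite /square; lia. Qed.

Lemma square_enum N : exists s : seq (nat * nat), forall p, square N p -> p \in s.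
Proof.
exists [seq (i, j) | i <- iota 0 N, j <- iota 0 N] => -[i j] /andP[/= iN jN].
by apply/allpairsP; exists (i, j); rewrite !mem_iota !add0n.
Qed.

Section Blocks.
Variables (R : realType) (H : hilbertType R) (e : nat -> H).
Hypothesis he : forall i j, inner (e i) (e j) = (i == j)%:R.
Hypothesis hd : closure [set x | exists (n : nat) (c : nat -> R[i]),
  x = \sum_(i < n) c i *: e i] = setT.
Variables (T : eqType) (f : T -> nat -> nat) (u : T -> nat -> ft_unitary e).
Hypothesis ad : forall s t, s != t -> exists N, forall n, (N <= n)%N -> f s n != f t n.
Local Notation B := (bfam (nat * nat) (bop H)).

Lemma fin_mx_closed n (a : bop H) :
  (forall d, 0 < d -> exists2 b, fin_mx e n b & nm (a - b) <= d) -> fin_mx e n a.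
Proof.
move=> h; apply/eqP; rewrite -subr_eq0; apply/eqP/nm_small => d d0.
have [b fb ab] := h (d / 2) ltac:(lra).
have -> : cmul (cut e n) (cmul a (cut e n)) - a =
    cmul (cut e n) (cmul (a - b) (cut e n)) - (a - b).
  by rewrite cmulBl cmulBr [cmul _ (cmul b _)]fb opprB addrA subrK.
apply: (@nmD_le _ _ _ _ (d / 2) (d / 2)); rewrite ?nmN//; last by lra.
have c1 := cut_nm1 he n; have n0 := nm_ge0 (a - b); have c0 := nm_ge0 (cut e n).
apply: le_trans (nm_cmul _ _) _; apply: le_trans (ler_wpM2l c0 (nm_cmul _ _)) _.
apply: le_trans ab; rewrite mulrA mulrAC -[leRHS]mul1r ler_wpM2r//; nra.
Qed.

Lemma fin_mx_entries n (a : bop H) : fin_mx e n a ->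
  (forall i j, (i < n)%N -> (j < n)%N -> inner (a (e i)) (e j) = 0) -> a = 0.
Proof.
move=> /(fin_mxP he)[a1 a2] h; apply: (basis_entries_ext he hd) => i j.
rewrite bop_zeroE inner0l; have [ni|ni] := ltnP i n; last first.
  by rewrite -a2 bop_mulE (cut_basis_out he ni) bop0 inner0l.
have [nj|nj] := ltnP j n; first exact: h.
by rewrite -a1 bop_mulE bop_starP cut_star (cut_basis_out he nj) inner0r.
Qed.

Lemma conj_by0 (v : ft_unitary e) : conj_by v 0 = 0.
Proof. by rewrite /conj_by cmul0l cmul0r. Qed.
Lemma conj_by'0 (v : ft_unitary e) : conj_by' v 0 = 0.
Proof. by rewrite /conj_by' cmul0l cmul0r. Qed.
Lemma conj_by'B (v : ft_unitary e) a b : conj_by' v (a - b) = conj_by' v a - conj_by' v b.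
Proof. by rewrite /conj_by' cmulBl cmulBr. Qed.

(** Undoes the twist: if [x] is [u c u^*] at a point of the graph of [t], with [u] the unitary
    there, this is [c]. *)
Definition frame t n (x : B) := conj_by' (u t n) (x (n, f t n)).

(* As [(N, f t N)] is outside the square, [frame t N x] is the constant value of
   [x] along the graph of [t].  The corner size [M] is separate from [N]: the
   unitaries met inside a larger square can require a larger corner. *)
Definition block (G : seq T) N M : set B := [set x : B |
  [/\ forall p, square N p -> fin_mx e M (x p),
      forall p, ~~ square N p -> (forall t, t \in G -> p.2 != f t p.1) -> x p = 0 &
      forall t n, t \in G -> ~~ square N (n, f t n) ->
        fin_mx e M (frame t n x) /\ frame t n x = frame t N x]].

Lemma frame_linear t n (c : R[i]) x y : frame t n (c *: x + y) = c *: frame t n x + frame t n y.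
Proof. exact: conj_by'_linear. Qed.

Lemma frame_mul t n x y : frame t n (cmul x y) = cmul (frame t n x) (frame t n y).
Proof. exact: conj_by'_mul. Qed.

Lemma frame_star t n x : frame t n (star x) = star (frame t n x).
Proof. exact: conj_by'_star. Qed.

Lemma frame_eq0 t n x : frame t n x = 0 -> x (n, f t n) = 0.
Proof. by move=> h; rewrite -(conj_byK' (u t n) (x _)) [conj_by' _ _]h conj_by0. Qed.

Lemma frame0 t n (x : B) : x (n, f t n) = 0 -> frame t n x = 0.
Proof. by rewrite /frame => ->; exact: conj_by'0. Qed.

Lemma frame_nm t n x y : nm (frame t n x - frame t n y) <= nm (x - y).
Proof.
rewrite /frame -conj_by'B; apply: le_trans (conj_by'_nm _ _) _.
exact: (bfam_nm (x - y) (n, f t n)).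
Qed.

Lemma block_linear G N M : linear_subspace (block G N M).
Proof.
split.
  split=> [p _|//|t n _ _]; first exact: fin_mx0.
  by rewrite !frame0//; split; first exact: fin_mx0.
move=> c x y [x1 x2 x3] [y1 y2 y3]; split.
- by move=> p hp; apply: fin_mx_linear; [exact: x1|exact: y1].
- by move=> p hp ht; rewrite bfam_addE bfam_scaleE x2// y2// scaler0 addr0.
move=> t n tG hn; have [[fx ex] [fy ey]] := (x3 t n tG hn, y3 t n tG hn).
by rewrite !frame_linear ex ey; split=> //; rewrite -ex -ey; exact: fin_mx_linear.
Qed.

Lemma block_mul G N M x y : block G N M x -> block G N M y -> block G N M (cmul x y).
Proof.
move=> [x1 x2 x3] [y1 y2 y3]; split.
- by move=> p hp; apply: (fin_mx_mul he); [exact: x1|exact: y1].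
- by move=> p hp ht; rewrite bfam_mulE x2// cmul0l.
move=> t n tG hn; have [[fx ex] [fy ey]] := (x3 t n tG hn, y3 t n tG hn).
by rewrite !frame_mul ex ey; split=> //; rewrite -ex -ey; exact: (fin_mx_mul he).
Qed.

Lemma block_star G N M x : block G N M x -> block G N M (star x).
Proof.
move=> [x1 x2 x3]; split.
- by move=> p hp; apply: (fin_mx_star he); exact: x1.
- by move=> p hp ht; rewrite bfam_starE x2// star0.
move=> t n tG hn; have [fx ex] := x3 t n tG hn.
by rewrite !frame_star ex; split=> //; rewrite -ex; exact: (fin_mx_star he).
Qed.

Lemma block_closed G N M : closed (block G N M).
Proof.
apply: closed_nm => x hx; split.
- move=> p hp; apply: fin_mx_closed => d /hx[y [y1 _ _] xy]; exists (y p); first exact: y1.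
  by apply: le_trans (ltW xy); exact: (bfam_nm (x - y) p).
- move=> p hp ht; apply: nm_small => d /hx[y [_ y2 _] xy].
  by apply: le_trans (ltW xy); have := bfam_nm (x - y) p; rewrite bfam_addE bfam_oppE y2// subr0.
move=> t n tG hn; split.
  apply: fin_mx_closed => d /hx[y [_ _ y3] xy]; exists (frame t n y); first by case: (y3 t n tG hn).
  exact: le_trans (frame_nm _ _ _ _) (ltW xy).
apply/eqP; rewrite -subr_eq0; apply/eqP/nm_small => d d0.
have [y [_ _ y3] xy] := hx (d / 2) ltac:(lra); have [_ ey] := y3 t n tG hn.
apply: (@nm_triangle2 _ _ (frame t n y)).
  exact: le_trans (frame_nm _ _ _ _) (ltW xy).
by rewrite ey nmB; apply: le_trans (frame_nm _ _ _ _) (ltW xy).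
Qed.

Lemma block_subalgebra G N M : cstar_subalgebra (block G N M).
Proof.
by split; [exact: block_linear|exact: block_mul|exact: block_star|exact: block_closed].
Qed.

Lemma block_eq0 G N M x : block G N M x -> (forall p, square N p -> x p = 0) ->
  (forall t, t \in G -> frame t N x = 0) -> x = 0.
Proof.
move=> [x1 x2 x3] h1 h2; apply: bfam_ext => p; rewrite bfam_zeroE.
have [/h1//|hp] := boolP (square N p).
have [[t tG hpt]|nG] := pselect (exists2 t, t \in G & p.2 = f t p.1); last first.
  by apply: x2 => // t tG; apply/eqP => hpt; apply: nG; exists t.
rewrite [p]surjective_pairing hpt in hp *.
by apply: frame_eq0; have [_ ->] := x3 t p.1 tG hp; exact: h2.
Qed.

(** An element is determined by finitely many matrix entries: those on the square and those of the
    constant values along the graphs in [G]. *)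
Lemma block_spanned G N M : spanned (block G N M).
Proof.
have [s hs] := square_enum N; have [r hr] := square_enum M.
pose l1 := [seq (fun x : B => inner (x p (e ij.1)) (e ij.2)) | p <- s, ij <- r].
pose l2 := [seq (fun x : B => inner (frame t N x (e ij.1)) (e ij.2)) | t <- G, ij <- r].
have [b0 bl] := block_linear G N M.
apply: (@functionals_spanned _ _ (l1 ++ l2)) => //.
  move=> l; rewrite mem_cat => /orP[/allpairsP[[p ij] [_ _ ->]]|/allpairsP[[t ij] [_ _ ->]]] c x y.
    by rewrite /= innerDl innerZl.
  have := congr1 (fun a : bop H => inner (a (e ij.1)) (e ij.2)) (frame_linear t N c x y).
  by rewrite [X in _ = X -> _]innerDl innerZl.
move=> x bx hl; have [x1 x2 x3] := bx; apply: (block_eq0 bx) => [p hp|t tG].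
  apply: (fin_mx_entries (x1 p hp)) => i j iM jM.
  apply: (hl (fun x : B => inner (x p (e i)) (e j))); rewrite mem_cat; apply/orP; left.
  by apply/allpairsP; exists (p, (i, j)); rewrite hs// hr// /square iM.
have [fx _] := x3 t N tG ltac:(by rewrite /square ltnn).
apply: (fin_mx_entries fx) => i j iM jM.
apply: (hl (fun x : B => inner (frame t N x (e i)) (e j))); rewrite mem_cat; apply/orP; right.
by apply/allpairsP; exists (t, (i, j)); rewrite tG hr// /square iM.
Qed.

(** Two of finitely many graphs meet in finitely many points, and a large square contains these. *)
Lemma graphs_disjoint (G : seq T) : exists N0, forall N, (N0 <= N)%N ->
  forall s t n, s \in G -> t \in G -> f s n = f t n -> ~~ square N (n, f t n) -> s = t.
Proof.
have [N0 hN0] : exists N0, forall N, (N0 <= N)%N -> forall st, st \in [seq (s, t) | s <- G, t <- G] ->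
    forall n, f st.1 n = f st.2 n -> ~~ square N (n, f st.2 n) -> st.1 = st.2.
  apply: eventually_all => -[s t] /=; have [->|/ad[N1 h1]] := eqVneq s t; first by exists 0%N.
  have [N2 h2] := seq_bounded (iota 0 N1) (f t).
  exists (maxn N1 N2) => N hN n fst hn; exfalso; move: hn.
  have nN1 : (n < N1)%N by rewrite ltnNge; apply/negP => /h1; rewrite fst eqxx.
  have := h2 n; rewrite mem_iota add0n nN1 => /(_ isT).
  by rewrite /square /=; move: hN nN1; lia.
exists N0 => N hN s t n sG tG; apply: (hN0 N hN (s, t)).
by apply/allpairsP; exists (s, t).
Qed.

(** [N] comes first, large enough to separate the graphs in [G']. The points of the graphs in [G]
    that have entered the square are now constrained untwisted, so [M] must grow to absorb their
    unitaries. *)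
Lemma block_mono G G' N1 M1 : {subset G <= G'} -> exists N0, forall N, (N0 <= N)%N ->
  exists M0, forall M, (M0 <= M)%N -> block G N1 M1 `<=` block G' N M.
Proof.
move=> GG'; have [N0 hN0] := graphs_disjoint G'.
exists (maxn N0 N1) => N; rewrite geq_max => /andP[/hN0 {}hN0 N1N].
have [M0 hM0] : exists M0, forall M, (M0 <= M)%N -> forall tn, tn \in [seq (t, n) | t <- G, n <- iota 0 N] ->
    forall a, fin_mx e M a -> fin_mx e M (conj_by (u tn.1 tn.2) a).
  apply: eventually_all => -[t n] /=; have [L hL] := conj_by_fin he (u t n).
  by exists L => M /hL h a /h[].
have Nsq p : ~~ square N p -> ~~ square N1 p by apply/contra/square_mono.
exists (maxn M0 M1) => M; rewrite geq_max => /andP[/hM0 {}hM0 M1M] x [x1 x2 x3].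
split.
- move=> p pN; have [pN1|pN1] := boolP (square N1 p).
    by apply: (fin_mx_mono he M1M); exact: x1.
  have [[t tG hpt]|nG] := pselect (exists2 t, t \in G & p.2 = f t p.1); last first.
    have -> : x p = 0 by apply: x2 => // t tG; apply/eqP => hpt; apply: nG; exists t.
    exact: fin_mx0.
  rewrite [p]surjective_pairing hpt in pN pN1 *.
  rewrite -(conj_byK' (u t p.1) (x _)); apply: (hM0 (t, p.1)).
    by apply/allpairsP; exists (t, p.1); rewrite tG mem_iota add0n; case/andP: pN => /= ->.
  by apply: (fin_mx_mono he M1M); case: (x3 t p.1 tG pN1).
- by move=> p pN h; apply: x2 => [|t /GG'/h//]; exact: Nsq.
have sqN t : ~~ square N (N, f t N) by rewrite /square ltnn.
move=> t n tG' nN; have [tG|tG] := boolP (t \in G).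
  have [fx ->] := x3 t n tG (Nsq _ nN); have [_ ->] := x3 t N tG (Nsq _ (sqN t)).
  split=> //; apply: (fin_mx_mono he M1M).
  by case: (x3 t N1 tG) => //; rewrite /square ltnn.
(* Outside the old square [x] lives on the graphs in [G], and the graph of [t] does not meet them
   outside the new one. *)
have x0 m : ~~ square N (m, f t m) -> frame t m x = 0.
  move=> mN; apply/frame0/x2 => [|s sG]; first exact: Nsq.
  apply/eqP => /= fst; move: tG; rewrite -(hN0 s t m) ?sG//; exact: GG'.
by rewrite !x0//; split=> //; exact: fin_mx0.
Qed.

Definition core (X : set T) : set B :=
  [set x : B | exists G N M, (forall t, t \in G -> X t) /\ block G N M x].

(** The separate blocks are kept beside the common one: they record on which graphs [x] and [y]
    live, as [core_ideal] requires for [x]. *)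
Lemma core_common X Y x y : core X x -> core Y y -> exists Gx Gy N M,
  [/\ forall t, t \in Gx -> X t, forall t, t \in Gy -> Y t,
      block Gx N M x, block Gy N M y & block (Gx ++ Gy) N M x /\ block (Gx ++ Gy) N M y].
Proof.
move=> [G [N [M [GX bx]]]] [G' [N' [M' [GY bY]]]].
have s1 : {subset G <= G ++ G'} by move=> t tG; rewrite mem_cat tG.
have s2 : {subset G' <= G ++ G'} by move=> t tG; rewrite mem_cat tG orbT.
have [N1 h1] := @block_mono G (G ++ G') N M s1.
have [N2 h2] := @block_mono G' (G ++ G') N' M' s2.
have [N3 h3] := @block_mono G G N M (fun _ => id).
have [N4 h4] := @block_mono G' G' N' M' (fun _ => id).
pose N0 := maxn (maxn N1 N2) (maxn N3 N4).
have [M1 k1] := h1 N0 ltac:(rewrite /N0; lia); have [M2 k2] := h2 N0 ltac:(rewrite /N0; lia).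
have [M3 k3] := h3 N0 ltac:(rewrite /N0; lia); have [M4 k4] := h4 N0 ltac:(rewrite /N0; lia).
pose M0 := maxn (maxn M1 M2) (maxn M3 M4).
exists G, G', N0, M0; split=> //; [apply: k3 bx|apply: k4 bY|split; [apply: k1 bx|apply: k2 bY]];
  rewrite /M0; lia.
Qed.

Lemma core_union X x y : core X x -> core X y ->
  exists G N M, [/\ forall t, t \in G -> X t, block G N M x & block G N M y].
Proof.
move=> /core_common h /h[G [G' [N [M [GX GY _ _ [b1 b2]]]]]].
exists (G ++ G'), N, M; split=> // t; rewrite mem_cat => /orP[/GX|/GY]//.
Qed.

Lemma core_linear X : linear_subspace (core X).
Proof.
split.
  by exists [::], 0%N, 0%N; split=> //; have [] := block_linear [::] 0 0.
move=> c x y cx /(core_union cx)[G [N [M [GX bx bY]]]]; exists G, N, M; split=> //.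
by have [_] := block_linear G N M; exact.
Qed.

Lemma core_mul X x y : core X x -> core X y -> core X (cmul x y).
Proof.
move=> cx /(core_union cx)[G [N [M [GX bx bY]]]]; exists G, N, M; split=> //.
exact: block_mul.
Qed.

Lemma core_star X x : core X x -> core X (star x).
Proof. by move=> [G [N [M [GX bx]]]]; exists G, N, M; split=> //; exact: block_star. Qed.

Lemma core_mono X Y : X `<=` Y -> core X `<=` core Y.
Proof. by move=> XY x [G [N [M [GX bx]]]]; exists G, N, M; split=> // t /GX/XY. Qed.

(** The product vanishes where [x] does, hence off the graphs of [x] outside a square; the common
    block gives the remaining conditions. *)
Lemma core_ideal X x y : core X x -> core setT y -> core X (cmul x y).
Proof.
move=> cx cy; have [G [G' [N [M [GX _ bx _ [bx' bY']]]]]] := core_common cx cy.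
have [b1 b2 b3] := block_mul bx' bY'; have [_ x2 _] := bx.
exists G, N, M; split=> //; split=> // [p hp hG|t n tG].
  by rewrite bfam_mulE x2// cmul0l.
by apply: b3; rewrite mem_cat tG.
Qed.

Definition galg (X : set T) : set B := closure (core X).

Lemma galg_subalgebra X : cstar_subalgebra (galg X).
Proof.
by apply: closure_subalgebra; [exact: core_linear|exact: core_mul|exact: core_star].
Qed.

Lemma galg_mono X Y : X `<=` Y -> galg X `<=` galg Y.
Proof. by move=> XY; apply: closureS; exact: core_mono. Qed.

Lemma galg_ideal X x y : galg X x -> galg setT y -> galg X (cmul x y).
Proof. by apply: closure_mul; exact: core_ideal. Qed.

Lemma galg_ideal' X x y : galg X x -> galg setT y -> galg X (cmul y x).
Proof.
have [_ _ sX _] := galg_subalgebra X; have [_ _ sT _] := galg_subalgebra setT.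
by move=> /sX hx /sT hy; have := sX _ (galg_ideal hx hy); rewrite starM !starK.
Qed.

Lemma galg_AF X : AF (subalg (galg_subalgebra X)).
Proof.
pose F := [set S | exists G N M, (forall t, t \in G -> X t) /\ S = block G N M].
apply: (@AF_of_family _ _ _ _ F).
- by exists (block [::] 0 0), [::], 0%N, 0%N.
- move=> _ [G [N [M [GX ->]]]]; split; [exact: block_subalgebra|exact: block_spanned|].
  by move=> x bx; apply: subset_closure; exists G, N, M.
- move=> _ _ [G [N [M [GX ->]]]] [G' [N' [M' [GY ->]]]].
  have s1 : {subset G <= G ++ G'} by move=> t tG; rewrite mem_cat tG.
  have s2 : {subset G' <= G ++ G'} by move=> t tG; rewrite mem_cat tG orbT.
  have [N1 h1] := @block_mono G (G ++ G') N M s1.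
  have [N2 h2] := @block_mono G' (G ++ G') N' M' s2.
  have [M1 k1] := h1 (maxn N1 N2) (leq_maxl _ _).
  have [M2 k2] := h2 (maxn N1 N2) (leq_maxr _ _).
  exists (block (G ++ G') (maxn N1 N2) (maxn M1 M2)); split.
  + exists (G ++ G'), (maxn N1 N2), (maxn M1 M2); split=> // t.
    by rewrite mem_cat => /orP[/GX|/GY].
  + exact: k1 (leq_maxl _ _).
  + exact: k2 (leq_maxr _ _).
apply: closureS => x [G [N [M [GX bx]]]].
by exists (block G N M) => //; exists G, N, M.
Qed.

Lemma galg_separable (g : nat -> T) : separable (subalg (galg_subalgebra (range g))).
Proof.
apply: (@separable_of_spanned _ _ _ _ _ (fun i : seq nat * (nat * nat) => block (map g i.1) i.2.1 i.2.2)).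
- by move=> i; split; [exact: block_linear|exact: block_spanned].
- move=> [s [N M]] x bx; apply: subset_closure; exists (map g s), N, M; split=> // t /mapP[k _ ->].
  by exists k.
apply: closureS => x [G [N [M [GX bx]]]].
have [s hs] : exists s, G = map g s.
  elim: G GX {bx} => [|t G IH] GX; first by exists [::].
  have [k _ kt] := GX t (mem_head _ _).
  have [|s ->] := IH; first by move=> t' ht'; apply: GX; rewrite inE ht' orbT.
  by exists (k :: s); rewrite /= kt.
by exists (s, (N, M)) => //=; rewrite -hs.
Qed.

End Blocks.

(** * Stability *)

(* A functional that does not vanish on the first [k] eliminates its [a]. *)
Lemma separated_tensor_sum_eq0 (R : realType) (A K : cstarAlgType R) (I : Type)
    (l : I -> K -> R[i]) :
  (forall i (c : R[i]) x y, l i (c *: x + y) = c * l i x + l i y) ->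
  (forall k, (forall i, l i k = 0) -> k = 0) ->
  forall s : seq (A * K), (forall i, \sum_(p <- s) l i p.2 *: p.1 = 0) -> tensor_sum_eq0 s.
Proof.
move=> ll sep s; have [n sn] := ubnP (size s).
elim: n s sn => // n IH [|[a k] s] /= sn hs W beta; first by rewrite big_nil.
rewrite big_cons /=; have {}hs i : l i k *: a + \sum_(p <- s) l i p.2 *: p.1 = 0.
  by have := hs i; rewrite big_cons.
have [k0|k0] := eqVneq k 0.
  rewrite k0 linear0r add0r; apply: IH => // i; have := hs i; rewrite k0.
  have -> : l i 0 = 0 by have := ll i (-1) 0 0; rewrite scaler0 addr0 mulN1r addNr.
  by rewrite scale0r add0r.
have [i li] : exists i, l i k != 0.
  apply: contrapT => h; move: k0; rewrite (sep k) ?eqxx// => i.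
  by apply: contrapT => /eqP li; apply: h; exists i.
pose c (p : A * K) := l i p.2 / l i k.
have aE : a = - \sum_(p <- s) c p *: p.1.
  have := congr1 (fun x => (l i k)^-1 *: x) (hs i).
  rewrite scaler0 scalerDr scalerA mulVf// scale1r => /eqP; rewrite addr_eq0 => /eqP ->.
  rewrite scaler_sumr; congr (- _); apply: eq_bigr => p _.
  by rewrite scalerA /c mulrC.
(* Substituting [aE] merges the first tensor into the others, which leaves one tensor fewer and
   keeps all the equations. *)
pose s' := [seq (p.1, - c p *: k + p.2) | p <- s].
have := IH s' ltac:(by rewrite size_map) _ W beta; rewrite /s' big_map /=.
under eq_bigr do rewrite linearDr linearZr_LR scaleNr /=.
rewrite big_split /= sumrN.
have -> : beta a k = - \sum_(p <- s) c p *: beta p.1 k.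
  rewrite aE linearNl linear_sumlz; congr (- _).
  by apply: eq_bigr => p _; rewrite linearZl_LR.
apply=> j; rewrite big_map /=.
under eq_bigr do rewrite ll scalerDl.
rewrite big_split /= -[RHS](hs j); congr (_ + _).
rewrite aE scalerN scaler_sumr -sumrN; apply: eq_bigr => p _.
by rewrite scalerA mulNr scaleNr [l j k * _]mulrC.
Qed.

Section Stability.
Variables (R : realType) (H : hilbertType R) (e : nat -> H).
Hypothesis he : forall i j, inner (e i) (e j) = (i == j)%:R.
Hypothesis hd : closure [set x | exists (n : nat) (c : nat -> R[i]),
  x = \sum_(i < n) c i *: e i] = setT.
Variables (T : eqType) (f : T -> nat -> nat) (u : T -> nat -> ft_unitary e).
Hypothesis ad : forall s t, s != t -> exists N, forall n, (N <= n)%N -> f s n != f t n.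
Variables (tops : tensor_ops e) (g : nat -> T).
Local Notation B := (bfam (nat * nat) (bop H)).
Local Notation core := (core f u (range g)).
Local Notation block := (block f u).
Local Notation galg := (galg f u (range g)).

(** The enumeration is essential. The data of [G] have numbers below some [K], and outside a large
    square the first [K] graphs are disjoint; so the first datum through a point of the graph of [t]
    is [t] itself. *)
Lemma first_unitary : exists V : nat * nat -> ft_unitary e,
  forall G : seq T, (forall t, t \in G -> range g t) -> exists N0, forall N, (N0 <= N)%N ->
    forall t n, t \in G -> ~~ square N (n, f t n) -> V (n, f t n) = u t n.
Proof.
have [v0 _] := ft_id_ex e.
pose P (p : nat * nat) k := p.2 == f (g k) p.1.
(* [v0] is a default value at the points on no graph. *)
exists (fun p => if pselect (exists k, P p k) is left ex then u (g (ex_minn ex)) p.1 else v0).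
move=> G GX.
have [K hK] : exists K, forall t, t \in G -> exists2 k, (k < K)%N & t = g k.
  have /choice[k hk] : forall t, exists k, t \in G -> t = g k.
    move=> t; have [/GX[k _ <-]|] := boolP (t \in G); first by exists k.
    by exists 0%N.
  have [K hK] := seq_bounded G k; exists K => t tG.
  by exists (k t); [exact: hK|exact: hk].
have [N0 hN0] := graphs_disjoint ad (map g (iota 0 K)); exists N0 => N /hN0 {}hN0 t n tG nN.
have [k kK tk] := hK t tG.
case: pselect => [ex|nex]; last by case: nex; exists k; rewrite /P /= tk.
case: ex_minnP => m /eqP /= Pm mmin.
have mk : (m <= k)%N by apply: mmin; rewrite /P /= tk.
rewrite (hN0 (g m) t n)//; apply/mapP; [exists m|exists k] => //; rewrite mem_iota add0n//.
exact: leq_ltn_trans mk kK.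
Qed.

Variable V : nat * nat -> ft_unitary e.
Hypothesis hV : forall G : seq T, (forall t, t \in G -> range g t) ->
  exists N0, forall N, (N0 <= N)%N ->
    forall t n, t \in G -> ~~ square N (n, f t n) -> V (n, f t n) = u t n.

(** In the frames given by [V] a single corner [M] holds all the values of [x], since only the
    finitely many points of the square can differ from the frames of the data. *)
Lemma core_framed x : core x -> exists G N M,
  [/\ forall t, t \in G -> range g t, block G N M x,
      forall p, fin_mx e M (conj_by' (V p) (x p)),
      forall M', (M <= M')%N -> forall p, square N p ->
        forall a, fin_mx e M' a -> fin_mx e M' (conj_by (V p) a) &
      forall t n, t \in G -> ~~ square N (n, f t n) -> V (n, f t n) = u t n].
Proof.
move=> [G [N1 [M1 [GX bx]]]]; have [N2 h2] := hV GX.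
have [N3 h3] := @block_mono _ _ _ he _ _ u ad G G N1 M1 (fun _ => id).
pose N := maxn N2 N3; have [M2 k2] := h3 N (leq_maxr _ _).
have {}h2 := h2 N (leq_maxl _ _).
have [s hs] := square_enum N.
have [M3 k3] : exists M0, forall M, (M0 <= M)%N -> forall p, p \in s ->
    forall a, fin_mx e M a -> fin_mx e M (conj_by (V p) a) /\ fin_mx e M (conj_by' (V p) a).
  by apply: eventually_all => p; exact: conj_by_fin.
pose M := maxn M2 M3; have bM := k2 M (leq_maxl _ _) x bx; have [x1 x2 x3] := bM.
exists G, N, M; split=> //.
  move=> p; have [pN|pN] := boolP (square N p).
    have := k3 M (leq_maxr _ _) p (hs _ pN) _ (x1 p pN); by case.
  have [[t tG hpt]|nG] := pselect (exists2 t, t \in G & p.2 = f t p.1); last first.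
    have -> : x p = 0 by apply: x2 => // t tG; apply/eqP => hpt; apply: nG; exists t.
    by rewrite conj_by'0; exact: fin_mx0.
  rewrite [p]surjective_pairing hpt in pN *; rewrite h2//.
  by case: (x3 t p.1 tG pN).
move=> M' MM' p pN a fa.
by case: (k3 M' (leq_trans (leq_maxr _ _) MM') p (hs _ pN) a fa).
Qed.

Lemma twist_ex (Phi : bop H -> bop H) C : 0 <= C -> (forall a, nm (Phi a) <= C * nm a) ->
  forall x : B, {y : B | forall p, y p = conj_by (V p) (Phi (conj_by' (V p) (x p)))}.
Proof.
move=> C0 bd x; apply: (bfam_of_bound (M := C * nm x)) => p.
apply: le_trans (conj_by_nm _ _) _; apply: le_trans (bd _) _; rewrite ler_wpM2l//.
exact: le_trans (conj_by'_nm _ _) (bfam_nm _ _).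
Qed.

(** Far out on a graph [V] is the unitary of its datum, so [Phi] acts on a constant frame value and
    gives a constant one. *)
Lemma twist_core (Phi : bop H -> bop H) (x y : B) : Phi 0 = 0 ->
  (forall M, exists N0, forall N, (N0 <= N)%N -> forall a, fin_mx e M a -> fin_mx e N (Phi a)) ->
  (forall p, y p = conj_by (V p) (Phi (conj_by' (V p) (x p)))) -> core x -> core y.
Proof.
move=> P0 Pfin hy /core_framed[G [N [M [GX [x1 x2 x3] fx fV VE]]]].
have [M1 hM1] := Pfin M; pose M' := maxn M M1.
have {}hM1 a : fin_mx e M a -> fin_mx e M' (Phi a) by apply: hM1; exact: leq_maxr.
have fy t n : t \in G -> ~~ square N (n, f t n) -> frame f u t n y = Phi (frame f u t n x).
  by move=> tG nN; rewrite /frame hy VE// conj_byK.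
exists G, N, M'; split=> //; split=> [p pN|p pN hG|t n tG nN].
- by rewrite hy; apply: (fV M' (leq_maxl _ _) p pN); exact: hM1.
- by rewrite hy x2// conj_by'0 P0 conj_by0.
have [fin_x ex] := x3 t n tG nN; rewrite !fy// ?ex; last by rewrite /square ltnn.
by split=> //; apply: hM1; rewrite -ex.
Qed.

Let tnBl a b k : tn tops (a - b) k = tn tops a k - tn tops b k.
Proof. by have := tn_linearl tops k (-1) b a; rewrite !scaleN1r ![- _ + _]addrC. Qed.
Let tnBr a k l : tn tops a (k - l) = tn tops a k - tn tops a l.
Proof. by have := tn_linearr tops a (-1) l k; rewrite !scaleN1r ![- _ + _]addrC. Qed.
Let tn0l k : tn tops 0 k = 0. Proof. by have := tnBl 0 0 k; rewrite subrr => ->; rewrite subrr. Qed.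
Let sl0 j l : sl tops j l 0 = 0.
Proof. by have := sl_linear tops j l (-1) 0 0; rewrite !scaleN1r addNr => ->; rewrite addNr. Qed.

Lemma tau_bound k a : nm (tn tops a k) <= nm k * nm a.
Proof. by rewrite mulrC; exact: tn_nm. Qed.
Lemma slice_bound j l a : nm (sl tops j l a) <= 1 * nm a.
Proof. by rewrite mul1r; exact: sl_nm. Qed.

(** This is [x (x) k], realized in the same algebra: [tn] is applied at each point in the frame
    given by [V]. *)
Definition ftau (x : B) (k : bop H) : B := sval (twist_ex (nm_ge0 k) (tau_bound k) x).
Definition fslice j l (x : B) : B := sval (twist_ex ler01 (slice_bound j l) x).

Lemma ftauE x k p : ftau x k p = conj_by (V p) (tn tops (conj_by' (V p) (x p)) k).
Proof. by rewrite /ftau; case: twist_ex. Qed.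
Lemma fsliceE j l x p : fslice j l x p = conj_by (V p) (sl tops j l (conj_by' (V p) (x p))).
Proof. by rewrite /fslice; case: twist_ex. Qed.

Lemma ftau_linearl k (c : R[i]) x y : ftau (c *: x + y) k = c *: ftau x k + ftau y k.
Proof.
apply: bfam_ext => p; rewrite bfam_addE bfam_scaleE !ftauE bfam_addE bfam_scaleE.
by rewrite conj_by'_linear tn_linearl conj_by_linear.
Qed.

Lemma ftau_linearr x (c : R[i]) k l : ftau x (c *: k + l) = c *: ftau x k + ftau x l.
Proof.
apply: bfam_ext => p; rewrite bfam_addE bfam_scaleE !ftauE.
by rewrite tn_linearr conj_by_linear.
Qed.

Lemma ftau_mul x k y l : cmul (ftau x k) (ftau y l) = ftau (cmul x y) (cmul k l).
Proof.
by apply: bfam_ext => p; rewrite bfam_mulE !ftauE -conj_by_mul tn_mul bfam_mulE conj_by'_mul.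
Qed.

Lemma ftau_star x k : star (ftau x k) = ftau (star x) (star k).
Proof.
by apply: bfam_ext => p; rewrite bfam_starE !ftauE -conj_by_star tn_star bfam_starE conj_by'_star.
Qed.

Lemma ftau_nm x k : nm (ftau x k) <= nm x * nm k.
Proof.
apply: bfam_nm_le => [|p]; first by rewrite mulr_ge0 ?nm_ge0.
rewrite ftauE; apply: le_trans (conj_by_nm _ _) _; apply: le_trans (tn_nm _ _ _) _.
rewrite ler_wpM2r ?nm_ge0//; exact: le_trans (conj_by'_nm _ _) (bfam_nm _ _).
Qed.

Lemma fslice_linear j l (c : R[i]) x y : fslice j l (c *: x + y) = c *: fslice j l x + fslice j l y.
Proof.
apply: bfam_ext => p; rewrite bfam_addE bfam_scaleE !fsliceE bfam_addE bfam_scaleE.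
by rewrite conj_by'_linear sl_linear conj_by_linear.
Qed.

Lemma fslice_tau j l x k : fslice j l (ftau x k) = inner (k (e l)) (e j) *: x.
Proof.
apply: bfam_ext => p; rewrite fsliceE ftauE conj_byK sl_tn bfam_scaleE.
have := conj_by_linear (V p) (inner (k (e l)) (e j)) (conj_by' (V p) (x p)) 0.
by rewrite conj_by0 !addr0 conj_byK'.
Qed.

Lemma ftau_core x k n : core x -> fin_mx e n k -> core (ftau x k).
Proof.
move=> cx fk; apply: (twist_core (Phi := fun a => tn tops a k)) (fun p => ftauE x k p) cx; first exact: tn0l.
move=> M; have [N0 h] := tn_fin tops (maxn M n); exists N0 => N /h {}h a fa.
apply: h; first exact: (fin_mx_mono he (leq_maxl _ _) fa).
exact: (fin_mx_mono he (leq_maxr _ _) fk).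
Qed.

Lemma fslice_core j l x : core x -> core (fslice j l x).
Proof.
move=> cx; apply: twist_core (fun p => fsliceE j l x p) cx; first exact: sl0.
exact: sl_fin.
Qed.

(** The slices of [x] are again in the core by [fslice_core], so sums of elementary tensors exhaust
    the core; this gives the density asked of a tensor product. *)
Lemma core_expansion x : core x -> exists J,
  x = \sum_(j < J) \sum_(l < J) ftau (fslice j l x) (rank_one (e j) (e l)).
Proof.
move=> /core_framed[G [N [M [_ _ fx _ _]]]]; have [J hJ] := sl_sum tops M.
exists J; apply: bfam_ext => p.
have famE (I : Type) (s : seq I) (F : I -> B) : (\sum_(i <- s) F i) p = \sum_(i <- s) F i p.
  exact: (big_morph (fun x : B => x p)).
have conjE (I : Type) (s : seq I) (F : I -> bop H) :
    conj_by (V p) (\sum_(i <- s) F i) = \sum_(i <- s) conj_by (V p) (F i).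
  apply: (big_morph (conj_by (V p))) => [a b|]; last exact: conj_by0.
  by have := conj_by_linear (V p) 1 a b; rewrite !scale1r.
rewrite -{1}(conj_byK' (V p) (x p)) (hJ _ (fx p)) conjE famE.
apply: eq_bigr => j _; rewrite conjE famE; apply: eq_bigr => l _.
by rewrite ftauE fsliceE conj_byK.
Qed.

Lemma ftau_galg x k : galg x -> Kset e k -> galg (ftau x k).
Proof.
move=> /closure_nmle hx /KsetP hk; apply/closure_nmle => d d0.
have tl x' x'' l : ftau (x' - x'') l = ftau x' l - ftau x'' l.
  by have := ftau_linearl l (-1) x'' x'; rewrite !scaleN1r ![- _ + _]addrC.
have tr y l l' : ftau y (l - l') = ftau y l - ftau y l'.
  by have := ftau_linearr y (-1) l' l; rewrite !scaleN1r ![- _ + _]addrC.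
have [d' d'0 h] := bilinear_approx x k tl tr ftau_nm d0.
have [x' cx' xx'] := hx d' d'0; have [n [k' [fk' kk']]] := hk d' d'0.
by exists (ftau x' k'); [exact: ftau_core cx' fk'|exact: h].
Qed.

End Stability.

Section StableAlgebra.
Variables (R : realType) (H : hilbertType R) (e : nat -> H).
Hypothesis he : forall i j, inner (e i) (e j) = (i == j)%:R.
Hypothesis hd : closure [set x | exists (n : nat) (c : nat -> R[i]),
  x = \sum_(i < n) c i *: e i] = setT.
Variables (T : eqType) (f : T -> nat -> nat) (u : T -> nat -> ft_unitary e).
Hypothesis ad : forall s t, s != t -> exists N, forall n, (N <= n)%N -> f s n != f t n.
Variables (tops : tensor_ops e) (g : nat -> T).

(** The algebra serves as its own tensor product with the compacts, through [ftau], and the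
    isomorphism is the identity. *)
Theorem galg_stable : stable (subalg (galg_subalgebra he u ad (range g))).
Proof.
have [V hV] := first_unitary u ad g.
set HS := galg_subalgebra he u ad (range g); set A := subalg HS.
pose K := compacts he hd.
have tauP (x : A) (k : K) : galg f u (range g) (ftau tops V (subval x) (subval k)).
  exact: (@ftau_galg _ _ _ he _ _ _ ad tops g V hV _ _ (subvalP x) (subvalP k)).
pose tau (x : A) (k : K) : A := sval (subval_ex HS (tauP x k)).
have tauE x k : subval (tau x k) = ftau tops V (subval x) (subval k).
  by rewrite /tau; case: subval_ex.
have tau_lin : bilinear_for ( *:%R : GRing.Scale.law R[i] A) ( *:%R : GRing.Scale.law R[i] A) tau.
  split=> [k c x y|x c k l]; apply: subval_inj; rewrite subval_linear !tauE.
    by rewrite subval_linear ftau_linearl.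
  by rewrite subval_linear ftau_linearr.
pose ltau := bilinear_isBilinear.Build R[i] A K A *:%R *:%R tau tau_lin.
pose btau : {bilinear A -> K -> A} := HB.pack tau ltau.
exists K, A; split; first exact: compacts_is_l2.
  exists btau; split.
  - move=> a a' b b'; apply: subval_inj; rewrite subval_mul !tauE.
    by rewrite ftau_mul.
  - by move=> a b; apply: subval_inj; rewrite subval_star !tauE ftau_star.
  - move=> s hs.
    (* Matrix entries separate the compacts, and the slice [fslice tops V j i] turns a vanishing sum
       of tensors into the equation for the entry [(j, i)]. *)
    pose l (jl : nat * nat) (k : K) : R[i] := inner (subval k (e jl.2)) (e jl.1).
    apply: (@separated_tensor_sum_eq0 _ _ _ _ l).
    + by move=> jl c x y; rewrite /l subval_linear bop_addE bop_scaleE innerDl innerZl.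
    + move=> k hk; apply: subval_inj; apply: (basis_entries_ext he hd) => i j.
      transitivity (0 : R[i]); [exact: (hk (j, i))|exact: esym (inner0l (e j))].
    move=> [j i]; apply: subval_inj.
    have := congr1 (fun x : A => fslice tops V j i (subval x)) hs.
    have z : fslice tops V j i 0 = 0.
      by have := fslice_linear tops V j i (-1) 0 0; rewrite !scaleN1r addNr => ->; rewrite addNr.
    rewrite [X in _ = X -> _]z subval_sum => h; rewrite -[RHS]h subval_sum.
    rewrite (big_morph (fslice tops V j i) (id1 := 0) (op1 := +%R)); last exact: z.
      by apply: eq_bigr => p _; rewrite tauE fslice_tau.
    by move=> x y; have := fslice_linear tops V j i 1 x y; rewrite !scale1r.
  apply/seteqP; split=> // z _.
  have : closure [set x : A | core f u (range g) (subval x)] z.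
    by rewrite (closure_subval HS (F := core f u (range g))) //; exact: subset_closure.
  apply: closureS => x cx; have [J hJ] := core_expansion he ad tops hV cx.
  have galg_slice j l : galg f u (range g) (fslice tops V j l (subval x)).
    by apply: subset_closure; exact: (fslice_core he ad tops hV).
  pose a j l : A := sval (subval_ex HS (galg_slice j l)).
  have Kr j l : Kset e (rank_one (e j) (e l)) by exact: Kset_rank_one.
  pose r j l : K := sval (subval_ex (Kset_subalgebra he hd) (Kr j l)).
  exists [seq (a j l, r j l) | j <- iota 0 J, l <- iota 0 J].
  rewrite big_allpairs_dep /=; apply: subval_inj; rewrite [LHS]hJ subval_sum.
  rewrite -(big_mkord xpredT (fun j => \sum_(l < J) ftau tops V (fslice tops V j l (subval x))
    (rank_one (e j) (e l)))) /index_iota subn0.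
  apply: eq_bigr => j _; rewrite subval_sum.
  rewrite -(big_mkord xpredT (fun l => ftau tops V (fslice tops V j l (subval x))
    (rank_one (e j) (e l)))) /index_iota subn0.
  by apply: eq_bigr => l _; rewrite tauE /a /r; case: subval_ex => /= ? ->; case: subval_ex => /= ? ->.
exists idfun; split=> //; exists idfun => //.
Qed.

End StableAlgebra.

(** * Failure of stability *)

(** Only finitely many elements can have values below [n]. *)
Lemma infinite_injective_unbounded (T : Type) (X : set T) (h : T -> nat) :
  infinite_set X -> (forall x y, X x -> X y -> h x = h y -> x = y) ->
  forall n, exists2 x, X x & (n <= h x)%N.
Proof.
move=> iX hi n; apply: contrapT => no; apply: iX.
apply: (@sub_finite_set _ _ (\bigcup_(k in `I_n) [set x | X x /\ h x = k])).
  move=> x Xx; exists (h x) => //=; rewrite ltnNge; apply/negP => hx.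
  by apply: no; exists x.
apply: bigcup_finite => [|k _]; first exact: finite_II.
have [[x [Xx hx]]|nx] := pselect (exists x, X x /\ h x = k).
  apply: (@sub_finite_set _ _ [set x]); last exact: finite_set1.
  by move=> y [Xy hy]; apply: hi; rewrite ?hy.
by rewrite (_ : [set _ | _] = set0); [exact: finite_set0|apply/seteqP; split=> // x hx; case: nx; exists x].
Qed.

Lemma unitary_inner (R : realType) (H : hilbertType R) (e : nat -> H) (v : ft_unitary e) x y :
  inner (v x) (v y) = inner x y.
Proof. by rewrite bop_starP ftuK. Qed.

Lemma star_mul_isometric (R : realType) (H : hilbertType R) (a b : bop H) v :
  cmul (star a) a = cmul (star b) b -> nm (a v) = nm (b v).
Proof.
move=> ab; apply/eqP; rewrite -(@eqrXn2 _ 2) ?nm_ge0//; apply/eqP/complexI.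
by rewrite -!inner_nm (bop_starPr a) (bop_starPr b) -!bop_mulE ab.
Qed.

Lemma bfam_apply (R : realType) (H : hilbertType R) (I : Type) (x y : bfam I (bop H)) p v :
  nm (x p v - y p v) <= nm (x - y) * nm v.
Proof.
have h := bop_nm ((x - y) p) v; rewrite bfam_addE bfam_oppE bop_addE bop_oppE in h.
apply: le_trans h _; rewrite -bfam_oppE -bfam_addE.
by rewrite ler_wpM2r ?nm_ge0//; exact: (bfam_nm (x - y) p).
Qed.

Section Estimates.
Variables (R : realType) (H : hilbertType R).
Implicit Types a b v w x y : H.

Lemma nm_half v x y w : nm v = 1 -> nm (x - v) <= 1 / 16 -> nm y = nm x ->
  nm (y - w) <= 1 / 16 -> 1 / 2 <= nm w.
Proof.
move=> nv xv yx yw; have h1 := nmD (v - x) x; rewrite subrK nmB nv in h1.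
by have h2 := nmD (y - w) w; rewrite subrK in h2; lra.
Qed.

Lemma nm_near_unit v x : nm v = 1 -> nm (x - v) <= 1 / 16 -> nm x <= 2.
Proof. by move=> nv xv; have h := nmD (x - v) v; rewrite subrK nv in h; lra. Qed.

(** Origin of [1/16]: the two errors add up to at most [1/16 + 2 * (1/16) = 3/16], below the [1/4]
    guaranteed by the norming unitaries. *)
Lemma nm_inner_small a b a0 b0 : inner a b = 0 -> nm a <= 2 -> nm b0 = 1 ->
  nm (a - a0) <= 1 / 16 -> nm (b - b0) <= 1 / 16 -> nm (inner a0 b0) < 1 / 4.
Proof.
move=> ab na nb0 aa0; rewrite nmB => bb0.
have -> : inner a0 b0 = inner (a0 - a) b0 + inner a (b0 - b).
  by rewrite innerBl innerBr ab subr0 subrK.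
have h1 := cauchy_schwarz (a0 - a) b0; have h2 := cauchy_schwarz a (b0 - b).
have h3 := nmD (inner (a0 - a) b0) (inner a (b0 - b)).
rewrite nb0 mulr1 nmB in h1.
have h4 : nm a * nm (b0 - b) <= 2 * (1 / 16) by apply: ler_pM; rewrite ?nm_ge0.
lra.
Qed.

End Estimates.

Section NotStable.
Variables (R : realType) (H : hilbertType R) (e : nat -> H).
Hypothesis he : forall i j, inner (e i) (e j) = (i == j)%:R.
Variables (T : eqType) (f : T -> nat -> nat) (u : T -> nat -> ft_unitary e).
Hypothesis ad : forall s t, s != t -> exists N, forall n, (N <= n)%N -> f s n != f t n.
Variables (g : nat -> ft_unitary e) (below : T -> set T).
Hypothesis norming : forall n w, cut e n w = w -> 1 / 2 <= nm w ->
  exists j, 1 / 4 <= nm (inner w (g j (e 0%N))).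
Hypothesis uncountableT : ~ countable [set: T].
Hypothesis infinite_below : forall X : set T, ~ countable X ->
  exists2 t, X t & infinite_set [set s | X s /\ below t s].
Hypothesis luzin_below : forall t, exists h : T -> nat,
  (forall s s', below t s -> below t s' -> h s = h s' -> s = s') /\
  forall s, below t s -> forall j, (j <= h s)%N -> exists n,
    [/\ (h s <= n)%N, f t n = f s n & forall x, u t n x = u s n (g j x)].
Local Notation B := (bfam (nat * nat) (bop H)).
Local Notation HS := (galg_subalgebra he u ad setT).
Local Notation A := (subalg HS).

Lemma e0_nm : nm (e 0%N) = 1. Proof. exact: basis_nm. Qed.

Definition e00 := rank_one (e 0%N) (e 0%N).

Lemma e00_e0 : e00 (e 0%N) = e 0%N.
Proof. by rewrite rank_oneE he eqxx scale1r. Qed.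

Lemma projection_ex t : exists x : A, cmul x x = x /\
  forall n, subval x (n, f t n) = conj_by (u t n) e00.
Proof.
pose F (p : nat * nat) := if p.2 == f t p.1 then conj_by (u t p.1) e00 else 0.
have [x hx] := bfam_of_bound (F := F) (M := nm e00) ltac:(by move=> p; rewrite /F;
  case: ifP => _; rewrite ?nm0 ?nm_ge0// conj_by_nm).
have xt n : x (n, f t n) = conj_by (u t n) e00 by rewrite hx /F /= eqxx.
have idem : cmul e00 e00 = e00 by rewrite rank_one_mul he eqxx scale1r.
have cx : core f u setT x.
  (* Empty square and corner of size 1: the frame value is [e00] along the whole graph. *)
  exists [:: t], 0%N, 1%N; split=> //; split=> [p|p _ h|s n].
  - by rewrite /square ltn0.
  - by rewrite hx /F (negbTE (h t (mem_head _ _))).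
  rewrite inE => /eqP -> _; rewrite /frame !xt !conj_byK; split=> //.
  have e0E : cut e 1 (e 0%N) = e 0%N by rewrite (cut_basis he).
  apply/(fin_mxP he); split; first by rewrite rank_one_mull e0E.
  by rewrite rank_one_mulr cut_star e0E.
have [y hy] := subval_ex HS (subset_closure cx).
exists y; split=> [|n]; last by rewrite hy xt.
apply: subval_inj; rewrite subval_mul hy; apply: bfam_ext => p; rewrite bfam_mulE hx /F.
by case: ifP => _; rewrite ?cmul0l// -conj_by_mul idem.
Qed.

Lemma near_projection (x s : B) t n : x (n, f t n) = conj_by (u t n) e00 ->
  nm (s - x) <= 1 / 16 ->
  nm (s (n, f t n) (u t n (e 0%N)) - u t n (e 0%N)) <= 1 / 16.
Proof.
move=> xt sx; set v := u t n _.
have xv : x (n, f t n) v = v by rewrite /v xt /conj_by !bop_mulE ftuK e00_e0.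
rewrite -{2}xv; apply: le_trans (bfam_apply s x _ v) _.
by rewrite /v ftu_nm e0_nm mulr1.
Qed.

Lemma galg_not_stable : ~ stable A.
Proof.
(* Evaluations at the points of N x N are representations that determine the norm, as
   [stable_splitting] requires. *)
pose pi (p : nat * nat) (x : A) : bop H := subval x p.
move=> st; have [L [Lsep Lapp]] : exists L : nat -> A -> A -> Prop,
    (forall m s s' t t', L m s s' -> L m t t' ->
       cmul (star s') s' = cmul (star s) s /\ cmul (star s) t' = 0) /\
    (forall x d, cmul x x = x -> 0 < d -> exists m s s', L m s s' /\ nm (s - x) <= d).
  apply: (@stable_splitting R A (nat * nat) H pi) => [p c x y|p x y|p x|p x|x M M0 h|].
  - by rewrite /pi subval_linear bfam_addE bfam_scaleE.
  - by rewrite /pi subval_mul bfam_mulE.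
  - by rewrite /pi subval_star bfam_starE.
  - by rewrite -subval_nm; exact: bfam_nm.
  - by rewrite -subval_nm; exact: bfam_nm_le.
  exact: st.
have isometric m s s' p v : L m s s' -> nm (subval s' p v) = nm (subval s p v).
  move=> l; have [eq_ss _] := Lsep _ _ _ _ _ l l.
  apply: star_mul_isometric; rewrite -!bfam_starE -!bfam_mulE -!subval_star -!subval_mul.
  by rewrite eq_ss.
(* [k] collects the type [m], the rank [N] from which [s'] is close to the constant vector [w], and
   the norming index [j]: a countable set of values, fit for the pigeonhole principle. *)
have key t : exists k : nat * (nat * nat), exists (s s' x : A) (w : H),
    [/\ L k.1 s s', forall n, subval x (n, f t n) = conj_by (u t n) e00,
        nm (subval s - subval x) <= 1 / 16,
        forall n, (k.2.1 <= n)%N -> nm (subval s' (n, f t n) (u t n (e 0%N)) - u t n w) <= 1 / 16 &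
        1 / 4 <= nm (inner w (g k.2.2 (e 0%N)))].
  have [x [xx xt]] := projection_ex t.
  have [m [s [s' [l sx]]]] := Lapp x (1 / 16) xx ltac:(lra).
  rewrite -subval_nm subval_sub in sx.
  have /closure_nmle /(_ (1 / 16) ltac:(lra))[y [G0 [N1 [M1 [_ by0]]]] sy] := subvalP s'.
  (* The approximant [y] may not involve [t]. Adding [t] to its list of graphs makes the frame
     values of [y] along [t] eventually constant in any case. *)
  have sub : {subset G0 <= t :: G0} by move=> r rG; rewrite inE rG orbT.
  have [N2 h2] := block_mono he u ad N1 M1 sub.
  have [M2 h] := h2 N2 (leqnn _); have [_ _ y3] := h M2 (leqnn _) y by0.
  set N := N2 in y3; set M := M2 in y3.
  pose w := frame f u t N y (e 0%N).
  have outside n : (N <= n)%N -> ~~ square N (n, f t n).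
    by move=> Nn; rewrite /square /= ltnNge Nn.
  have yw n : (N <= n)%N -> y (n, f t n) (u t n (e 0%N)) = u t n w.
    move=> /outside nN; have [_ ey] := y3 t n (mem_head _ _) nN.
    by rewrite /w -ey /frame /conj_by' !bop_mulE ftuKV.
  have s'w n : (N <= n)%N -> nm (subval s' (n, f t n) (u t n (e 0%N)) - u t n w) <= 1 / 16.
    move=> Nn; rewrite -yw//; apply: le_trans sy.
    by have := bfam_apply (subval s') y (n, f t n) (u t n (e 0%N)); rewrite ftu_nm e0_nm mulr1.
  have cw : cut e M w = w.
    have [/(fin_mxP he)[y1 _] _] := y3 t N (mem_head _ _) (outside N (leqnn _)).
    by rewrite /w -bop_mulE y1.
  (* At [u t N (e 0)], [s'] has the same length as [s], which is nearly 1, and [w] is close to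
     it. *)
  have nw : 1 / 2 <= nm w.
    rewrite -(ftu_nm (u t N)); apply: (nm_half _ (near_projection (xt N) sx)).
    - by rewrite ftu_nm e0_nm.
    - exact: isometric l.
    - exact: s'w.
  have [j hj] := norming cw nw.
  by exists (m, (N, j)), s, s', x, w.
have [k hk] := choice key.
have [[m [N j]] /infinite_below[t [_ kt] inf]] := pigeonhole_countable k uncountableT.
have [h [hi hL]] := luzin_below t.
(* [h r >= N] puts the meeting point where both approximations are valid, and [h r >= j] makes the
   twist [j] available. *)
have [r [[_ kr] rt] hr] : exists2 r, ([set: T] r /\ k r = (m, (N, j))) /\ below t r & (maxn N j <= h r)%N.
  by apply: (infinite_injective_unbounded inf) => x y [_ hx] [_ hy]; exact: hi.
have [n [hn ft ut]] := hL r rt j (leq_trans (leq_maxr _ _) hr).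
have Nn : (N <= n)%N by apply: leq_trans hn; apply: leq_trans hr; exact: leq_maxl.
have [s [s' [x [w [l xt sx _ _]]]]] := hk t; have [s2 [s2' [x2 [w2 [l2 xr sx2 s2w gw]]]]] := hk r.
rewrite kt /= in l; rewrite kr /= in l2 s2w gw.
have [_ sep] := Lsep _ _ _ _ _ l l2.
pose p := (n, f r n).
pose a := subval s2' p (u r n (e 0%N)); pose b := subval s p (u t n (e 0%N)).
have ab : inner a b = 0.
  rewrite /b bop_starPr.
  have z : star (subval s p) a = 0.
    have hz := congr1 (fun c : A => subval c p (u r n (e 0%N))) sep; exact: hz.
  by rewrite z inner0l.
have na : nm a <= 2.
  rewrite /a (isometric _ _ _ _ _ l2); apply: (nm_near_unit _ (near_projection (xr n) sx2)).
  by rewrite ftu_nm e0_nm.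
(* As [u t n (e 0) = u r n (g j (e 0))], the unitary [u r n] cancels and the lower bound for [w2]
   remains. *)
have gw' : 1 / 4 <= nm (inner (u r n w2) (u t n (e 0%N))) by rewrite ut unitary_inner.
suff : nm (inner (u r n w2) (u t n (e 0%N))) < 1 / 4 by rewrite ltNge gw'.
apply: (nm_inner_small ab na _ (s2w n Nn)); first by rewrite ftu_nm e0_nm.
by rewrite /b /p -ft; exact: near_projection (xt n) sx.
Qed.

End NotStable.

(** * The union of the chain *)

Lemma countable_range (T : Type) (X : set T) x0 : X x0 -> countable X ->
  exists g : nat -> T, range g = X.
Proof.
move=> Xx0 /countable_injP[h hi].
have /choice[g hg] : forall n, exists y, X y /\ forall x, X x -> h x = n -> y = x.
  move=> n; have [[y [Xy hy]]|ny] := pselect (exists y, X y /\ h y = n).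
    by exists y; split=> // x Xx hx; apply: hi; rewrite ?inE// hx.
  by exists x0; split=> // x Xx hx; case: ny; exists x.
exists g; apply/seteqP; split=> [_ [n _ <-]|x Xx]; first by case: (hg n).
by exists (h x) => //; have [_] := hg (h x); exact.
Qed.

Lemma countable_image_inj (T U : Type) (h : T -> U) (X : set T) : injective h ->
  countable (h @` X) -> countable X.
Proof.
move=> hi /countable_injP[k ki]; apply/countable_injP; exists (k \o h).
by move=> x y; rewrite !inE => Xx Xy /ki /= hxy; apply/hi/hxy; rewrite inE; [exists x|exists y].
Qed.

Section Ideals.
Variables (R : realType) (H : hilbertType R) (e : nat -> H).
Hypothesis he : forall i j, inner (e i) (e j) = (i == j)%:R.
Hypothesis hd : closure [set x | exists (n : nat) (c : nat -> R[i]),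
  x = \sum_(i < n) c i *: e i] = setT.
Variable tops : tensor_ops e.
Variables (d : Order.disp_t) (T : orderType d) (f : T -> nat -> nat) (u : T -> nat -> ft_unitary e).
Hypothesis ad : forall s t, s != t -> exists N, forall n, (N <= n)%N -> f s n != f t n.
Local Notation HS := (galg_subalgebra he u ad setT).
Local Notation A := (subalg HS).

Definition gideal (X : set T) : set A := [set x | galg f u X (subval x)].

Lemma gideal_closed_ideal X : closed_ideal (gideal X).
Proof.
have [[X0 Xl] _ _ Xc] := galg_subalgebra he u ad X; split.
- by split=> [//|c x y]; exact: Xl.
- by move=> a x Xx; apply: (galg_ideal' he ad Xx); exact: subvalP.
- by move=> a x Xx; apply: (galg_ideal he ad Xx); exact: subvalP.
move=> x /closure_nmle hx; apply: Xc; apply/closure_nmle => r r0.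
by have [y Xy xy] := hx r r0; exists (subval y).
Qed.

Lemma gideal_as_cstar_algebra X : countable X -> X !=set0 ->
  as_cstar_algebra (gideal X) (fun B => separable B /\ stable B /\ AF B).
Proof.
move=> cX [x0 Xx0].
have sub : galg f u X `<=` galg f u setT by exact: galg_mono.
pose B := subalg (galg_subalgebra he u ad X).
pose h (x : B) : A := sval (subval_ex HS (sub _ (subvalP x))).
have hE x : subval (h x) = subval x by rewrite /h; case: subval_ex.
have h_lin : linear h.
  by move=> c x y; apply: subval_inj; rewrite hE !subval_linear !hE.
pose lh := GRing.isLinear.Build R[i] B A *:%R h h_lin.
pose hh : {linear B -> A} := HB.pack h lh.
exists B, hh; split.
- by split=> [x y|x]; apply: subval_inj; rewrite ?subval_mul ?subval_star !hE.
- move=> x y hxy; apply: subval_inj; rewrite -hE -(hE y).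
  have {}hxy : h x = h y := hxy; by rewrite hxy.
- apply/seteqP; split=> [_ [x _ <-]|x Xx]; first by rewrite /gideal /= hE; exact: subvalP.
  by have [y hy] := subval_ex (galg_subalgebra he u ad X) Xx; exists y => //; apply: subval_inj; rewrite hE.
rewrite /B; have [g <-] := countable_range Xx0 cX.
split; first exact: galg_separable.
by split; [exact: galg_stable|exact: galg_AF].
Qed.

(** An element of the core involves finitely many data, and these have an upper bound in the chain;
    [j0] serves when there are none. *)
Lemma gideal_dense (j0 : T) :
  closure (\bigcup_(j in [set: T]) gideal [set s | (s <= j)%O]) = setT.
Proof.
rewrite -(closure_subval HS (F := \bigcup_j galg f u [set s | (s <= j)%O])).
- by congr closure; apply/seteqP; split=> x [j _ hx]; exists j.
- by move=> x [j _]; apply: galg_mono.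
apply: closureS => x [G [N [M [_ bx]]]].
have [j hj] : exists j, forall t, t \in G -> (t <= j)%O.
  elim: G {bx} => [|t G [j hj]]; first by exists j0.
  exists (Order.max t j) => s; rewrite inE le_max => /orP[/eqP->|/hj->]; first by rewrite lexx.
  by rewrite orbT.
by exists j => //; apply: subset_closure; exists G, N, M.
Qed.

End Ideals.

Lemma uncountable_union (R : realType) (H : hilbertType R) (e : nat -> H) :
  (forall i j, inner (e i) (e j) = (i == j)%:R) ->
  closure [set x | exists (n : nat) (c : nat -> R[i]), x = \sum_(i < n) c i *: e i] = setT ->
  tensor_ops e ->
  exists (A : cstarAlgType R) (d : Order.disp_t) (J : orderType d)
         (I : J -> set A),
    AF A /\
    ~ countable [set: J] /\
    (forall j, closed_ideal (I j)) /\
    (forall j j' : J, (j <= j')%O -> I j `<=` I j') /\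
    (forall j, as_cstar_algebra (I j)
                 (fun B => separable B /\ stable B /\ AF B)) /\
    closure (\bigcup_(j in [set: J]) I j) = [set: A] /\
    ~ stable A.
Proof.
move=> he hd tops.
have [g hg] := norming_unitaries he.
have [u0 _] := ft_id_ex e.
(* The twist is multiplication on the right by [g j], so that it acts on [e 0] before the old
   unitary does. *)
have /choice[act hact] : forall v : ft_unitary e, exists a : nat -> ft_unitary e,
    forall j x, a j x = v (g j x).
  by move=> v; have /choice[a ha] := fun j => ft_mul_ex v (g j); exists a.
have [C [nC cC adC luC]] := uncountable_chain (luzin_step u0 act).
(* The chain of data is its own index set: the ideal of [j] comes from the data up to [j], which are
   countably many. *)
pose J := so_sort C.
pose f (s : J) := (sval s).1; pose u (s : J) := (sval s).2.
have ad (s t : J) : s != t -> exists N, forall n, (N <= n)%N -> f s n != f t n.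
  move=> st; have [|N hN] := adC _ _ (svalP s) (svalP t).
    by move=> /so_val_inj /eqP; rewrite (negbTE st).
  by exists N => n /hN /eqP.
have sval_set (X : set J) : sval @` X `<=` so_set C by move=> _ [x _ <-]; exact: svalP.
have nJ : ~ countable [set: J].
  move=> cJ; apply: nC; have := @card_image_le _ _ (sval : J -> _) setT.
  have -> : sval @` [set: J] = so_set C.
    by apply/seteqP; split=> // x Cx; exists (exist _ x Cx).
  by move=> h; exact: card_le_trans h cJ.
have [j0 _] : exists j : J, True.
  apply: contrapT => nj; apply: nJ; rewrite (_ : setT = set0); first exact: countable0.
  by apply/seteqP; split=> // j _; apply: nj; exists j.
pose below (t : J) := [set s : J | so_le C (sval s) (sval t) /\ sval s <> sval t].
exists (subalg (galg_subalgebra he u ad setT)), (Order.Disp tt tt), (so_sort C).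
exists (fun j : J => gideal [set s : J | (s <= j)%O]).
split; first exact: galg_AF.
split=> //; split; first by move=> j; exact: gideal_closed_ideal.
split.
  move=> j j' jj' x; apply: galg_mono => s /= sj; exact: le_trans sj jj'.
split.
  move=> j; have key := @gideal_as_cstar_algebra R H e he hd tops _ (so_sort C) f u ad [set s : J | (s <= j)%O].
  apply: key; last by exists j; exact: lexx.
  apply: (countable_image_inj (@so_val_inj _ C)).
  apply: sub_countable (cC _ (svalP j)); apply: subset_card_le => _ [s sj <-].
  by split; [have := sj; rewrite /= so_leE => /asboolP|exact: svalP].
split; first exact: gideal_dense.
apply: (@galg_not_stable _ _ _ he _ _ _ ad g below) => //.
- move=> X nX; have [|t [t' Xt' <-] inf] := uncountable_infinite_pred cC (sval_set X).
    by move=> /(countable_image_inj (@so_val_inj _ C)).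
  exists t' => // fin; apply: inf.
  apply: sub_finite_set (finite_image sval fin) => _ [[s Xs <-] st nst].
  by exists s.
- move=> t; have [h [hi hh]] := luC _ (svalP t); exists (h \o sval); split.
    move=> s s' [st nst] [s't ns't] hss; apply/so_val_inj/hi => //; rewrite inE; split=> //; exact: svalP.
  move=> s [st nst] j js; have [|n [hn fn un]] := hh (sval s) _ j js.
    by split=> //; exact: svalP.
  by exists n; split=> // x; rewrite -hact -un.
Qed.

Theorem theorem1p4 (R : realType) :
  exists (A : cstarAlgType R) (d : Order.disp_t) (J : orderType d)
         (I : J -> set A),
    AF A /\
    ~ countable [set: J] /\
    (forall j, closed_ideal (I j)) /\
    (forall j j' : J, (j <= j')%O -> I j `<=` I j') /\
    (forall j, as_cstar_algebra (I j)
                 (fun B => separable B /\ stable B /\ AF B)) /\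
    closure (\bigcup_(j in [set: J]) I j) = [set: A] /\
    ~ stable A.
Proof.
have [tops _] := l2h_tensor_ops R.
exact: (uncountable_union (@l2e_orthonormal R) (@l2e_dense R) tops).
Qed.
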